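(* Let $\xi$ be an extremal real number. Then there exists an unbounded admissible Fibonacci sequence $(W_i)_{i\ge 1}$ in ${\mathcal{P}}$ which satisfies \[ \|W_{i+1}\| \asymp \|W_i\|^\gamma, \quad \|(\xi,-1)W_i\| \asymp \|W_i\|^{-1} \quad\mbox{and}\quad |\det W_i| \asymp 1 \qquad (\ast) \] with implied constants independent of $i$. Such a sequence is uniquely determined by $\xi$ up to its first terms and up to term-by-term multiplication by a Fibonacci sequence in $\{\pm 1\}$; that is, if $(W_i)_{i\ge1}$ and $(W'_i)_{i\ge1}$ are two unbounded admissible Fibonacci sequences in ${\mathcal{P}}$ both satisfying $(\ast)$ for the same $\xi$, then there are integers $k,\ell\ge 0$ and a sequence $(\epsilon_i)$ in $\{-1,1\}$ with $\epsilon_{i+2}=\epsilon_{i+1}\epsilon_i$ such that $W'_{i+k}=\epsilon_i W_{i+\ell}$ for all sufficiently large $i$. Conversely, any unbounded admissible Fibonacci sequence $(W_i)_{i\ge 1}$ in ${\mathcal{P}}$ which satisfies \[ \|W_{i+2}\| \gg \|W_{i+1}\| \|W_i\| \quad\mbox{and}\quad |\det W_i| \ll 1 \] (with constants independent of $i$) also satisfies $(\ast)$ for some extremal real number $\xi$.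
   Context: Let $\gamma=(1+\sqrt5)/2$. A real number $\xi$ is extremal if it is neither rational nor quadratic over $\mathbb{Q}$ and there is a constant $c>0$ such that for every real $X\ge1$ the system $|x_0|\le X$, $|x_0\xi-x_1|\le cX^{-1/\gamma}$, $|x_0\xi^2-x_2|\le cX^{-1/\gamma}$ has a non-zero solution $(x_0,x_1,x_2)\in\mathbb{Z}^3$. The content $c(A)$ of a non-zero $A\in\mathrm{Mat}_{2\times2}(\mathbb{Z})$ is the positive gcd of its entries; $A$ is primitive if $c(A)=1$, and $A^{\mathrm{red}}$ denotes the primitive matrix with $A=c(A)A^{\mathrm{red}}$. ${\mathcal{P}}$ is the set of primitive integer $2\times2$ matrices with non-zero determinant; it is a group under $A*B=(AB)^{\mathrm{red}}$. A Fibonacci sequence in ${\mathcal{P}}$ is a sequence with $W_{i+2}=W_{i+1}*W_i$ for all $i\ge1$. It is admissible if there is a matrix $N\in{\mathcal{P}}$ which is neither symmetric nor skew-symmetric such that, putting $N_i={}^tN$ for $i$ odd and $N_i=N$ for $i$ even, $W_iN_i$ is symmetric for every $i\ge1$. The norm $\|A\|$ of a real matrix (or vector) is the maximum absolute value of its entries. $A\asymp B$ means $A\ll B$ and $B\ll A$, where $A\ll B$ means $A\le CB$ for a constant $C>0$ independent of $i$. *)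

(* Defs.v *)
From mathcomp Require Import all_boot all_order all_algebra.
From mathcomp Require Import all_classical all_reals all_analysis.

Set Implicit Arguments.
Unset Strict Implicit.
Unset Printing Implicit Defensive.

Import Order.TTheory GRing.Theory Num.Theory.
Local Open Scope ring_scope.

(* All sequences are indexed by the integers i >= 1. They are represented by
   functions on nat whose value at 0 is never constrained. *)

Definition golden (R : realType) : R := (1 + Num.sqrt 5) / 2.

Definition quadratic (R : realType) (xi : R) : Prop :=
  exists p : {poly rat},
    [/\ size p = 3%N, irreducible_poly p & root (map_poly ratr p) xi].

Definition extremal (R : realType) (xi : R) : Prop :=
  [/\ ~ rational xi, ~ quadratic xi &
    exists c : R, 0 < c /\
      forall X : R, 1 <= X ->
        exists x0 x1 x2 : int,
          [/\ (x0, x1, x2) <> (0, 0, 0),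
              `|x0%:~R : R| <= X,
              `|x0%:~R * xi - x1%:~R| <= c * X `^ (- (golden R)^-1) &
              `|x0%:~R * xi ^+ 2 - x2%:~R| <= c * X `^ (- (golden R)^-1)]].

Definition mx_content (A : 'M[int]_2) : nat :=
  \big[gcdn/0%N]_(i < 2) \big[gcdn/0%N]_(j < 2) `|A i j|%N.

Definition primitive_mx (A : 'M[int]_2) : Prop := mx_content A = 1%N.

Definition mx_red (A : 'M[int]_2) : 'M[int]_2 :=
  \matrix_(i, j) (A i j %/ (mx_content A)%:Z)%Z.

Definition calP (A : 'M[int]_2) : Prop := primitive_mx A /\ \det A != 0.

Definition starmul (A B : 'M[int]_2) : 'M[int]_2 := mx_red (A *m B).

Definition fibonacci_seq (W : nat -> 'M[int]_2) : Prop :=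
  (forall i, (1 <= i)%N -> calP (W i)) /\
  (forall i, (1 <= i)%N -> W i.+2 = starmul (W i.+1) (W i)).

Definition symmetric_mx (A : 'M[int]_2) : Prop := A^T = A.

Definition skew_symmetric_mx (A : 'M[int]_2) : Prop := A^T = - A.

Definition admissible (W : nat -> 'M[int]_2) : Prop :=
  exists N : 'M[int]_2,
    [/\ calP N, ~ symmetric_mx N, ~ skew_symmetric_mx N &
      forall i, (1 <= i)%N ->
        symmetric_mx (W i *m (if odd i then N^T else N))].

Definition norm_int (R : realType) (A : 'M[int]_2) : R :=
  mx_norm (map_mx intr A : 'M[R]_2).

Definition unbounded (R : realType) (W : nat -> 'M[int]_2) : Prop :=
  forall B : R, exists i, (1 <= i)%N /\ B < norm_int R (W i).

Definition lesssim (R : realType) (f g : nat -> R) : Prop :=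
  exists C : R, 0 < C /\ forall i, (1 <= i)%N -> f i <= C * g i.

Definition asympt (R : realType) (f g : nat -> R) : Prop :=
  lesssim f g /\ lesssim g f.

(* The norm of the row vector (xi, -1) A. *)
Definition norm_row (R : realType) (xi : R) (A : 'M[int]_2) : R :=
  mx_norm ((\row_(j < 2) [:: xi; -1]`_j) *m map_mx intr A : 'rV[R]_2).

Definition abs_det (R : realType) (A : 'M[int]_2) : R := `|(\det A)%:~R|.

Definition star_condition (R : realType) (xi : R)
    (W : nat -> 'M[int]_2) : Prop :=
  [/\ asympt (fun i => norm_int R (W i.+1))
             (fun i => norm_int R (W i) `^ golden R),
      asympt (fun i => norm_row xi (W i))
             (fun i => (norm_int R (W i))^-1) &
      asympt (fun i => abs_det R (W i)) (fun=> 1)].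

Definition unbounded_admissible_fibonacci (R : realType)
    (W : nat -> 'M[int]_2) : Prop :=
  [/\ fibonacci_seq W, admissible W & unbounded R W].

Definition sign_fibonacci_seq (eps : nat -> int) : Prop :=
  (forall i, (1 <= i)%N -> eps i = 1 \/ eps i = -1) /\
  (forall i, (1 <= i)%N -> eps i.+2 = eps i.+1 * eps i).

(* Main.v *)
(* Identify (x0, x1, x2) with the symmetric matrix (x0, x1; x1, x2), and write
   |x| for its norm and L(x) for that of (xi, -1) x.  Everything is reduced to
   sequences (y_i) of symmetric integer matrices with |y_{i+2}| =~= |y_{i+1}| |y_i|,
   L(y_i) << 1/|y_i|, non-zero determinant, and y_i, y_{i+1}, y_{i+2} linearly
   independent.
   - If xi is extremal, the minimal points x_k such that x_{k-1}, x_k, x_{k+1} are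
     linearly independent form such a sequence.
   - Given (y_i), size estimates for 3x3 determinants show that
     y_{i+2} adj(y_{i+3}) y_{i+2} is proportional to y_i; hence the matrices
     N_{i+1} ~ y_i adj(y_{i+2}) y_{i+1} satisfy N_{i+1} ~ tN_i, and
     W_i ~ y_i adj(N_i) is an admissible Fibonacci sequence.  Conversely
     y_i = W_i N_i recovers (y_i), and N is not symmetric precisely because
     three consecutive y_i are linearly independent.
   - Two such sequences for the same xi agree from some point on up to
     proportionality and a shift, again because 3x3 determinants of nearby terms
     are integers of absolute value less than 1.
   - If (W_i) satisfies the growth condition, then adj(y_i) y_{i+1} is small with
     respect to |y_i| |y_{i+1}|, so the directions of the y_i converge to that of
     (1, xi, xi^2) for some real xi. *)

Require Import Defs.
From mathcomp Require Import all_boot all_order all_algebra.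
From mathcomp Require Import all_classical all_reals all_analysis.
From mathcomp Require Import ring lra zify.

Set Implicit Arguments.
Unset Strict Implicit.
Unset Printing Implicit Defensive.

Import Order.TTheory GRing.Theory Num.Theory.
Local Open Scope ring_scope.

(** * Two by two matrices *)

(** The algebra is done up to rational scalars: [~~] is equality in projective space and the
    adjugate stands for the inverse, so contents need not be tracked. Sizes come back at the end,
    because the determinants of the y_i are non-zero integers of bounded absolute value, which
    bounds the scalars lost in passing from [y] to [W]. Growth is encoded by [gpow]: the conditions
    |y_{i+2}| =~= |y_{i+1}| |y_i| and |y_{i+1}|^(1/gamma) =~= |y_i| are equivalent, the only input
    being 1/gamma + 1/gamma^2 = 1. For an extremal number the obstacle is that minimal points a
    priori satisfy only L(x_k) << |x_{k+1}|^(-1/gamma). Two non-zero integers close the gap: det x_k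
    for large k gives |x_{k+1}|^(1/gamma) << |x_k|, and the 3x3 determinant of an independent triple
    gives a bound in the opposite direction. Between two such triples the points stay in one plane,
    where the wedge products of neighbours do not increase, so the skipped points cost only a
    constant. *)

Lemma ord2P (i : 'I_2) : i = 0 \/ i = 1.
Proof. by case: i => [[|[|i]]] // h; [left|right]; apply/val_inj. Qed.

Lemma mx2P (T : Type) (A B : 'M[T]_2) :
  A 0 0 = B 0 0 -> A 0 1 = B 0 1 -> A 1 0 = B 1 0 -> A 1 1 = B 1 1 -> A = B.
Proof.
move=> h00 h01 h10 h11; apply/matrixP => i j.
by case: (ord2P i) => ->; case: (ord2P j) => ->.
Qed.

Lemma mul2E (S : pzSemiRingType) (m n : nat) (A : 'M[S]_(m, 2)) (B : 'M[S]_(2, n)) i j :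
  (A *m B) i j = A i 0 * B 0 j + A i 1 * B 1 j.
Proof.
rewrite mxE !big_ord_recl big_ord0 addr0.
by have -> : lift ord0 ord0 = 1 :> 'I_2 by apply/val_inj.
Qed.

Lemma lift2E : (lift 0 0 = 1 :> 'I_2) * (lift 1 0 = 0 :> 'I_2).
Proof. by split; apply/val_inj. Qed.

Lemma det2E (S : comNzRingType) (A : 'M[S]_2) :
  \det A = A 0 0 * A 1 1 - A 0 1 * A 1 0.
Proof.
rewrite (expand_det_row _ 0) !big_ord_recl big_ord0 addr0 /cofactor.
rewrite !det_mx11 !mxE !lift2E /=.
by rewrite /bump /= !addn0 expr0 expr1; ring.
Qed.

Lemma adj2E (S : comNzRingType) (A : 'M[S]_2) :
  [/\ (\adj A) 0 0 = A 1 1, (\adj A) 0 1 = - A 0 1,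
      (\adj A) 1 0 = - A 1 0 & (\adj A) 1 1 = A 0 0].
Proof.
by split; rewrite !mxE /cofactor det_mx11 !mxE ?lift2E /=;
  rewrite ?addn0 ?add0n ?expr0 ?expr1 ?sqrrN ?expr1n ?mul1r ?mulN1r.
Qed.

Ltac adjE A :=
  let h00 := fresh in let h01 := fresh in let h10 := fresh in
  let h11 := fresh in
  case: (@adj2E _ A) => h00 h01 h10 h11;
  rewrite ?h00 ?h01 ?h10 ?h11; clear h00 h01 h10 h11.

Lemma adj2M (S : comNzRingType) (A B : 'M[S]_2) :
  \adj (A *m B) = \adj B *m \adj A.
Proof.
by apply: mx2P; rewrite ?mul2E; adjE (A *m B); adjE A; adjE B;
  rewrite !mul2E; ring.
Qed.

Lemma adj2K (S : comNzRingType) (A : 'M[S]_2) : \adj (\adj A) = A.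
Proof.
by apply: mx2P; adjE (\adj A); adjE A; rewrite ?opprK.
Qed.

Lemma adj2Z (S : comNzRingType) c (A : 'M[S]_2) : \adj (c *: A) = c *: \adj A.
Proof.
by apply: mx2P; rewrite ![(_ *: \adj A) _ _]mxE; adjE (c *: A); adjE A; rewrite !mxE ?mulrN.
Qed.

Lemma det_adj2 (S : comNzRingType) (A : 'M[S]_2) : \det (\adj A) = \det A.
Proof. by rewrite !det2E; adjE A; ring. Qed.

Lemma adj2_tr (S : comNzRingType) (A : 'M[S]_2) : \adj A^T = (\adj A)^T.
Proof.
by apply: mx2P; rewrite ![((\adj A)^T) _ _]mxE; adjE (A^T); adjE A; rewrite !mxE.
Qed.

(** The determinant of the coordinate rows (x_0, x_1, x_2) of the three points. The entries [1 0]
    are never read, so it is meant for symmetric matrices. *)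
Definition det3 (S : comNzRingType) (a b c : 'M[S]_2) : S :=
  c 0 0 * (a 0 1 * b 1 1 - a 1 1 * b 0 1) -
  c 0 1 * (a 0 0 * b 1 1 - a 1 1 * b 0 0) +
  c 1 1 * (a 0 0 * b 0 1 - a 0 1 * b 0 0).

(* With J the standard skew matrix and c = b M a = a M^T b, up to sign
   det3 a b c = tr (J b J a J c) = tr ((b J b) J (a J a) M^T), and
   x J x = \det x *: J for symmetric x. *)
Lemma det3_mul (S : comNzRingType) (a b M : 'M[S]_2) :
  a^T = a -> b^T = b -> (b *m M *m a)^T = b *m M *m a ->
  det3 a b (b *m M *m a) = \det a * \det b * (M 1 0 - M 0 1).
Proof.
move=> /matrixP/(_ 0 1); rewrite mxE => ha /matrixP/(_ 0 1); rewrite mxE => hb.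
set c := b *m M *m a => /matrixP/(_ 0 1); rewrite mxE => hc.
have -> : det3 a b c = c 0 0 * (a 0 1 * b 1 1 - a 1 1 * b 0 1) +
  c 0 1 * (a 0 1 * b 0 1 - a 0 0 * b 1 1) +
  c 1 0 * (a 1 1 * b 0 0 - a 0 1 * b 0 1) +
  c 1 1 * (a 0 0 * b 0 1 - a 0 1 * b 0 0).
  by rewrite /det3 hc; ring.
by rewrite /c !det2E !mul2E ha hb; ring.
Qed.

(** Equality up to a rational scalar, cleared of denominators. Requiring both scalars to be non-zero
    makes it an equivalence relation, even at the zero matrix. *)
Definition proportional (A B : 'M[int]_2) : Prop :=
  exists s t : int, [/\ s != 0, t != 0 & s *: A = t *: B].

Notation "A ~~ B" := (proportional A B) (at level 70).

Lemma prop_refl A : A ~~ A.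
Proof. by exists 1, 1. Qed.

Lemma prop_sym A B : A ~~ B -> B ~~ A.
Proof. by move=> [s [t [hs ht h]]]; exists t, s. Qed.

Lemma prop_trans A B C : A ~~ B -> B ~~ C -> A ~~ C.
Proof.
move=> [s [t [hs ht h]]] [u [v [hu hv h']]].
exists (u * s), (t * v); split; rewrite ?mulf_neq0 //.
have -> : (t * v) *: C = t *: (u *: B) by rewrite h' scalerA.
by rewrite -scalerA h !scalerA mulrC.
Qed.

Lemma prop_mul A A' B B' : A ~~ A' -> B ~~ B' -> A *m B ~~ A' *m B'.
Proof.
move=> [s [t [hs ht h]]] [u [v [hu hv h']]].
exists (s * u), (t * v); split; rewrite ?mulf_neq0 //.
have e (k l : int) (X Y : 'M[int]_2) : (k * l) *: (X *m Y) = (k *: X) *m (l *: Y).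
  by rewrite -scalemxAl -scalemxAr scalerA.
by rewrite !e h h'.
Qed.

Lemma prop_adj A B : A ~~ B -> \adj A ~~ \adj B.
Proof.
by move=> [s [t [hs ht h]]]; exists s, t; split; rewrite // -!adj2Z h.
Qed.

Lemma prop_tr A B : A ~~ B -> A^T ~~ B^T.
Proof.
by move=> [s [t [hs ht h]]]; exists s, t; split; rewrite // -!linearZ h.
Qed.

Lemma prop_scale (s : int) A : s != 0 -> s *: A ~~ A.
Proof. by move=> hs; exists 1, s; split; rewrite ?scale1r. Qed.

Lemma prop_adj_mulr A B : \det A != 0 -> A *m \adj A *m B ~~ B.
Proof. by move=> h; rewrite mul_mx_adj mul_scalar_mx; exact: prop_scale. Qed.

Lemma prop_adj_mull A B : \det A != 0 -> \adj A *m A *m B ~~ B.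
Proof. by move=> h; rewrite mul_adj_mx mul_scalar_mx; exact: prop_scale. Qed.

Lemma prop_mulr_adj A B : \det A != 0 -> B *m A *m \adj A ~~ B.
Proof.
by move=> h; rewrite -mulmxA mul_mx_adj mul_mx_scalar; exact: prop_scale.
Qed.

Lemma prop_mull_adj A B : \det A != 0 -> B *m \adj A *m A ~~ B.
Proof.
by move=> h; rewrite -mulmxA mul_adj_mx mul_mx_scalar; exact: prop_scale.
Qed.

Lemma prop_det A B : A ~~ B -> \det A != 0 -> \det B != 0.
Proof.
move=> [s [t [hs ht h]]] hA; have := congr1 determinant h.
rewrite !detZ => e; apply/eqP => hB; move: e; rewrite hB mulr0 => /eqP.
by rewrite mulf_eq0 (negbTE hA) orbF; apply/negP; exact: expf_neq0.
Qed.

(** * Content and primitive matrices *)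

Lemma content_dvd (A : 'M[int]_2) i j : (mx_content A %| `|A i j|)%N.
Proof.
by apply: (biggcdn_inf i) => //; apply: (biggcdn_inf j).
Qed.

Lemma dvd_content (A : 'M[int]_2) d : (forall i j, (d %| `|A i j|)%N) -> (d %| mx_content A)%N.
Proof. by move=> h; apply/dvdn_biggcdP => i _; apply/dvdn_biggcdP => j _. Qed.

Lemma content_gt0 A : A != 0 -> (0 < mx_content A)%N.
Proof.
move=> hA; rewrite lt0n; apply: contra hA => /eqP h; apply/eqP/matrixP => i j.
have := content_dvd A i j; rewrite h dvd0n absz_eq0 mxE => /eqP //.
Qed.

Lemma det_neq0 (S : comNzRingType) (A : 'M[S]_2) : \det A != 0 -> A != 0.
Proof. by apply: contra => /eqP ->; rewrite det2E !mxE mul0r subr0. Qed.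

Lemma content_red A : A = (mx_content A)%:Z *: mx_red A.
Proof.
apply/matrixP => i j; rewrite !mxE mulrC divzK //.
by rewrite dvdzE /= content_dvd.
Qed.

Lemma contentZ (s : int) A : mx_content (s *: A) = (`|s| * mx_content A)%N.
Proof.
apply/eqP; rewrite eqn_dvd; apply/andP; split; last first.
  by apply: dvd_content => i j; rewrite mxE abszM dvdn_mul ?content_dvd.
have [->|hs] := eqVneq s 0; first by rewrite absz0 mul0n dvdn0.
have hs' : (0 < `|s|)%N by rewrite absz_gt0.
have /dvdnP [q hq] : (`|s| %| mx_content (s *: A))%N.
  by apply: dvd_content => i j; rewrite mxE abszM dvdn_mulr.
rewrite hq mulnC dvdn_pmul2l //; apply: dvd_content => i j.
have := content_dvd (s *: A) i j.
by rewrite hq mxE abszM mulnC dvdn_pmul2l.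
Qed.

Lemma red_primitive A : A != 0 -> primitive_mx (mx_red A).
Proof.
move=> /content_gt0 h; have := congr1 mx_content (content_red A).
rewrite contentZ absz_nat => e; rewrite /primitive_mx.
by apply/eqP; rewrite -(eqn_pmul2l h) muln1 -e.
Qed.

Lemma prop_red A : A != 0 -> mx_red A ~~ A.
Proof.
move=> h; exists (mx_content A)%:Z, 1; split => //.
  by have := content_gt0 h; case: (mx_content A).
by rewrite -content_red scale1r.
Qed.

Lemma red_calP A : \det A != 0 -> calP (mx_red A).
Proof.
move=> h; have h0 := det_neq0 h; split; first exact: red_primitive.
exact: prop_det (prop_sym (prop_red h0)) h.
Qed.

(** Comparing contents in t B = s A shows that t divides s: a primitive matrix generates all
    integral matrices on its line. *)
Lemma primitive_prop A B : primitive_mx A -> B ~~ A ->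
  exists2 r : int, r != 0 & B = r *: A.
Proof.
move=> hA [t [s [ht hs h]]].
have hd : (`|t| %| `|s|)%N.
  rewrite -[X in (_ %| X)%N]muln1 -[X in (_ * X)%N]hA -contentZ -h contentZ.
  exact: dvdn_mulr.
have {}hd : (t %| s)%Z by rewrite dvdzE.
exists (s %/ t)%Z.
  by apply: contra hs => /eqP e; rewrite -(divzK hd) e mul0r.
apply/eqP; rewrite -subr_eq0; have := scalemx_eq0 t (B - (s %/ t)%Z *: A).
by rewrite (negbTE ht) /= => <-; rewrite scalerBr scalerA mulrC divzK // h subrr.
Qed.

Lemma primitive_prop2 A B : primitive_mx A -> primitive_mx B -> B ~~ A ->
  exists e : int, (e = 1 \/ e = -1) /\ B = e *: A.
Proof.
move=> hA hB /(primitive_prop hA)[r r0 h]; exists r; split=> //.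
have := congr1 mx_content h; rewrite contentZ hA hB muln1.
by clear; lia.
Qed.

Lemma starmul_prop A B : \det A != 0 -> \det B != 0 -> starmul A B ~~ A *m B.
Proof. by move=> hA hB; apply/prop_red/det_neq0; rewrite det_mulmx mulf_neq0. Qed.

Lemma starmul_calP A B : \det A != 0 -> \det B != 0 -> calP (starmul A B).
Proof. by move=> hA hB; apply/red_calP; rewrite det_mulmx mulf_neq0. Qed.

Lemma red_sign (e : int) A : e = 1 \/ e = -1 -> mx_red (e *: A) = e *: mx_red A.
Proof.
move=> he; have e1 : `|e|%N = 1%N by case: he => ->.
apply/matrixP => i j; rewrite !mxE contentZ e1 mul1n.
case: he => ->; first by rewrite !mul1r.
have hd : ((mx_content A)%:Z %| A i j)%Z by rewrite dvdzE content_dvd.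
by rewrite mulz_divA.
Qed.

(** * Norms *)

Lemma mx_norm_entry (R : realType) (m n : nat) (A : 'M[R]_(m, n)) i j :
  `|A i j| <= mx_norm A.
Proof.
rewrite mx_normrE.
exact: (le_bigmax_cond 0 (fun p : 'I_m * 'I_n => `|A p.1 p.2|) (j := (i, j)) (P := xpredT) isT).
Qed.

Lemma mx_norm_le (R : realType) (m n : nat) (A : 'M[R]_(m, n)) b :
  0 <= b -> (forall i j, `|A i j| <= b) -> mx_norm A <= b.
Proof. by move=> hb h; rewrite mx_normrE; apply/bigmax_leP; split. Qed.

Lemma norm_entry (R : realType) (A : 'M[int]_2) i j :
  `|(A i j)%:~R : R| <= norm_int R A.
Proof. by have := @mx_norm_entry R _ _ (map_mx intr A) i j; rewrite mxE. Qed.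

Lemma norm_le (R : realType) (A : 'M[int]_2) b :
  0 <= b -> (forall i j, `|(A i j)%:~R : R| <= b) -> norm_int R A <= b.
Proof. by move=> hb h; apply: mx_norm_le => // i j; rewrite mxE. Qed.

Lemma norm_int_ge0 (R : realType) (A : 'M[int]_2) : 0 <= norm_int R A.
Proof. exact: le_trans (normr_ge0 _) (norm_entry R A 0 0). Qed.

Lemma intr_ge1 (R : realType) (n : int) : n != 0 -> 1 <= `|n%:~R : R|.
Proof.
by rewrite -intr_norm => h; rewrite -[1]/(1%:~R) ler_int -gtz0_ge1 normr_gt0.
Qed.

Lemma norm_int_ge1 (R : realType) (A : 'M[int]_2) : A != 0 -> 1 <= norm_int R A.
Proof.
move=> hA; case: (boolP [exists i, exists j, A i j != 0]).
  move=> /existsP[i /existsP[j h]].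
  exact: le_trans (intr_ge1 R h) (norm_entry R A i j).
rewrite negb_exists => /forallP h; case/eqP: hA; apply/matrixP => i j.
by have := h i; rewrite negb_exists => /forallP/(_ j); rewrite negbK mxE => /eqP.
Qed.

Lemma normM_le (R : realType) (x y a b : R) :
  `|x| <= a -> `|y| <= b -> `|x * y| <= a * b.
Proof. by move=> hx hy; rewrite normrM ler_pM. Qed.

Lemma normD_le (R : realType) (x y a b : R) :
  `|x| <= a -> `|y| <= b -> `|x + y| <= a + b.
Proof. by move=> hx hy; apply: le_trans (ler_normD _ _) _; apply: lerD. Qed.

Lemma normB_le (R : realType) (x y a b : R) :
  `|x| <= a -> `|y| <= b -> `|x - y| <= a + b.
Proof. by move=> hx hy; apply: normD_le; rewrite ?normrN. Qed.

Lemma norm_mul (R : realType) (A B : 'M[int]_2) :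
  norm_int R (A *m B) <= 2 * norm_int R A * norm_int R B.
Proof.
have hA := norm_int_ge0 R A; have hB := norm_int_ge0 R B.
apply: norm_le; first by rewrite !mulr_ge0.
move=> i j; rewrite mul2E intrD !intrM -mulrA mulr_natl.
by apply: normD_le; apply: normM_le; apply: norm_entry.
Qed.

Lemma norm_scale (R : realType) (s : int) (A : 'M[int]_2) :
  norm_int R (s *: A) = `|s%:~R| * norm_int R A.
Proof.
rewrite /norm_int -mx_normZ; congr mx_norm.
by apply/matrixP => i j; rewrite !mxE intrM.
Qed.

Lemma norm_adj (R : realType) (A : 'M[int]_2) :
  norm_int R (\adj A) = norm_int R A.
Proof.
have h B : norm_int R (\adj B) <= norm_int R B.
  apply: norm_le => [|i j]; first exact: norm_int_ge0.
  by case: (ord2P i) => ->; case: (ord2P j) => ->; adjE B;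
    rewrite ?intrN ?normrN norm_entry.
by apply/le_anti; rewrite h -{1}[A]adj2K h.
Qed.

Lemma norm_tr (R : realType) (A : 'M[int]_2) : norm_int R A^T = norm_int R A.
Proof.
have h B : norm_int R B^T <= norm_int R B.
  apply: norm_le => [|i j]; first exact: norm_int_ge0.
  by rewrite mxE norm_entry.
by apply/le_anti; rewrite h -{1}[A]trmxK h.
Qed.

Section NormRow.
Variables (R : realType) (xi : R).

Let rowE (A : 'M[int]_2) j :
  ((\row_(j < 2) [:: xi; -1]`_j) *m map_mx intr A : 'rV[R]_2) 0 j
  = xi * (A 0 j)%:~R - (A 1 j)%:~R.
Proof. by rewrite mul2E !mxE /= mulN1r. Qed.

Lemma norm_row_entry (A : 'M[int]_2) j :
  `|xi * (A 0 j)%:~R - (A 1 j)%:~R| <= norm_row xi A.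
Proof. by rewrite -rowE; apply: mx_norm_entry. Qed.

Lemma norm_row_le (A : 'M[int]_2) b : 0 <= b ->
  (forall j, `|xi * (A 0 j)%:~R - (A 1 j)%:~R| <= b) -> norm_row xi A <= b.
Proof.
by move=> hb h; apply: mx_norm_le => // i j; rewrite ord1 rowE.
Qed.

Lemma norm_row_ge0 (A : 'M[int]_2) : 0 <= norm_row xi A.
Proof. exact: le_trans (normr_ge0 _) (norm_row_entry A 0). Qed.

Lemma norm_row_mul (A B : 'M[int]_2) :
  norm_row xi (A *m B) <= 2 * norm_row xi A * norm_int R B.
Proof.
have hA := norm_row_ge0 A; have hB := norm_int_ge0 R B.
apply: norm_row_le => [|j]; first by rewrite !mulr_ge0.
rewrite !mul2E !intrD !intrM.
have -> : forall a b c d e f : R,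
  xi * (a * b + c * d) - (e * b + f * d) = (xi * a - e) * b + (xi * c - f) * d.
  by move=> *; ring.
rewrite -mulrA mulr_natl.
by apply: normD_le; apply: normM_le; rewrite ?norm_entry ?norm_row_entry.
Qed.

Lemma norm_row_scale (s : int) (A : 'M[int]_2) :
  norm_row xi (s *: A) = `|s%:~R| * norm_row xi A.
Proof.
rewrite /norm_row -mx_normZ; congr mx_norm; apply/matrixP => i j.
by rewrite ord1 [RHS]mxE !rowE !mxE !intrM mulrBr; congr (_ - _); ring.
Qed.

Lemma det_le (A : 'M[int]_2) :
  `|(\det A)%:~R : R| <= 2 * norm_int R A * norm_row xi A.
Proof.
rewrite det2E intrB !intrM.
have -> : forall a b c d : R,
  a * d - b * c = b * (xi * a - c) - a * (xi * b - d) by move=> *; ring.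
rewrite -mulrA mulr_natl.
by apply: normB_le; apply: normM_le; rewrite ?norm_entry ?norm_row_entry.
Qed.

(** After column operations replacing x_1, x_2 by xi x_0 - x_1, xi x_1 - x_2, every product in the
    determinant has one factor of full size and two factors bounded by [norm_row]. *)
Lemma det3_le (a b c : 'M[int]_2) : a^T = a -> b^T = b -> c^T = c ->
  `|(det3 a b c)%:~R : R| <= 2 *
    (norm_int R a * norm_row xi b * norm_row xi c +
     norm_int R b * norm_row xi a * norm_row xi c +
     norm_int R c * norm_row xi a * norm_row xi b).
Proof.
move=> /matrixP/(_ 0 1); rewrite mxE => ha.
move=> /matrixP/(_ 0 1); rewrite mxE => hb.
move=> /matrixP/(_ 0 1); rewrite mxE => hc.
rewrite /det3 !(intrB, intrD, intrM).
have -> : forall a0 a1 a2 b0 b1 b2 c0 c1 c2 : R,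
  c0 * (a1 * b2 - a2 * b1) - c1 * (a0 * b2 - a2 * b0)
    + c2 * (a0 * b1 - a1 * b0) =
  a0 * ((xi * b0 - b1) * (xi * c1 - c2) - (xi * b1 - b2) * (xi * c0 - c1))
  + (b0 * ((xi * a1 - a2) * (xi * c0 - c1) - (xi * a0 - a1) * (xi * c1 - c2))
  + c0 * ((xi * a0 - a1) * (xi * b1 - b2) - (xi * a1 - a2) * (xi * b0 - b1))).
  by move=> *; ring.
have Ha0 := norm_row_entry a 0; have Ha1 := norm_row_entry a 1.
have Hb0 := norm_row_entry b 0; have Hb1 := norm_row_entry b 1.
have Hc0 := norm_row_entry c 0; have Hc1 := norm_row_entry c 1.
rewrite ha hb hc in Ha0 Hb0 Hc0.
have -> : forall u v w : R, 2 * (u + v + w) = 2 * u + (2 * v + 2 * w).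
  by move=> *; ring.
have aux (x y z u v n r s : R) : `|x| <= n -> `|y| <= r -> `|z| <= s ->
  `|u| <= r -> `|v| <= s -> `|x * (y * z - u * v)| <= 2 * (n * r * s).
  move=> hx hy hz hu hv.
  have -> : 2 * (n * r * s) = n * (r * s + r * s) by ring.
  by apply: normM_le => //; apply: normB_le; apply: normM_le.
apply: normD_le; first by apply: aux => //; rewrite norm_entry.
by apply: normD_le; apply: aux => //; rewrite norm_entry.
Qed.
End NormRow.

(** * Growth of sequences *)

Lemma golden_gt1 (R : realType) : 1 < golden R.
Proof.
rewrite /golden ltr_pdivlMr // mul1r.
have : Num.sqrt 1 < Num.sqrt 5 :> R by rewrite ltr_sqrt //; lra.
by rewrite sqrtr1; lra.
Qed.

Lemma golden_sqr (R : realType) : golden R ^+ 2 = golden R + 1.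
Proof.
rewrite /golden; have : Num.sqrt 5 ^+ 2 = 5 :> R by rewrite sqr_sqrtr //; lra.
by move=> h; field: h.
Qed.

Lemma powR_le (R : realType) (r x y : R) : 0 <= r -> 0 <= x -> x <= y ->
  x `^ r <= y `^ r.
Proof.
move=> hr hx hxy; have hy := le_trans hx hxy.
have := @ge0_ler_powR R r hr x y; rewrite !nnegrE; exact.
Qed.

(* The exponent is 1/gamma = gamma - 1, so that x = gpow x * gpow (gpow x). *)
Definition gpow (R : realType) (x : R) : R := x `^ (golden R)^-1.

Section Gpow.
Variable R : realType.
Implicit Types x y : R.
Local Notation p := (@gpow R).

Lemma gpow_gt0 x : 0 < x -> 0 < p x.
Proof. exact: powR_gt0. Qed.

Lemma gpowM x y : 0 < x -> 0 < y -> p (x * y) = p x * p y.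
Proof. by move=> hx hy; rewrite /gpow powRM ?ltW. Qed.

Lemma gpow_le x y : 0 < x -> x <= y -> p x <= p y.
Proof.
move=> hx hxy; apply: powR_le => //; last exact: ltW.
by rewrite invr_ge0 ltW //; apply: lt_trans (golden_gt1 R).
Qed.

Lemma gpow1 : p 1 = 1.
Proof. by rewrite /gpow powR1. Qed.

Lemma powR_golden x : 0 < x -> x `^ golden R = x * p x.
Proof.
move=> hx; rewrite /gpow -{2}(powRr1 (ltW hx)) -powRD; last by rewrite (gt_eqF hx) implybT.
congr powR; have g1 := golden_gt1 R.
have g0 : golden R != 0 by rewrite gt_eqF //; apply: lt_trans g1.
apply: (mulIf g0); rewrite mulrDl mul1r mulVf // -expr2 golden_sqr //.
Qed.

Lemma gpow_golden x : 0 < x -> p (x `^ golden R) = x.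
Proof.
move=> hx; rewrite /gpow -powRrM divff ?powRr1 ?ltW //.
by rewrite gt_eqF //; apply: lt_trans (golden_gt1 R).
Qed.

Lemma golden_gpow x : 0 < x -> (p x) `^ golden R = x.
Proof.
move=> hx; rewrite /gpow -powRrM mulVf ?powRr1 ?ltW //.
by rewrite gt_eqF //; apply: lt_trans (golden_gt1 R).
Qed.

Lemma gpow_gpow x : 0 < x -> p x * p (p x) = x.
Proof. by move=> hx; rewrite -powR_golden ?golden_gpow ?gpow_gt0. Qed.

Lemma gpow_le_inv x y : 0 < x -> 0 < y -> p x <= p y -> x <= y.
Proof.
move=> hx hy h; rewrite -(golden_gpow hx) -(golden_gpow hy).
have g0 : 0 <= golden R by rewrite ltW //; apply: lt_trans (golden_gt1 R).
by apply: powR_le => //; rewrite ltW ?gpow_gt0.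
Qed.

Lemma gpow_large B : exists X : R, 0 < X /\ forall x, X <= x -> B <= p x.
Proof.
pose b := Num.max 1 B; have b0 : 0 < b by rewrite lt_max ltr01.
exists (b `^ golden R); split => [|x hx]; first exact: powR_gt0.
apply: (@le_trans _ _ b); first by rewrite le_max lexx orbT.
by rewrite -(gpow_golden b0); apply: gpow_le; rewrite ?powR_gt0.
Qed.

(* The ratio q_i = p (f i.+1) / f i satisfies q_{i+1} =~= p (q_i)^-1, so
   that it stays bounded. *)
Lemma fib_gpow (f : nat -> R) C : 0 < C -> (forall i, 0 < f i) ->
  (forall i, f i.+2 <= C * f i.+1 * f i) ->
  (forall i, f i.+1 * f i <= C * f i.+2) ->
  exists2 K, 0 < K &
    forall i, p (f i.+1) <= K * f i /\ f i <= K * p (f i.+1).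
Proof.
move=> C0 f0 hu hl.
pose q := p (f 1%N) / f 0%N.
have q0 : 0 < q by rewrite divr_gt0 ?gpow_gt0.
(* As [K] will equal x * p x, the bound C <= x gives p C * p K <= K, which is what the induction
   step needs; q and 1/q serve the base case. *)
pose x := C + q + q^-1 + 1.
have iq0 : 0 < q^-1 by rewrite invr_gt0.
have x0 : 0 < x by rewrite /x !addr_gt0.
pose K := x `^ golden R.
have K0 : 0 < K by exact: powR_gt0.
have pK : p K = x by exact: gpow_golden.
have px1 : 1 <= p x.
  by rewrite -gpow1; apply: gpow_le => //; rewrite /x; lra.
have xK : x <= K.
  by rewrite /K powR_golden // -{1}[x]mulr1 ler_pM2l.
have CK : p C * p K <= K.
  rewrite pK /K powR_golden // mulrC ler_pM2l //; apply: gpow_le => //.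
  by rewrite /x; lra.
have pf j := gpow_gt0 (f0 j).
exists K => //; elim=> [|i [IH1 IH2]].
  split.
    rewrite -ler_pdivrMr //; apply: le_trans xK; rewrite -/q /x; lra.
  rewrite -ler_pdivrMr //; apply: le_trans xK.
  have -> : f 0%N / p (f 1%N) = q^-1 by rewrite /q invf_div.
  by rewrite /x; lra.
have ppf j : 0 < p (p (f j)) by apply: gpow_gt0.
have e1 := gpow_gpow (f0 i.+1).
split.
  have := gpow_le (f0 _) (hu i).
  rewrite !gpowM ?mulr_gt0 // => /le_trans; apply.
  have := gpow_le (f0 i) IH2; rewrite gpowM // => h2.
  rewrite -[f i.+1 in X in _ <= X]e1.
  have := ler_wpM2l (ltW (gpow_gt0 C0)) h2; rewrite mulrA => h3.
  have h4 := ler_wpM2r (ltW (ppf i.+1)) CK.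
  have := ler_wpM2l (ltW (pf i.+1)) (le_trans h3 h4).
  by congr (_ <= _); ring.
have := gpow_le (mulr_gt0 (f0 i.+1) (f0 i)) (hl i).
rewrite !gpowM // => h1.
have := gpow_le (pf _) IH1; rewrite gpowM // => h2.
rewrite -e1; apply: (@le_trans _ _ (p K * (p C * p (f i.+2)))).
  have := ler_wpM2l (ltW (pf i.+1)) h2 => h3; apply: le_trans h3 _.
  have := ler_wpM2l (ltW (gpow_gt0 K0)) h1; congr (_ <= _); ring.
by rewrite mulrA [p K * _]mulrC ler_wpM2r // ltW.
Qed.

(** Converse of [fib_gpow]: f_{i+2} is the product of p f_{i+2} and p (p f_{i+2}), comparable to
    f_{i+1} and to p f_{i+1} =~= f_i. *)
Lemma gpow_fib (f : nat -> R) K : 0 < K -> (forall i, 0 < f i) ->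
  (forall i, p (f i.+1) <= K * f i /\ f i <= K * p (f i.+1)) ->
  exists2 C, 0 < C & forall i,
    f i.+2 <= C * f i.+1 * f i /\ f i.+1 * f i <= C * f i.+2.
Proof.
move=> K0 f0 h; have pK0 := gpow_gt0 K0.
exists (K * K * p K); first by rewrite !mulr_gt0.
move=> i; have [h1 h2] := h i; have [h3 h4] := h i.+1.
have pf j := gpow_gt0 (f0 j).
have e := gpow_gpow (f0 i.+2).
split.
  have := gpow_le (pf _) h3; rewrite gpowM // => h5.
  have h6 := le_trans h5 (ler_wpM2l (ltW pK0) h1).
  have h7 := ler_pM (ltW (pf _)) (ltW (gpow_gt0 (pf _))) h3 h6.
  rewrite -e; apply: le_trans h7 _.
  by rewrite le_eqVlt; apply/orP; left; apply/eqP; ring.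
have := gpow_le (f0 _) h4; rewrite gpowM ?gpow_gt0 // => h5.
have h6 := le_trans h2 (ler_wpM2l (ltW K0) h5).
rewrite -e; apply: le_trans (ler_pM (ltW (f0 _)) (ltW (f0 _)) h4 h6) _.
by rewrite le_eqVlt; apply/orP; left; apply/eqP; ring.
Qed.

Lemma gpow_asympt (f : nat -> R) K : 0 < K -> (forall i, 0 < f i) ->
  (forall i, p (f i.+1) <= K * f i /\ f i <= K * p (f i.+1)) ->
  exists2 C, 0 < C & forall i,
    f i.+1 <= C * f i `^ golden R /\ f i `^ golden R <= C * f i.+1.
Proof.
move=> K0 f0 h; exists (K `^ golden R); first exact: powR_gt0.
have g0 : 0 <= golden R by rewrite ltW //; apply: lt_trans (golden_gt1 R).
move=> i; have [h1 h2] := h i; have pf := gpow_gt0 (f0 i.+1).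
have e := golden_gpow (f0 i.+1); split.
  by rewrite -{1}e -(powRM _ (ltW K0) (ltW (f0 i))); apply: powR_le => //; exact: ltW.
by rewrite -e -(powRM _ (ltW K0) (ltW pf)); apply: powR_le => //; exact: ltW.
Qed.

Lemma asympt_gpow (f : nat -> R) C : 0 < C -> (forall i, 0 < f i) ->
  (forall i, f i.+1 <= C * f i `^ golden R /\ f i `^ golden R <= C * f i.+1) ->
  exists2 K, 0 < K &
    forall i, p (f i.+1) <= K * f i /\ f i <= K * p (f i.+1).
Proof.
move=> C0 f0 h; exists (p C); first exact: gpow_gt0.
move=> i; have [h1 h2] := h i.
have fg : 0 < f i `^ golden R by exact: powR_gt0.
have := gpow_le (f0 _) h1; have := gpow_le fg h2.
by rewrite !gpowM // gpow_golden.
Qed.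
End Gpow.

(* The lower bound in the Fibonacci growth makes one large term propagate. *)
Lemma fib_unbounded (R : realType) (f : nat -> R) C : 0 < C ->
  (forall i, 1 <= f i) -> (forall i, f i.+1 * f i <= C * f i.+2) ->
  (forall B, exists i, B < f i) ->
  forall B, exists i0, forall i, (i0 <= i)%N -> B <= f i.
Proof.
move=> C0 f1 hl hub B.
pose c := C + 1; have c1 : 1 < c by rewrite /c; lra.
have hl' i : f i.+1 * f i <= c * f i.+2.
  apply: le_trans (hl i) _; rewrite ler_wpM2r // ?(le_trans _ (f1 _)) //.
  by rewrite /c; lra.
have f0 i : 0 < f i by apply: lt_le_trans (f1 i).
have stepn i : f i.+1 <= c * f i.+2.
  by apply: le_trans (hl' i); rewrite -{1}[f i.+1]mulr1 ler_pM2l.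
(* The summand [f 0] excludes the index 0, so that [stepn] applies to the large term. The outer
   factor [c] is what [stepn] loses; two consecutive terms of size at least 2 c (|B| + 1) remain. *)
have [i hi] := hub (f 0%N + c * (c * 2 * (`|B| + 1))).
have c2B : 0 < c * (c * 2 * (`|B| + 1)).
  by rewrite !mulr_gt0 //; have := normr_ge0 B; lra.
case: i hi => [|i hi]; first by lra.
have D0 : 1 <= `|B| + 1 by have := normr_ge0 B; lra.
pose D := `|B| + 1.
have f1a : c * (c * 2 * D) <= f i.+1.
  by have := f0 0%N; rewrite /D; lra.
have f2a : c * 2 * D <= f i.+2.
  rewrite -(ler_pM2l (lt_trans ltr01 c1)); apply: le_trans f1a _; exact: stepn.
have cD : 0 < c * 2 * D by rewrite !mulr_gt0 // /D; lra.
have main j : c * 2 * D <= f (i.+1 + j)%N /\ c * 2 * D <= f (i.+2 + j)%N.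
  elim: j => [|j [IH1 IH2]].
    rewrite !addn0; split=> //; apply: le_trans f1a.
    by rewrite -{1}[_ * D]mul1r ler_wpM2r // ltW.
  rewrite !addnS -!addSn; split=> //.
  have := hl' (i.+1 + j)%N => h.
  rewrite -(ler_pM2l (lt_trans ltr01 c1)).
  apply: le_trans h; apply: ler_pM => //; [|exact: ltW|].
    by rewrite ltW // (lt_trans ltr01).
  apply: le_trans IH2; rewrite -mulrA -{1}[c]mulr1 ler_pM2l ?(lt_trans ltr01) //.
  by rewrite /D; lra.
exists i.+1 => j hj; rewrite -(subnKC hj); have [h _] := main (j - i.+1)%N.
apply: le_trans h; apply: (@le_trans _ _ D).
  by rewrite /D; have := ler_norm B; lra.
by rewrite -{1}[D]mul1r ler_wpM2r // /D; lra.
Qed.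

Lemma fib_ratio (R : realType) (f : nat -> R) C : 0 < C ->
  (forall i, 0 < f i) -> (forall i, f i.+1 * f i <= C * f i.+2) ->
  (forall B, exists i0, forall i, (i0 <= i)%N -> B <= f i) ->
  forall B, exists i0, forall i, (i0 <= i)%N -> B * f i <= f i.+1.
Proof.
move=> C0 f0 hl hub B; have [i0 h] := hub (C * B).
exists i0.+1 => -[//|i]; rewrite ltnS => /h hi.
rewrite -(ler_pM2l C0); apply: le_trans (hl i).
by rewrite mulrA mulrC ler_wpM2l // ltW.
Qed.

Lemma lesssim_eventually (R : realType) (f g : nat -> R) C i0 :
  (forall i, (1 <= i)%N -> 0 < g i) ->
  (forall i, (i0 <= i)%N -> f i <= C * g i) -> lesssim f g.
Proof.
move=> g0 h.
have [D [D0 hD]] : exists D, 0 < D /\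
    forall i, (1 <= i)%N -> (i < i0)%N -> f i <= D * g i.
  elim: i0 {h} => [|n [D [D0 IH]]]; first by exists 1.
  exists (D + `|f n / g n|); split => [|i i1]; first by rewrite ltr_wpDr.
  rewrite ltnS leq_eqVlt => /orP[/eqP e|hi].
    rewrite -e -ler_pdivrMr ?g0 //; apply: le_trans (ler_norm _) _.
    by rewrite lerDr ltW.
  apply: le_trans (IH i i1 hi) _; apply: ler_wpM2r; first exact/ltW/g0.
  by rewrite lerDl.
exists (D + `|C|); split => [|i i1]; first by rewrite ltr_wpDr.
case: (ltnP i i0) => hi.
  apply: le_trans (hD i i1 hi) _; apply: ler_wpM2r; first exact/ltW/g0.
  by rewrite lerDl.
apply: le_trans (h i hi) _; apply: ler_wpM2r; first exact/ltW/g0.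
by apply: le_trans (ler_norm _) _; rewrite lerDr ltW.
Qed.

(* The sequences u i -+ 2 K / f i ^ 2 are monotone and enclose the limit. *)
Lemma cauchy_limit (R : realType) (u f : nat -> R) K : 0 < K ->
  (forall i, 0 < f i) -> (forall i, 2 * f i <= f i.+1) ->
  (forall i, `|u i.+1 - u i| <= K / f i ^+ 2) ->
  exists l, forall i, `|u i - l| <= 2 * K / f i ^+ 2.
Proof.
move=> K0 f0 hf hu.
pose e i := K / f i ^+ 2.
have e0 i : 0 < e i by rewrite divr_gt0 // exprn_gt0.
have he i : 4 * e i.+1 <= e i.
  rewrite /e mulrA ler_pdivrMr ?exprn_gt0 // mulrAC ler_pdivlMr ?exprn_gt0 //.
  rewrite [4 * K]mulrC -mulrA ler_pM2l //.
  have := hf i; have := f0 i; rewrite !expr2; nra.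
have mono i j : (i <= j)%N ->
    u i - 2 * e i <= u j - 2 * e j /\ u j + 2 * e j <= u i + 2 * e i.
  move=> hij; rewrite -(subnKC hij); elim: (j - i)%N => [|k [IH1 IH2]].
    by rewrite addn0.
  rewrite addnS; have := hu (i + k)%N; rewrite -/(e _) ler_norml => /andP[h1 h2].
  have := he (i + k)%N; have := e0 (i + k).+1; split; lra.
pose S := range (fun i => u i - 2 * e i).
have Sub j : ubound S (u j + 2 * e j).
  move=> _ [i _ <-]; have [m1 m2] := mono i (maxn i j) (leq_maxl _ _).
  have [m3 m4] := mono j (maxn i j) (leq_maxr _ _).
  by have := e0 (maxn i j); lra.
have S0 : nonempty S by exists (u 0%N - 2 * e 0%N); exists 0%N.
exists (sup S) => i; rewrite -mulrA -/(e i) ler_norml; apply/andP; split.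
  have : sup S <= u i + 2 * e i by apply: ge_sup.
  lra.
have : u i - 2 * e i <= sup S.
  by apply: ub_le_sup; [exists (u 0%N + 2 * e 0%N)|exists i].
lra.
Qed.

(* For a symmetric matrix (x0, x1; x1, x2), norm_row xi is comparable to
   max (|x0 xi - x1|, |x0 xi^2 - x2|). *)
Definition approx_seq (R : realType) (xi : R) (y : nat -> 'M[int]_2) : Prop :=
  [/\ forall i, (y i)^T = y i, forall i, \det (y i) != 0,
      forall i, det3 (y i) (y i.+1) (y i.+2) != 0 &
  exists C : R,
    [/\ 0 < C,
        forall i, norm_int R (y i.+2) <= C * norm_int R (y i.+1) * norm_int R (y i),
        forall i, norm_int R (y i.+1) * norm_int R (y i) <= C * norm_int R (y i.+2),
        forall i, norm_int R (y i) * norm_row xi (y i) <= C &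
        forall B, exists i0, forall i, (i0 <= i)%N -> B <= norm_int R (y i)]].

(** * Approximation sequences: independence of 1, xi, xi^2 and extremality *)

Lemma sym10 (A : 'M[int]_2) : A^T = A -> A 1 0 = A 0 1.
Proof. by move=> /matrixP/(_ 0 1); rewrite mxE. Qed.

Lemma int_small (R : realType) (n : int) : `|n%:~R : R| < 1 -> n = 0.
Proof.
by move=> h; apply/eqP; apply: contraLR h => h; rewrite -leNgt intr_ge1.
Qed.

Definition no_relation (R : realType) (xi : R) : Prop :=
  forall a b c : int, a%:~R * xi ^+ 2 + b%:~R * xi + c%:~R = 0 ->
  [/\ a = 0, b = 0 & c = 0].

Lemma det3_cramer (S : comNzRingType) (a b c : 'M[S]_2) (u v w : S) :
  let n (x : 'M[S]_2) := u * x 1 1 + v * x 0 1 + w * x 0 0 in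
  [/\ det3 a b c * u = n a * (b 0 0 * c 0 1 - b 0 1 * c 0 0)
        - n b * (a 0 0 * c 0 1 - a 0 1 * c 0 0)
        + n c * (a 0 0 * b 0 1 - a 0 1 * b 0 0),
      det3 a b c * v = - n a * (b 0 0 * c 1 1 - b 1 1 * c 0 0)
        + n b * (a 0 0 * c 1 1 - a 1 1 * c 0 0)
        - n c * (a 0 0 * b 1 1 - a 1 1 * b 0 0) &
      det3 a b c * w = n a * (b 0 1 * c 1 1 - b 1 1 * c 0 1)
        - n b * (a 0 1 * c 1 1 - a 1 1 * c 0 1)
        + n c * (a 0 1 * b 1 1 - a 1 1 * b 0 1)].
Proof. by move=> n; rewrite /n /det3; split; ring. Qed.

(** An integral form a x_2 + b x_1 + c x_0 vanishing at (1, xi, xi^2) takes at y_i an integer value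
    << L(y_i), hence 0 for large i. It then vanishes at three independent points, and Cramer's rule
    kills its coefficients. *)
Lemma approx_seq_no_relation (R : realType) (xi : R) y : approx_seq xi y -> no_relation xi.
Proof.
move=> [ysym _ ydet3 [C [C0 _ _ hL hub]]] a b c habc.
pose K : R := `|a%:~R| + `|a%:~R * xi + b%:~R|.
have K0 : 0 <= K by rewrite addr_ge0.
have [i0 hi0] := hub (K * C + 1).
pose n (x : 'M[int]_2) := a * x 1 1 + b * x 0 1 + c * x 0 0.
have n0 i : (i0 <= i)%N -> n (y i) = 0.
  move=> /hi0 hi; apply: (@int_small R).
  have KC : 0 <= K * C by rewrite mulr_ge0 // ltW.
  have Y0 : 0 < norm_int R (y i) by lra.
  have e0 := norm_row_entry xi (y i) 0; have e1 := norm_row_entry xi (y i) 1.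
  rewrite (sym10 (ysym i)) in e0.
  have -> : (n (y i))%:~R = (a%:~R * xi ^+ 2 + b%:~R * xi + c%:~R) * (y i 0 0)%:~R
     - (a%:~R * (xi * (y i 0 1)%:~R - (y i 1 1)%:~R)
      + (a%:~R * xi + b%:~R) * (xi * (y i 0 0)%:~R - (y i 0 1)%:~R)) :> R.
    by rewrite /n !intrD !intrM; ring.
  rewrite habc mul0r sub0r normrN.
  have h := normD_le (normM_le (lexx `|a%:~R|) e1)
                     (normM_le (lexx `|a%:~R * xi + b%:~R|) e0).
  apply: le_lt_trans h _; rewrite -mulrDl -/K.
  rewrite -(ltr_pM2r Y0) mul1r -mulrA [_ * norm_int _ _]mulrC.
  by apply: le_lt_trans (ler_wpM2l K0 (hL i)) _; lra.
have [h1 h2 h3] := det3_cramer (y i0) (y i0.+1) (y i0.+2) a b c.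
have := ydet3 i0; rewrite -/(n _) in h1 h2 h3.
move: h1 h2 h3; rewrite -!/(n _) !n0 ?leqnSn //; last exact: leq_trans (leqnSn _) _.
rewrite !(mul0r, oppr0, subr0, addr0) => /eqP h1 /eqP h2 /eqP h3 nz.
by move: h1 h2 h3; rewrite !mulf_eq0 (negbTE nz) /= => /eqP-> /eqP-> /eqP->.
Qed.

Lemma no_relation_irrational (R : realType) (xi : R) :
  no_relation xi -> ~ rational xi.
Proof.
move=> h [q _ hq]; have d0 : (denq q)%:~R != 0 :> R.
  by rewrite intr_eq0 denq_eq0.
have [] := h 0 (denq q) (- numq q).
  by rewrite -hq intrN /ratr; field.
by move=> _ /eqP; rewrite denq_eq0.
Qed.

Lemma no_relation_nonquadratic (R : realType) (xi : R) :
  no_relation xi -> ~ quadratic xi.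
Proof.
move=> h [p [hs _ /rootP]]; rewrite horner_coef size_map_poly hs.
rewrite !big_ord_recl big_ord0 !coef_map /= /bump /= !addn0 expr0 mulr1 addr0 expr1.
set p0 := p`_0; set p1 := p`_(1 + 0); set p2 := p`_(1 + (1 + 0)) => e.
have p20 : p2 != 0.
  have -> : p2 = lead_coef p by rewrite lead_coefE hs.
  by rewrite lead_coef_eq0 -size_poly_eq0 hs.
have d0 q : (denq q)%:~R != 0 :> R by rewrite intr_eq0 denq_eq0.
have [] := h (numq p2 * denq p1 * denq p0) (numq p1 * denq p2 * denq p0)
     (numq p0 * denq p1 * denq p2).
  have := congr1 ( *%R ((denq p0)%:~R * (denq p1)%:~R * (denq p2)%:~R)) e.
  rewrite mulr0 => <-; rewrite /ratr !intrM.
  by field; rewrite ?d0.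
move=> /eqP; rewrite !mulf_eq0 !denq_eq0 !orbF numq_eq0 (negbTE p20) //.
Qed.

Lemma irrational_no_relation (R : realType) (xi : R) :
  ~ rational xi -> ~ quadratic xi -> no_relation xi.
Proof.
move=> hr hq a b c e.
have rat_lin (u v : rat) : u != 0 -> ratr u * xi + ratr v = 0 -> False.
  move=> u0 e'; apply: hr; exists (- v / u) => //.
  have u0' : ratr u != 0 :> R by rewrite fmorph_eq0.
  rewrite fmorph_div rmorphN /=; apply: (mulIf u0'); rewrite mulfVK //.
  by move/eqP: e'; rewrite addrC addr_eq0 => /eqP ->; rewrite opprK mulrC.
have [a0|a0] := eqVneq a 0.
  have [b0|b0] := eqVneq b 0.
    by move: e; rewrite a0 b0 !mul0r !add0r => /eqP; rewrite intr_eq0 => /eqP.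
  case: (@rat_lin b%:~R c%:~R); first by rewrite intr_eq0.
  by move: e; rewrite a0 mul0r add0r !ratr_int.
case: hq; pose p : {poly rat} := Poly [:: c%:~R; b%:~R; a%:~R].
have hp : p = [:: c%:~R; b%:~R; a%:~R] :> seq rat.
  by apply: (@PolyK _ 0); rewrite /= intr_eq0.
exists p; have hs : size p = 3%N by rewrite hp.
have [c0 c1 c2] : [/\ p`_0 = c%:~R, p`_1 = b%:~R & p`_2 = a%:~R] by rewrite hp.
have hroot : root (map_poly ratr p) xi.
  rewrite /root horner_coef size_map_poly hs.
  rewrite !big_ord_recr big_ord0 /= !coef_map /= c0 c1 c2 !ratr_int.
  by apply/eqP; rewrite -[RHS]e; ring.
split=> //; apply: cubic_irreducible; first by rewrite hs.
move=> r; apply/negP => /rootP hr'.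
have e' : a%:~R * r ^+ 2 + b%:~R * r + c%:~R = 0.
  by rewrite -[RHS]hr' horner_coef hs !big_ord_recr big_ord0 /= c0 c1 c2; ring.
(* Subtracting the relation at [r] from the relation at [xi] factors out xi - r; the vanishing of
   either factor makes [xi] rational. *)
have e2 : (xi - ratr r) * (a%:~R * xi + (b%:~R + a%:~R * ratr r)) = 0 :> R.
  have := congr1 (@ratr R) e'.
  rewrite !rmorphD !rmorphM /= rmorph0 !ratr_int ?rmorphXn /= => h.
  by rewrite -[RHS](subr0 0) -{1}e -h; ring.
move/eqP: e2; rewrite mulf_eq0 => /orP[/eqP h|/eqP h].
  by apply: hr; exists r => //; apply/eqP; rewrite eq_sym -subr_eq0 h.
apply: (@rat_lin a%:~R (b%:~R + a%:~R * r)); first by rewrite intr_eq0.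
by rewrite rmorphD rmorphM /= !ratr_int.
Qed.

Lemma approx_seq_ge1 (R : realType) (xi : R) y i : approx_seq xi y -> 1 <= norm_int R (y i).
Proof. by move=> [_ h _ _]; apply/norm_int_ge1/det_neq0. Qed.

Lemma approx_seq_gpow (R : realType) (xi : R) y : approx_seq xi y ->
  exists2 K, 0 < K & forall i,
    gpow (norm_int R (y i.+1)) <= K * norm_int R (y i) /\
    norm_int R (y i) <= K * gpow (norm_int R (y i.+1)).
Proof.
move=> hy; have y0 i : 0 < norm_int R (y i) by apply: lt_le_trans (approx_seq_ge1 i hy).
case: hy => _ _ _ [C [C0 h1 h2 _ _]].
exact: (fib_gpow (f := fun i => norm_int R (y i)) C0 y0 h1 h2).
Qed.

Lemma approx_seq_extremal (R : realType) (xi : R) y : approx_seq xi y -> extremal xi.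
Proof.
move=> hy; have hn := approx_seq_no_relation hy.
split; [exact: no_relation_irrational|exact: no_relation_nonquadratic|].
have [K K0 hK] := approx_seq_gpow hy.
have y1 i := approx_seq_ge1 i hy.
case: hy => ysym ydet _ [C [C0 _ _ hL hub]].
pose p := @gpow R.
have Y0 i : 0 < norm_int R (y i) by apply: lt_le_trans (y1 i).
pose D := (1 + `|xi|) * C * K.
have D0 : 0 <= D.
  by apply: mulr_ge0; [apply: mulr_ge0; [exact: addr_ge0|exact: ltW]|exact: ltW].
(* For X below |y_0| the point (1, 0, 0) is used, at the price of [E]. For larger X the point is y_m
   with |y_m| <= X < |y_{m+1}|, where X^(1/gamma) <= K |y_m|. *)
pose E := (`|xi| + `|xi ^+ 2|) * p (norm_int R (y 0%N)).
have E0 : 0 <= E by rewrite mulr_ge0 ?addr_ge0 // ltW // gpow_gt0.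
exists (D + E + 1); split; first lra.
move=> X X1; have X0 : 0 < X by lra.
have pX0 := gpow_gt0 X0.
have -> : X `^ (- (golden R)^-1) = (p X)^-1 by rewrite powRN.
pose P m := X < norm_int R (y m).
have exP : exists m, P m.
  have [i0 h] := hub (X + 1); exists i0; rewrite /P.
  by have := h i0 (leqnn _); lra.
case: (ex_minnP exP) => -[|m] hPm hmin.
  exists 1, 0, 0; split=> //; rewrite ?normr1 // !mul1r !subr0.
    apply: (@le_trans _ _ (E / p X)); last first.
      by rewrite ler_pM2r ?invr_gt0 //; lra.
    rewrite ler_pdivlMr // /E; apply: ler_pM => //; [exact: ltW|by rewrite lerDl|].
    by apply: gpow_le => //; exact: ltW.
  apply: (@le_trans _ _ (E / p X)); last first.
    by rewrite ler_pM2r ?invr_gt0 //; lra.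
  rewrite ler_pdivlMr // /E; apply: ler_pM => //; [exact: ltW|by rewrite lerDr|].
  by apply: gpow_le => //; exact: ltW.
have hmX : norm_int R (y m) <= X.
  by rewrite leNgt; apply/negP => /hmin; rewrite ltnn.
have e0 := norm_row_entry xi (y m) 0; have e1 := norm_row_entry xi (y m) 1.
rewrite (sym10 (ysym m)) in e0.
have hl : (1 + `|xi|) * norm_row xi (y m) <= (D + E + 1) / p X.
  apply: (@le_trans _ _ (D / p X)); last first.
    by rewrite ler_pM2r ?invr_gt0 //; lra.
  rewrite ler_pdivlMr // /D -!mulrA; apply: ler_wpM2l; first by rewrite addr_ge0.
  have h1 : p X <= K * norm_int R (y m).
    by have [h _] := hK m; apply: le_trans h; apply: gpow_le => //; exact: ltW.
  apply: le_trans (ler_wpM2l (norm_row_ge0 _ _) h1) _.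
  rewrite mulrCA mulrC; apply: ler_wpM2r; [exact: ltW|rewrite mulrC; exact: hL].
have hr := norm_row_ge0 xi (y m); have ha := normr_ge0 xi.
exists (y m 0 0), (y m 0 1), (y m 1 1); split.
- move=> [h00 h01 h11]; have := ydet m.
  by rewrite det2E h00 h01 mul0r mul0r subr0 eqxx.
- exact: le_trans (norm_entry _ _ _ _) hmX.
- by apply: le_trans hl; rewrite mulrC; nra.
- apply: le_trans hl.
  have -> : (y m 0 0)%:~R * xi ^+ 2 - (y m 1 1)%:~R =
     (xi * (y m 0 1)%:~R - (y m 1 1)%:~R)
     + xi * (xi * (y m 0 0)%:~R - (y m 0 1)%:~R) :> R by ring.
  rewrite mulrDl mul1r; apply: normD_le => //; exact: normM_le.
Qed.

(** The inequalities 1 <= |det W_i| <= 2 |W_i| L(W_i) turn the upper bound on the row into both its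
    lower bound and the upper bound on the determinant. *)
Lemma star_of_growth (R : realType) (xi : R) W :
  (forall i, (1 <= i)%N -> calP (W i)) ->
  (exists2 C : R, 0 < C & forall i, (1 <= i)%N ->
     norm_int R (W i.+2) <= C * norm_int R (W i.+1) * norm_int R (W i) /\
     norm_int R (W i.+1) * norm_int R (W i) <= C * norm_int R (W i.+2)) ->
  lesssim (fun i => norm_row xi (W i)) (fun i => (norm_int R (W i))^-1) ->
  star_condition xi W.
Proof.
move=> hW [C C0 hC] [D [D0 hD]].
have W0 i : (1 <= i)%N -> 0 < norm_int R (W i).
  move=> /hW[_ h]; apply: lt_le_trans (norm_int_ge1 R (det_neq0 h)) => //.
have [K K0 hK] : exists2 K, 0 < K & forall i,
    gpow (norm_int R (W i.+2)) <= K * norm_int R (W i.+1) /\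
    norm_int R (W i.+1) <= K * gpow (norm_int R (W i.+2)).
  apply: (fib_gpow (f := fun i => norm_int R (W i.+1)) C0) => i; first exact: W0.
    by case: (hC i.+1 isT).
  by case: (hC i.+1 isT).
have [L L0 hL] := gpow_asympt (f := fun i => norm_int R (W i.+1)) K0
   (fun i => W0 i.+1 isT) hK.
have row_le i : (1 <= i)%N -> norm_int R (W i) * norm_row xi (W i) <= D.
  move=> i1; rewrite mulrC -ler_pdivlMr ?W0 //; exact: hD.
have det1 i : (1 <= i)%N -> 1 <= abs_det R (W i).
  by move=> /hW[_ h]; apply: intr_ge1.
split; split.
- by exists L; split=> // -[//|i] _; case: (hL i).
- by exists L; split=> // -[//|i] _; case: (hL i).
- by exists D; split=> //.
- exists 2; split=> // i i1; rewrite -[_^-1]mul1r ler_pdivrMr ?W0 //.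
  by apply: le_trans (det1 i i1) _; rewrite mulrAC det_le.
- exists (2 * D); split; first by rewrite mulr_gt0.
  move=> i i1; rewrite mulr1; apply: le_trans (det_le xi _) _.
  by rewrite -mulrA ler_pM2l // row_le.
- by exists 1; split=> // i i1; rewrite mul1r det1.
Qed.

(** * From approximation sequences to Fibonacci sequences *)

(** The planes spanned by [a], [b] and by [b], [c] meet in the line of [b], and [z] lies in both. *)
Lemma prop_of_det3 (a b c z : 'M[int]_2) :
  a^T = a -> b^T = b -> c^T = c -> z^T = z -> z != 0 ->
  det3 a b c != 0 -> det3 z b c = 0 -> det3 a b z = 0 -> z ~~ b.
Proof.
move=> /sym10 ha /sym10 hb /sym10 hc /sym10 hz z0 d h1 h2.
have e : det3 a b c *: z = det3 a z c *: b.
  have -> : det3 a b c *: z =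
      det3 z b c *: a + det3 a z c *: b + det3 a b z *: c.
    by apply: mx2P; rewrite !mxE ?ha ?hb ?hc ?hz /det3; ring.
  by rewrite h1 h2 !scale0r add0r addr0.
exists (det3 a b c), (det3 a z c); split=> //.
apply: contra z0 => /eqP h; move/eqP: e; rewrite h scale0r scalemx_eq0.
by rewrite (negbTE d).
Qed.

Lemma sym_triple (x y : 'M[int]_2) : x^T = x -> y^T = y ->
  (x *m \adj y *m x)^T = x *m \adj y *m x.
Proof. by move=> hx hy; rewrite !trmx_mul -adj2_tr hx hy mulmxA. Qed.

Section Triple.
Variables (R : realType) (xi : R).
Local Notation L := (norm_row xi).

Lemma norm_sym_le (z : 'M[int]_2) : z^T = z ->
  norm_int R z <= (1 + `|xi|) ^+ 2 * (`|(z 0 0)%:~R : R| + L z).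
Proof.
move=> /sym10 hz; have e0 := norm_row_entry xi z 0.
have e1 := norm_row_entry xi z 1; rewrite hz in e0.
have x0 := normr_ge0 xi; have z0 := normr_ge0 ((z 0 0)%:~R : R).
have L0 := norm_row_ge0 xi z.
have h1 : `|(z 0 1)%:~R : R| <= `|xi| * `|(z 0 0)%:~R| + L z.
  have -> : (z 0 1)%:~R = xi * (z 0 0)%:~R - (xi * (z 0 0)%:~R - (z 0 1)%:~R) :> R.
    by ring.
  by apply: normB_le => //; apply: normM_le.
have h2 : `|(z 1 1)%:~R : R| <= `|xi| * (`|xi| * `|(z 0 0)%:~R| + L z) + L z.
  have -> : (z 1 1)%:~R = xi * (z 0 1)%:~R - (xi * (z 0 1)%:~R - (z 1 1)%:~R) :> R.
    by ring.
  by apply: normB_le => //; apply: normM_le.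
apply: norm_le => [|i j]; first by rewrite mulr_ge0 ?exprn_ge0 ?addr_ge0.
have p1 : 0 <= `|xi| * `|(z 0 0)%:~R : R| by rewrite mulr_ge0.
have p2 : 0 <= `|xi| * L z by rewrite mulr_ge0.
have p3 : 0 <= `|xi| * (`|xi| * `|(z 0 0)%:~R : R|) by rewrite mulr_ge0.
have p4 : 0 <= `|xi| * (`|xi| * L z) by rewrite mulr_ge0.
case: (ord2P i) => ->; case: (ord2P j) => ->; rewrite ?hz;
  rewrite expr2; lra.
Qed.

Lemma adjM_le (x y : 'M[int]_2) : x^T = x -> y^T = y ->
  norm_int R (\adj y *m x) <= norm_int R x * L y + norm_int R y * L x.
Proof.
move=> /sym10 hx /sym10 hy.
have x0 := norm_row_entry xi x 0; have x1 := norm_row_entry xi x 1.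
have y0 := norm_row_entry xi y 0; have y1 := norm_row_entry xi y 1.
rewrite hx in x0; rewrite hy in y0.
apply: norm_le => [|i j].
  by rewrite addr_ge0 ?mulr_ge0 ?norm_int_ge0 ?norm_row_ge0.
have nx := norm_entry R x; have ny := norm_entry R y.
rewrite mul2E; case: (ord2P i) => ->; case: (ord2P j) => ->; adjE y;
  rewrite ?hx ?hy !(intrD, intrM, intrN).
- have -> : forall a0 a1 b1 b2 : R, b2 * a0 + - b1 * a1 =
      b1 * (xi * a0 - a1) - a0 * (xi * b1 - b2) by move=> *; ring.
  by rewrite [X in _ <= X]addrC; apply: normB_le; apply: normM_le.
- have -> : forall a1 a2 b1 b2 : R, b2 * a1 + - b1 * a2 =
      b1 * (xi * a1 - a2) - a1 * (xi * b1 - b2) by move=> *; ring.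
  by rewrite [X in _ <= X]addrC; apply: normB_le; apply: normM_le.
- have -> : forall a0 a1 b0 b1 : R, - b1 * a0 + b0 * a1 =
      a0 * (xi * b0 - b1) - b0 * (xi * a0 - a1) by move=> *; ring.
  by apply: normB_le; apply: normM_le.
- have -> : forall a1 a2 b0 b1 : R, - b1 * a1 + b0 * a2 =
      a1 * (xi * b0 - b1) - b0 * (xi * a1 - a2) by move=> *; ring.
  by apply: normB_le; apply: normM_le.
Qed.

Lemma triple_row (x y : 'M[int]_2) : x^T = x -> y^T = y ->
  L (x *m \adj y *m x) <=
  2 * L x * (norm_int R x * L y + norm_int R y * L x).
Proof.
move=> hx hy; rewrite -mulmxA; apply: le_trans (norm_row_mul _ _ _) _.
apply: ler_wpM2l; last exact: adjM_le.
by rewrite mulr_ge0 ?norm_row_ge0.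
Qed.

(** Expanding around x_1 = xi x_0, the coefficient of x_0^2 is xi^2 y_0 - 2 xi y_1 + y_2, a
    combination of the two small quantities of [y]. So the main term is |x|^2 L(y) instead of |x|^2
    |y|, and [norm_sym_le] carries the bound over to the norm. *)
Lemma triple_entry (x y : 'M[int]_2) : x^T = x -> y^T = y ->
  `|((x *m \adj y *m x) 0 0)%:~R : R| <=
  norm_int R x * norm_int R x * ((`|xi| + 1) * L y)
  + 2 * (norm_int R x * (L x * L y)) + L x * L x * norm_int R y.
Proof.
move=> /sym10 hx /sym10 hy.
have x0 := norm_row_entry xi x 0; have y0 := norm_row_entry xi y 0.
have y1 := norm_row_entry xi y 1; rewrite hx in x0; rewrite hy in y0.
rewrite !mul2E; adjE y; rewrite hx hy !(intrD, intrM, intrN).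
have -> : forall a0 a1 b0 b1 b2 : R,
   (a0 * b2 + a1 * - b1) * a0 + (a0 * - b1 + a1 * b0) * a1
   = a0 * a0 * (xi * (xi * b0 - b1) - (xi * b1 - b2))
   - (a0 * ((xi * a0 - a1) * (xi * b0 - b1))
      + a0 * ((xi * a0 - a1) * (xi * b0 - b1)))
   + (xi * a0 - a1) * (xi * a0 - a1) * b0 by move=> *; ring.
have nx := norm_entry R x; have ny := norm_entry R y.
rewrite mulr_natl mulr2n [(_ + 1) * _]mulrDl mul1r; apply: normD_le; last first.
  by apply: normM_le => //; apply: normM_le.
apply: normB_le.
  apply: normM_le; first exact: normM_le.
  by apply: normB_le => //; apply: normM_le.
by apply: normD_le; apply: normM_le => //; apply: normM_le.
Qed.
End Triple.

(* a, ..., g stand for the norms of six consecutive terms, and lb, ..., lg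
   for the corresponding values of norm_row; z and lz are the norms of the
   triple product x *m \adj y *m x of the last two terms. *)
Lemma backward_numeric (R : realType) (C T a b d e f g lb ld le lf lg z lz : R) :
  1 <= C -> 0 <= T -> T <= a -> T <= b -> T <= e ->
  1 <= a -> 1 <= b -> 1 <= d -> 1 <= e -> 1 <= f -> 1 <= g ->
  0 <= lb -> 0 <= ld -> 0 <= le -> 0 <= lf -> 0 <= lg -> 0 <= z -> 0 <= lz ->
  b * a <= C * d -> e <= C * d * b -> e * d <= C * f -> f <= C * e * d ->
  f * e <= C * g -> g <= C * f * e ->
  b * lb <= C -> d * ld <= C -> e * le <= C -> f * lf <= C -> g * lg <= C ->
  lz <= 2 * lf * (f * lg + g * lf) ->
  z <= C * (f * f * (C * lg) + 2 * (f * (lf * lg)) + lf * lf * g + lz) ->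
  let K := 8 * C ^+ 8 in
  [/\ T * (z * ld * le) <= K, T * (d * lz * le) <= K, T * (e * lz * ld) <= K,
      T * (z * lb * ld) <= K & T * (b * lz * ld) <= K /\ T * (d * lz * lb) <= K].
Proof.
move=> C1 T0 Ta Tb Te a1 b1 d1 e1 f1 g1 lb0 ld0 le0 lf0 lg0 z0 lz0.
move=> h1 h2 h3 h4 h5 h6 Lb Ld Le Lf Lg hlz hz K.
have [C0 a0 b0] : [/\ 0 <= C, 0 <= a & 0 <= b] by split; lra.
have [d0 e0] : 0 <= d /\ 0 <= e by split; lra.
have [f0 g0] : 0 <= f /\ 0 <= g by split; lra.
have mulge (x y : R) : 0 <= x -> 0 <= y -> 0 <= x * y by exact: mulr_ge0.
have H1 : f * f * lg <= C * C * C * d.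
  have s1 := ler_wpM2r (mulge _ _ f0 lg0) h4.
  have s2 := ler_wpM2l (mulge _ _ (mulge _ _ C0 d0) lg0) h5.
  have s3 := ler_wpM2l (mulge _ _ (mulge _ _ C0 C0) d0) Lg.
  lra.
have H2 : d * lg <= C * C * C.
  have s1 := ler_wpM2r (mulge _ _ d0 lg0) e1.
  have s2 := ler_wpM2r lg0 h3.
  have s3 := ler_wpM2l (mulge _ _ C0 (mulge _ _ f0 lg0)) e1.
  have s4 := ler_wpM2l (mulge _ _ C0 lg0) h5.
  have s5 := ler_wpM2l (mulge _ _ C0 C0) Lg.
  lra.
have H3 : d * (lf * lf * g) <= C * C * C * C.
  have s1 := ler_wpM2l (mulge _ _ d0 (mulge _ _ lf0 lf0)) h6.
  have s2 := ler_wpM2l (mulge _ _ (mulge _ _ C0 (mulge _ _ e0 d0)) lf0) Lf.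
  have s3 := ler_wpM2l (mulge _ _ (mulge _ _ C0 C0) lf0) h3.
  have s4 := ler_wpM2l (mulge _ _ (mulge _ _ C0 C0) C0) Lf.
  lra.
have H4 : d * (f * (lf * lg)) <= C * C * C * C.
  have s1 := ler_wpM2l (mulge _ _ d0 lg0) Lf.
  have s2 := ler_wpM2r C0 H2.
  lra.
have H5 : d * lz <= 4 * (C * C * C * C).
  have := ler_wpM2l d0 hlz; lra.
have CC : 1 <= C * C * C * C.
  have C2 := ler_pM ler01 ler01 C1 C1; rewrite mulr1 in C2.
  by have := ler_pM ler01 ler01 C2 C2; rewrite mulr1 !mulrA.
pose M := 8 * (C * C * C * C * C).
have M0 : 0 <= M by rewrite /M !mulge.
have H6 : z <= M * d.
  have t1 : lf * lf * g <= C * C * C * C.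
    have := ler_wpM2r (mulge _ _ (mulge _ _ lf0 lf0) g0) d1; lra.
  have t2 : f * (lf * lg) <= C * C * C * C.
    have := ler_wpM2r (mulge _ _ f0 (mulge _ _ lf0 lg0)) d1; lra.
  have t3 : lz <= 4 * (C * C * C * C).
    have := ler_wpM2r lz0 d1; lra.
  have t4 := ler_wpM2l C0 H1.
  have t5 : C * C * C * C <= C * C * C * C * d.
    by rewrite -{1}[_ * C]mulr1 ler_wpM2l ?mulge.
  apply: le_trans hz _; rewrite /M.
  have -> : 8 * (C * C * C * C * C) * d = C * (8 * (C * C * C * C * d)) by ring.
  apply: ler_wpM2l => //; lra.
have H7 : a * (b * ld) <= C * C.
  have s1 := ler_wpM2r ld0 h1; have s2 := ler_wpM2l C0 Ld; lra.
have H8 : d * lz <= M.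
  rewrite /M; apply: le_trans H5 _.
  have : C * C * C * C * 1 <= C * C * C * C * C by rewrite ler_wpM2l ?mulge.
  lra.
have H9 : z * ld <= M * C.
  have s1 := ler_wpM2r ld0 H6; have s2 := ler_wpM2l M0 Ld; lra.
have H10 : lz <= M by have := ler_wpM2r lz0 d1; lra.
have MC0 : 0 <= M * C by exact: mulge.
have MCC : 1 * (M * C) <= C * (M * C) by apply: ler_wpM2r.
have MCCC : 1 * (C * (M * C)) <= C * (C * (M * C)).
  by apply: ler_wpM2r => //; exact: mulge.
have -> : K = C * (C * (M * C)) by rewrite /K /M; ring.
have aux (x l t : R) : 0 <= x -> 0 <= l -> T <= t -> x <= M * C -> t * l <= C ->
    T * (x * l) <= C * (C * (M * C)).
  move=> x0 l0 Tt hx ht.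
  have s1 := ler_wpM2r (mulge _ _ x0 l0) Tt.
  have s2 := ler_wpM2l x0 ht; have s3 := ler_wpM2r C0 hx; lra.
have MMC : M <= M * C by rewrite -{1}[M]mulr1 ler_wpM2l.
split; last split.
- by apply: (aux _ _ e) => //; rewrite mulge.
- by apply: (aux _ _ e) => //; rewrite ?mulge //; lra.
- have s1 := ler_wpM2r (mulge _ _ e0 (mulge _ _ lz0 ld0)) Ta.
  have s2 := ler_wpM2r (mulge _ _ a0 (mulge _ _ lz0 ld0)) h2.
  have s3 := ler_wpM2l (mulge _ _ C0 (mulge _ _ d0 lz0)) H7.
  have s4 := ler_wpM2l (mulge _ _ C0 (mulge _ _ C0 C0)) H8.
  lra.
- have -> : z * lb * ld = z * ld * lb by ring.
  by apply: (aux _ _ b) => //; rewrite mulge.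
- have s1 := ler_wpM2r (mulge _ _ b0 (mulge _ _ lz0 ld0)) Ta.
  have s2 := ler_wpM2l lz0 H7; have s3 := ler_wpM2l (mulge _ _ C0 C0) H10.
  lra.
- by apply: (aux _ _ b) => //; rewrite ?mulge //; lra.
Qed.

(** With Y_i = |y_i|, the triple product z has |z| << Y_{k+2}^2 / Y_{k+3} =~= Y_k and L(z) <<
    Y_{k+3} / Y_{k+2}^2 =~= 1 / Y_k. It is as good a point as y_k, so its determinants with y_k,
    y_{k+1} and with y_{k-1}, y_k vanish. *)
Lemma approx_seq_backward (R : realType) (xi : R) y : approx_seq xi y ->
  exists k0, forall k, (k0 <= k)%N ->
    y k.+2 *m \adj (y k.+3) *m y k.+2 ~~ y k.
Proof.
move=> hy; have y1 i := approx_seq_ge1 i hy.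
case: hy => ysym ydet ydet3 [C0 [C00 hu hl hL hub]].
have x0 := normr_ge0 xi.
pose C := C0 + (1 + `|xi|) ^+ 2.
have C1 : 1 + `|xi| <= (1 + `|xi|) ^+ 2 by rewrite expr2; nra.
have ge0 A : 0 <= norm_int R A by exact: norm_int_ge0.
have rge0 A : 0 <= norm_row xi A by exact: norm_row_ge0.
have CC : C0 <= C by rewrite /C; lra.
pose K := 8 * C ^+ 8.
(* [backward_numeric] bounds each product by K / T, and [det3_le] doubles a sum of three of them: T
   = 6 K + 1 brings the determinants below 1. *)
have [i0 hi0] := hub (6 * K + 1).
(* The six terms in play start at m = k - 2, which must already be in the range of [hi0]. *)
exists i0.+2 => -[|[|m]]; rewrite // !ltnS => hm.
pose z := y m.+4 *m \adj (y m.+4.+1) *m y m.+4; rewrite -/z.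
have zsym : z^T = z by exact: sym_triple.
have Cge0 : 0 <= C by rewrite /C; lra.
have K0 : 0 <= K by rewrite /K mulr_ge0 ?exprn_ge0.
have := @backward_numeric R C (6 * K + 1) (norm_int R (y m)) (norm_int R (y m.+1))
  (norm_int R (y m.+2)) (norm_int R (y m.+3)) (norm_int R (y m.+4))
  (norm_int R (y m.+4.+1)) (norm_row xi (y m.+1)) (norm_row xi (y m.+2))
  (norm_row xi (y m.+3)) (norm_row xi (y m.+4)) (norm_row xi (y m.+4.+1))
  (norm_int R z) (norm_row xi z).
have lC x w : 0 <= w -> x <= C0 * w -> x <= C * w.
  by move=> w0 /le_trans; apply; apply: ler_wpM2r.
have lC2 x v w : 0 <= v -> 0 <= w -> x <= C0 * v * w -> x <= C * v * w.
  by move=> v0 w0 /le_trans; apply; rewrite -!mulrA; apply: ler_wpM2r => //; rewrite mulr_ge0.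
case; rewrite ?ge0 ?rge0 ?y1 //.
- by rewrite /C; lra.
- by lra.
- exact: hi0.
- by apply: hi0; lia.
- by apply: hi0; lia.
- exact: lC.
- exact: lC2.
- exact: lC.
- exact: lC2.
- exact: lC.
- exact: lC2.
- exact: le_trans (hL _) CC.
- exact: le_trans (hL _) CC.
- exact: le_trans (hL _) CC.
- exact: le_trans (hL _) CC.
- exact: le_trans (hL _) CC.
- exact: triple_row.
- apply: le_trans (norm_sym_le xi zsym) _.
  have c0 : 0 <= `|(z 0 0)%:~R : R| + norm_row xi z by rewrite addr_ge0.
  have hC : (1 + `|xi|) ^+ 2 <= C by rewrite /C; lra.
  apply: le_trans (ler_wpM2r c0 hC) _; apply: ler_wpM2l => //.
  apply: lerD => //; apply: le_trans (triple_entry xi (ysym _) (ysym _)) _.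
  apply: lerD => //; apply: lerD => //; apply: ler_wpM2l; first exact: mulr_ge0.
  by apply: ler_wpM2r => //; rewrite /C; lra.
move=> B1 B2 B3 B4 [B5 B6].
have TT : 0 < 6 * K + 1 by lra.
have dz : det3 z (y m.+2) (y m.+3) = 0.
  apply: (@int_small R); apply: le_lt_trans (det3_le xi _ _ _) _ => //.
  rewrite -(ltr_pM2l TT) mulr1; apply: (@le_lt_trans _ _ (6 * K)); last lra.
  move: B1 B2 B3; rewrite -/K; lra.
have dz' : det3 (y m.+1) (y m.+2) z = 0.
  apply: (@int_small R); apply: le_lt_trans (det3_le xi _ _ _) _ => //.
  rewrite -(ltr_pM2l TT) mulr1; apply: (@le_lt_trans _ _ (6 * K)); last lra.
  move: B4 B5 B6; rewrite -/K; lra.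
apply: (prop_of_det3 (a := y m.+1) (c := y m.+3)) => //.
by apply: det_neq0; rewrite !det_mulmx det_adj2 !mulf_neq0.
Qed.

(* N_i in the definition of admissible sequences. *)
Definition alt (N : 'M[int]_2) (i : nat) := if odd i then N^T else N.

Lemma altS N i : alt N i.+1 = (alt N i)^T.
Proof. by rewrite /alt /=; case: (odd i); rewrite ?trmxK. Qed.

Lemma altSS N i : alt N i.+2 = alt N i.
Proof. by rewrite !altS trmxK. Qed.

Lemma det_alt N i : \det (alt N i) = \det N.
Proof. by rewrite /alt; case: (odd i); rewrite ?det_tr. Qed.

Lemma norm_alt (R : realType) N i : norm_int R (alt N i) = norm_int R N.
Proof. by rewrite /alt; case: (odd i); rewrite ?norm_tr. Qed.

Lemma prop_symmetric A B : A ~~ B -> A^T = A -> B^T = B.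
Proof.
move=> [s [t [s0 t0 e]]] hA.
have trZ (k : int) (X : 'M[int]_2) : (k *: X)^T = k *: X^T.
  by apply/matrixP => i j; rewrite !mxE.
have : t *: B^T = t *: B by rewrite -trZ -e trZ hA.
move=> /eqP; rewrite -subr_eq0 -scalerBr scalemx_eq0 (negbTE t0) /=.
by rewrite subr_eq0 => /eqP.
Qed.

Lemma det3_prop a b c c' : c ~~ c' -> det3 a b c = 0 -> det3 a b c' = 0.
Proof.
move=> [s [t [s0 t0 e]]] h.
have : t * det3 a b c' = 0.
  have <- : s * det3 a b c = t * det3 a b c'.
    have e' i j : s * c i j = t * c' i j.
      by have /matrixP/(_ i j) := e; rewrite !mxE.
    rewrite /det3; have -> : forall x y z u v w k : int,
      k * (x * u - y * v + z * w) = (k * x) * u - (k * y) * v + (k * z) * w.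
      by move=> *; ring.
    by rewrite !e'; ring.
  by rewrite h mulr0.
by move=> /eqP; rewrite mulf_eq0 (negbTE t0) => /eqP.
Qed.

(** [M k] is what solving y_{k+1} adj(X) y_k ~ y_{k+2} for X gives, up to a scalar; the backward
    relation then makes one matrix and its transpose serve all indices. *)
Lemma alt_of_backward (y : nat -> 'M[int]_2) :
  (forall i, (y i)^T = y i) -> (forall i, \det (y i) != 0) ->
  (forall k, y k.+2 *m \adj (y k.+3) *m y k.+2 ~~ y k) ->
  exists2 N, calP N & forall k, y k.+1 *m \adj (alt N k.+1) *m y k ~~ y k.+2.
Proof.
move=> ysym ydet hb.
pose M k := y k *m \adj (y k.+2) *m y k.+1.
have MT k : M k.+1 ~~ (M k)^T.
  have -> : (M k)^T = y k.+1 *m \adj (y k.+2) *m y k.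
    by rewrite /M !trmx_mul -adj2_tr !ysym mulmxA.
  rewrite /M -!mulmxA; apply: prop_mul; first exact: prop_refl.
  have h := prop_mul (prop_refl (\adj (y k.+2))) (hb k).
  apply: prop_trans h; apply: prop_sym; rewrite !mulmxA.
  by rewrite -mulmxA; apply: prop_adj_mull.
have detM k : \det (M k) != 0 by rewrite /M !det_mulmx det_adj2 !mulf_neq0.
(* [M 1] rather than [M 0], since [M k] belongs to the index k + 1 and [alt N 2] is [N] itself. *)
pose N := mx_red (M 1%N).
have hN : M 1%N ~~ N by exact/prop_sym/prop_red/det_neq0.
exists N; first exact: red_calP.
have hM k : M k ~~ alt N k.+1.
  elim: k => [|k IH]; last first.
    by rewrite altS; apply: prop_trans (MT k) _; exact: prop_tr.
  rewrite /alt /=; apply: prop_trans (prop_tr hN).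
  by rewrite -{1}[M 0%N]trmxK; apply/prop_tr/prop_sym.
move=> k; have h := prop_adj (hM k).
apply: prop_trans (prop_mul (prop_mul (prop_refl _) (prop_sym h)) (prop_refl _)) _.
rewrite /M !adj2M adj2K !mulmxA.
have h1 := prop_mull_adj (y k.+1 *m \adj (y k.+1) *m y k.+2) (ydet k).
by apply: prop_trans h1 _; apply: prop_adj_mulr.
Qed.

(** The reductions of y_i adj(N_i) satisfy the Fibonacci relation only up to sign, so only the first
    two are kept and the others come from recursion: [F n] holds W_{n+1} and W_{n+2}.
    Proportionality propagates because N_{i+2} = N_i. *)
Lemma fib_of_alt (y : nat -> 'M[int]_2) N :
  (forall i, \det (y i) != 0) -> calP N ->
  (forall k, y k.+1 *m \adj (alt N k.+1) *m y k ~~ y k.+2) ->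
  exists2 W, fibonacci_seq W &
    forall i, (1 <= i)%N -> W i ~~ y i *m \adj (alt N i).
Proof.
move=> ydet [_ dN] h.
have dyN i : \det (y i *m \adj (alt N i)) != 0.
  by rewrite det_mulmx det_adj2 det_alt mulf_neq0.
pose start i := mx_red (y i *m \adj (alt N i)).
pose F := fix F n := if n is n'.+1 then ((F n').2, starmul (F n').2 (F n').1)
                    else (start 1%N, start 2%N).
have hF n : [/\ calP (F n).1, calP (F n).2, (F n).1 ~~ y n.+1 *m \adj (alt N n.+1)
     & (F n).2 ~~ y n.+2 *m \adj (alt N n.+2)].
  elim: n => [|n [h1 h2 h3 h4]].
    by split=> /=; rewrite /start; try exact: red_calP; exact/prop_red/det_neq0.
  have [_ d1] := h1; have [_ d2] := h2.
  split=> //=; first exact: starmul_calP.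
  apply: prop_trans (starmul_prop d2 d1) _.
  apply: prop_trans (prop_mul h4 h3) _; rewrite -(altSS N n.+1) mulmxA.
  by apply: prop_mul; [exact: h | exact: prop_refl].
exists (fun i => (F i.-1).1).
  split=> -[//|i] _; first by case: (hF i).
  by rewrite /=.
by move=> [//|i] _; case: (hF i).
Qed.

(* A symmetric N would make consecutive terms of y coplanar, by det3_mul. *)
Lemma alt_nonsymmetric (y : nat -> 'M[int]_2) N :
  (forall i, (y i)^T = y i) -> (forall i, det3 (y i) (y i.+1) (y i.+2) != 0) ->
  (forall k, y k.+1 *m \adj (alt N k.+1) *m y k ~~ y k.+2) ->
  ~ symmetric_mx N.
Proof.
move=> ysym yd h hN; have h0 := h 0%N.
have hs := prop_symmetric (prop_sym h0) (ysym _).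
have := det3_mul (ysym 0%N) (ysym 1%N) hs.
have -> : alt N 1 = N by exact: hN.
adjE N; rewrite (sym10 hN) subrr mulr0 => e.
have := det3_prop (h0) _; rewrite /alt /= hN => /(_ _ _ e) /eqP.
by rewrite (negbTE (yd 0%N)).
Qed.

(* A skew-symmetric N would make the sequence periodic up to scalars. *)
Lemma alt_skew (y : nat -> 'M[int]_2) N :
  (forall i, (y i)^T = y i) -> (forall i, \det (y i) != 0) -> calP N ->
  (forall k, y k.+1 *m \adj (alt N k.+1) *m y k ~~ y k.+2) ->
  skew_symmetric_mx N -> forall k, y k.+3 ~~ y k.
Proof.
move=> ysym ydet [_ dN] h hN k.
have hN' i : alt N i ~~ N.
  rewrite /alt; case: (odd i); last exact: prop_refl.
  by rewrite hN -scaleN1r; apply: prop_scale.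
have h' i : y i.+1 *m \adj N *m y i ~~ y i.+2.
  apply: prop_trans (h i); apply: prop_mul (prop_refl _).
  by apply: prop_mul (prop_refl _) _; apply: prop_adj; apply: prop_sym.
have aT : (\adj N)^T = - \adj N by rewrite -adj2_tr hN -scaleN1r adj2Z scaleN1r.
have hc := prop_symmetric (prop_sym (h' k)) (ysym _).
rewrite !trmx_mul aT !ysym in hc.
apply: prop_trans (prop_sym (h' k.+1)) _.
(* Transposing a symmetric product with a skew middle factor swaps the outer factors up to sign. *)
have h2 : y k *m \adj N *m y k.+1 ~~ y k.+2.
  apply: prop_trans (h' k); rewrite -hc mulNmx mulmxN !mulmxA -scaleN1r.
  exact/prop_sym/prop_scale.
apply: prop_trans (prop_mul (prop_mul (prop_sym h2) (prop_refl _)) (prop_refl _)) _.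
set S := \adj N in aT *.
have -> : y k *m S *m y k.+1 *m S *m y k.+1 = y k *m (S *m y k.+1 *m S *m y k.+1).
  by rewrite !mulmxA.
have [a00 a11 a10] : [/\ S 0 0 = 0, S 1 1 = 0 & S 1 0 = - S 0 1].
  have e i j : S j i = - S i j by have /matrixP/(_ i j) := aT; rewrite !mxE.
  by split; [have := e 0 0; lia | have := e 1 1; lia | exact: e].
have s0 : S 0 1 != 0.
  have : \det S != 0 by rewrite /S det_adj2.
  by rewrite det2E a00 a10 mul0r sub0r mulrN opprK mulf_eq0 orbb.
clearbody S.
(* For skew S and symmetric y, the product S y S is a multiple of adj(y), so multiplying by y gives
   a scalar matrix. *)
have -> : S *m y k.+1 *m S *m y k.+1 = (- (S 0 1 * S 0 1 * \det (y k.+1)))%:M.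
  have e := sym10 (ysym k.+1).
  by apply: mx2P; rewrite !mul2E ?mxE det2E a00 a11 a10 e /= ?mulr1n ?mulr0n; ring.
rewrite mul_mx_scalar; apply: prop_scale.
by rewrite oppr_eq0 !mulf_neq0.
Qed.

(** In size two, |A|^2 / |det A| is invariant under scaling. When determinants are non-zero integers
    of bounded size, proportional matrices therefore have comparable norms. *)
Lemma prop_norm (R : realType) A B : A ~~ B ->
  norm_int R A ^+ 2 * `|(\det B)%:~R| = norm_int R B ^+ 2 * `|(\det A)%:~R|.
Proof.
move=> [s [t [s0 t0 e]]].
have := congr1 (norm_int R) e; rewrite !norm_scale => h1.
have := congr1 (fun M => `|(\det M)%:~R : R|) e; rewrite !detZ !intrM !normrM => h2.
have s1 : `|s%:~R : R| ^+ 2 != 0 by rewrite expf_neq0 // normr_eq0 intr_eq0.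
apply: (mulfI s1); rewrite mulrA -exprMn h1.
have -> : forall u v w : R, u ^+ 2 * (v * w) = v * (u * u * w) by move=> *; ring.
by rewrite h2; ring.
Qed.

Lemma approx_seq_det_le (R : realType) (xi : R) y : approx_seq xi y ->
  exists2 D : R, 0 < D & forall i, `|(\det (y i))%:~R : R| <= D.
Proof.
move=> [_ _ _ [C [C0 _ _ hL _]]]; exists (2 * C); first by rewrite mulr_gt0.
by move=> i; apply: le_trans (det_le xi _) _; rewrite -mulrA ler_pM2l.
Qed.

Lemma approx_seq_prop_norm (R : realType) (xi : R) y y' : approx_seq xi y -> approx_seq xi y' ->
  exists2 D : R, 0 < D & forall i j, y i ~~ y' j ->
    norm_int R (y i) <= D * norm_int R (y' j).
Proof.
move=> hy hy'; have [D D0 hD] := approx_seq_det_le hy.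
exists (D + 1); first lra.
move=> i j /(prop_norm R) e.
have d' : 1 <= `|(\det (y' j))%:~R : R| by case: hy' => _ h _ _; apply: intr_ge1.
have n0 := norm_int_ge0 R (y i); have n0' := norm_int_ge0 R (y' j).
rewrite -(@ler_pXn2r _ 2) ?nnegrE ?mulr_ge0 //; last lra.
have h1 : norm_int R (y i) ^+ 2 <= norm_int R (y' j) ^+ 2 * D.
  apply: (@le_trans _ _ (norm_int R (y' j) ^+ 2 * `|(\det (y i))%:~R|)).
    by rewrite -e -{1}[_ ^+ 2]mulr1 ler_wpM2l // exprn_ge0.
  by apply: ler_wpM2l => //; rewrite exprn_ge0.
apply: le_trans h1 _; rewrite exprMn mulrC; apply: ler_wpM2r.
  by rewrite exprn_ge0.
by rewrite expr2; nra.
Qed.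

Lemma approx_seq_shift (R : realType) (xi : R) y k :
  approx_seq xi y -> approx_seq xi (fun i => y (i + k)%N).
Proof.
move=> [h1 h2 h3 [C [C0 hu hl hL hub]]]; split=> [i|i|i|] //.
exists C; split=> [//|i|i|i|B]; rewrite ?addSn //.
by have [i0 h] := hub B; exists i0 => i hi; apply: h; lia.
Qed.

Lemma fib_compare (R : realType) (f g : nat -> R) (K C : R) : 0 < K -> 0 < C ->
  (forall i, 0 < f i) -> (forall i, 0 < g i) ->
  (forall i, g i <= K * f i /\ f i <= K * g i) ->
  (forall i, f i.+2 <= C * f i.+1 * f i /\ f i.+1 * f i <= C * f i.+2) ->
  exists2 C', 0 < C' & forall i,
    g i.+2 <= C' * g i.+1 * g i /\ g i.+1 * g i <= C' * g i.+2.
Proof.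
move=> K0 C0 f0 g0 h hf; exists (C * K ^+ 3); first by rewrite mulr_gt0 ?exprn_gt0.
move=> i; have [a1 a2] := h i; have [b1 b2] := h i.+1; have [c1 c2] := h i.+2.
have [h1 h2] := hf i; split.
  apply: le_trans c1 _.
  have -> : C * K ^+ 3 * g i.+1 * g i = K * (C * ((K * g i.+1) * (K * g i))) by ring.
  rewrite ler_pM2l //; apply: le_trans h1 _; rewrite -mulrA ler_pM2l //.
  by apply: ler_pM => //; exact: ltW.
apply: (@le_trans _ _ ((K * f i.+1) * (K * f i))).
  by apply: ler_pM => //; exact: ltW.
have -> : (K * f i.+1) * (K * f i) = K * K * (f i.+1 * f i) by ring.
have -> : C * K ^+ 3 * g i.+2 = K * K * (C * (K * g i.+2)) by ring.
rewrite ler_pM2l ?mulr_gt0 //; apply: le_trans h2 _; by rewrite ler_pM2l.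
Qed.

Lemma approx_seq_fibonacci (R : realType) (xi : R) y : approx_seq xi y ->
  exists W, unbounded_admissible_fibonacci R W /\ star_condition xi W.
Proof.
move=> hy0; have [k0 hb0] := approx_seq_backward hy0.
pose y' i := y (i + k0)%N.
have hy : approx_seq xi y' by exact: approx_seq_shift.
have hb k : y' k.+2 *m \adj (y' k.+3) *m y' k.+2 ~~ y' k.
  by rewrite /y' !addSn; apply: hb0; rewrite leq_addl.
clearbody y'; clear hy0 hb0 y k0; rename y' into y.
have y1 i := approx_seq_ge1 i hy.
have [ysym ydet ydet3 [C [C0 hu hl hL hub]]] := hy.
have [N NP hN] := alt_of_backward ysym ydet hb.
have [W [WP WF] hW] := fib_of_alt ydet NP hN.
have Y0 i : 0 < norm_int R (y i) by apply: lt_le_trans (y1 i).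
have [D D0 hD] := approx_seq_det_le hy.
have dN : 1 <= `|(\det N)%:~R : R| by apply: intr_ge1; case: NP.
have nN : 1 <= norm_int R N by apply/norm_int_ge1/det_neq0; case: NP.
pose dn : R := `|(\det N)%:~R|.
pose K := 2 * norm_int R N * (1 + D * dn).
have Dd : 0 < D * dn by rewrite mulr_gt0 //; apply: lt_le_trans dN.
have K0 : 0 < K by rewrite /K !mulr_gt0 //; lra.
have NK : 2 * norm_int R N <= K.
  by rewrite /K -{1}[2 * _]mulr1; apply: ler_wpM2l; lra.
have cmp i : (1 <= i)%N -> [/\ norm_int R (W i) <= K * norm_int R (y i),
     norm_int R (y i) <= K * norm_int R (W i) &
     norm_row xi (W i) <= K * norm_row xi (y i)].
  move=> i1; have [Wp Wd] := WP i i1.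
  have [s s0 hs] := primitive_prop Wp (prop_sym (hW i i1)).
  have s1 := intr_ge1 R s0.
  have e1 : norm_int R (y i *m \adj (alt N i)) = `|s%:~R| * norm_int R (W i).
    by rewrite hs norm_scale.
  have e2 : norm_row xi (y i *m \adj (alt N i)) = `|s%:~R| * norm_row xi (W i).
    by rewrite hs norm_row_scale.
  have m1 := norm_mul R (y i) (\adj (alt N i)).
  have m2 := norm_row_mul xi (y i) (\adj (alt N i)).
  rewrite e1 norm_adj norm_alt in m1; rewrite e2 norm_adj norm_alt in m2.
  have W0 := norm_int_ge0 R (W i); have rW0 := norm_row_ge0 xi (W i).
  have ry0 := norm_row_ge0 xi (y i).
  split.
  - have := ler_wpM2r W0 s1; rewrite mul1r => /le_trans; apply.
    apply: le_trans m1 _; rewrite mulrAC; apply: ler_wpM2r => //; exact: ltW.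
  (* Determinants give s^2 det W_i = det y_i det N, so the scalar removed by reduction stays
     bounded. *)
  - have hs' : `|s%:~R : R| <= D * dn.
      have := congr1 (fun M => `|(\det M)%:~R : R|) hs.
      rewrite det_mulmx det_adj2 det_alt detZ !intrM !normrM => e.
      have dW := intr_ge1 R Wd; have sq0 : 0 <= `|s%:~R : R| * `|s%:~R| by rewrite mulr_ge0.
      have := ler_wpM2l sq0 dW; rewrite mulr1 -e => h.
      have h' : `|s%:~R : R| <= `|s%:~R| * `|s%:~R| by rewrite -{1}[`|_|]mulr1 ler_wpM2l.
      apply: le_trans h' (le_trans h _); apply: ler_wpM2r; rewrite // /dn; lra.
    have := congr1 (fun M => norm_int R (M *m alt N i)) hs.
    rewrite -mulmxA mul_adj_mx mul_mx_scalar -scalemxAl !norm_scale det_alt => e.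
    have m3 := norm_mul R (W i) (alt N i); rewrite norm_alt in m3.
    have := ler_wpM2r (ltW (Y0 i)) dN; rewrite mul1r e => /le_trans; apply.
    apply: le_trans (ler_pM _ _ hs' m3) _; rewrite ?norm_int_ge0 //.
    have p0 : 0 <= norm_int R (W i) * norm_int R N by rewrite mulr_ge0 // norm_int_ge0.
    rewrite /K; lra.
  - have := ler_wpM2r rW0 s1; rewrite mul1r => /le_trans; apply.
    by apply: le_trans m2 _; rewrite mulrAC; apply: ler_wpM2r.
have W0 i : 0 < norm_int R (W i.+1).
  have [_ h _] := cmp i.+1 isT; have := lt_le_trans (Y0 _) h.
  by rewrite pmulr_rgt0.
exists W; split; first split.
- by [].
- exists N; split=> //.
  + exact: (alt_nonsymmetric ysym ydet3 hN).
  + move=> hsk; have hp := alt_skew ysym ydet NP hN hsk.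
    have [B B0 hB] := approx_seq_prop_norm hy hy.
    (* The norms of proportional terms differ at most by the factor [B], whereas from [i0] on each
       step multiplies the norm by at least B + 2. *)
    have [i0 hr] := fib_ratio C0 Y0 hl hub (B + 2).
    have h1 := hr _ (leqnn i0); have h2 := hr _ (leqnSn i0).
    have h3 := hr i0.+2 (leq_trans (leqnSn i0) (leqnSn _)).
    have h4 := hB _ _ (hp i0).
    have := Y0 i0; have := Y0 i0.+1; have := Y0 i0.+2 => p2 p1 p0.
    have q1 := mulr_gt0 B0 p0; have q2 := mulr_gt0 B0 p1.
    have q3 := mulr_gt0 B0 p2; lra.
  + move=> i i1; rewrite /symmetric_mx.
    apply: (prop_symmetric (A := y i)) => //.
    apply: prop_trans (prop_mul (prop_sym (hW i i1)) (prop_refl _)).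
    by apply/prop_sym/prop_mull_adj; rewrite det_alt; case: NP.
- move=> B; have [i0 h] := hub (K * `|B| + 1 + K).
  have hi := h i0.+1 (leqnSn _); have [_ c2 _] := cmp i0.+1 isT.
  exists i0.+1; split=> //; rewrite -(ltr_pM2l K0); apply: lt_le_trans c2.
  apply: lt_le_trans hi; apply: (@le_lt_trans _ _ (K * `|B|)); last lra.
  by rewrite ler_pM2l // ler_norm.
apply: star_of_growth => //.
  have [C' C'0 h] := fib_compare (f := fun i => norm_int R (y i.+1))
     (g := fun i => norm_int R (W i.+1)) K0 C0 (fun i => Y0 i.+1) W0
     (fun i => let: And3 p q _ := cmp i.+1 isT in conj p q)
     (fun i => conj (hu i.+1) (hl i.+1)).
  by exists C' => // -[//|i] _; exact: h.
exists (K * C * K); split; first by do 2?apply: mulr_gt0 => //.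
move=> [//|i] _; have [c1 c2 c3] := cmp i.+1 isT.
rewrite ler_pdivlMr ?W0 //.
apply: le_trans (ler_pM (norm_row_ge0 _ _) (norm_int_ge0 _ _) c3 c1) _.
have -> : K * norm_row xi (y i.+1) * (K * norm_int R (y i.+1)) =
  K * K * (norm_int R (y i.+1) * norm_row xi (y i.+1)) by ring.
have -> : K * C * K = K * K * C by ring.
apply: ler_wpM2l; [exact/ltW/mulr_gt0 | exact: hL].
Qed.

(** * From Fibonacci sequences to approximation sequences *)

Section FromW.
Variables (R : realType) (W : nat -> 'M[int]_2) (N : 'M[int]_2).
Hypothesis WF : fibonacci_seq W.
Hypothesis NP : calP N.

(* Indices are shifted by one: symW i is the matrix W_{i+1} N_{i+1}. *)
Definition symW (i : nat) := W i.+1 *m alt N i.+1.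

Lemma fib_det i : (1 <= i)%N -> \det (W i) != 0.
Proof. by move=> i1; case: (WF.1 i i1). Qed.

Lemma symW_det i : \det (symW i) != 0.
Proof.
by rewrite /symW det_mulmx det_alt mulf_neq0 ?fib_det //; case: NP.
Qed.

Lemma symW_adj i : symW i *m \adj (alt N i.+1) ~~ W i.+1.
Proof. by apply: prop_mulr_adj; rewrite det_alt; case: NP. Qed.

Lemma symW_rel i : symW i.+1 *m \adj (alt N i.+2) *m symW i ~~ symW i.+2.
Proof.
apply: prop_trans (prop_mul (symW_adj i.+1) (prop_refl _)) _.
rewrite /symW altSS mulmxA; apply: prop_mul (prop_refl _).
by rewrite (WF.2 i.+1 isT); apply/prop_sym/starmul_prop; rewrite fib_det.
Qed.

Lemma fib_norm1 i : 1 <= norm_int R (W i.+1).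
Proof. exact/norm_int_ge1/det_neq0/fib_det. Qed.

Lemma fib_content i : exists2 c : int, c != 0 & c *: W i.+3 = W i.+2 *m W i.+1.
Proof.
exists (mx_content (W i.+2 *m W i.+1))%:Z; last by rewrite (WF.2 i.+1 isT) -content_red.
have : (0 < mx_content (W i.+2 *m W i.+1))%N.
  by apply/content_gt0/det_neq0; rewrite det_mulmx mulf_neq0 ?fib_det.
by case: (mx_content _).
Qed.

Lemma fib_upper i :
  norm_int R (W i.+3) <= 2 * norm_int R (W i.+2) * norm_int R (W i.+1).
Proof.
have [c c0 e] := fib_content i.
have := norm_mul R (W i.+2) (W i.+1); rewrite -e norm_scale; apply: le_trans.
by rewrite -{1}[norm_int R _]mul1r ler_wpM2r ?norm_int_ge0 ?intr_ge1.
Qed.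

Lemma symW_norm : exists2 K : R, 0 < K & forall i,
  norm_int R (symW i) <= K * norm_int R (W i.+1) /\
  norm_int R (W i.+1) <= K * norm_int R (symW i).
Proof.
have dN : 1 <= `|(\det N)%:~R : R| by apply: intr_ge1; case: NP.
have nN : 1 <= norm_int R N by apply/norm_int_ge1/det_neq0; case: NP.
exists (2 * norm_int R N); first by rewrite mulr_gt0 //; lra.
move=> i; split; first by have := norm_mul R (W i.+1) (alt N i.+1); rewrite norm_alt mulrAC.
have := norm_mul R (symW i) (\adj (alt N i.+1)).
rewrite /symW -mulmxA mul_mx_adj mul_mx_scalar norm_scale det_alt norm_adj norm_alt.
rewrite [X in _ <= X]mulrAC; apply: le_trans.
by rewrite -{1}[norm_int R _]mul1r ler_wpM2r ?norm_int_ge0.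
Qed.

Lemma symW_row (xi : R) : exists2 K : R, 0 < K & forall i,
  norm_row xi (symW i) <= K * norm_row xi (W i.+1) /\
  norm_row xi (W i.+1) <= K * norm_row xi (symW i).
Proof.
have dN : 1 <= `|(\det N)%:~R : R| by apply: intr_ge1; case: NP.
have nN : 1 <= norm_int R N by apply/norm_int_ge1/det_neq0; case: NP.
exists (2 * norm_int R N); first by rewrite mulr_gt0 //; lra.
move=> i; split; first by have := norm_row_mul xi (W i.+1) (alt N i.+1); rewrite norm_alt mulrAC.
have := norm_row_mul xi (symW i) (\adj (alt N i.+1)).
rewrite /symW -mulmxA mul_mx_adj mul_mx_scalar norm_row_scale det_alt norm_adj norm_alt.
rewrite [X in _ <= X]mulrAC; apply: le_trans.
by rewrite -{1}[norm_row _ _]mul1r ler_wpM2r ?norm_row_ge0.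
Qed.

Hypothesis Nsym : ~ symmetric_mx N.
Hypothesis WNsym : forall i, (1 <= i)%N -> symmetric_mx (W i *m alt N i).
Hypothesis Wub : unbounded R W.

(** By [det3_mul], a vanishing determinant would make the two off-diagonal entries of [N] equal. *)
Lemma symW_det3 i : det3 (symW i) (symW i.+1) (symW i.+2) != 0.
Proof.
have ysym j : (symW j)^T = symW j by exact: WNsym.
apply/eqP => h.
have hs := prop_symmetric (prop_sym (symW_rel i)) (ysym _).
have := det3_mul (ysym i) (ysym i.+1) hs.
rewrite (det3_prop (prop_sym (symW_rel i)) h) => /esym/eqP.
rewrite !mulf_eq0 !(negbTE (symW_det _)) /=; adjE (alt N i.+2).
rewrite opprK addrC subr_eq0 => /eqP e.
apply: Nsym; rewrite /symmetric_mx; move: e; rewrite /alt; case: (odd _).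
  by rewrite !mxE => e; apply: mx2P; rewrite ?mxE.
by move=> e; apply: mx2P; rewrite ?mxE.
Qed.

Lemma approx_seq_symW (xi : R) C : 0 < C ->
  (forall i, norm_int R (W i.+2) * norm_int R (W i.+1) <= C * norm_int R (W i.+3)) ->
  lesssim (fun i => norm_row xi (W i)) (fun i => (norm_int R (W i))^-1) ->
  approx_seq xi symW.
Proof.
move=> C0 hl [D [D0 hD]].
have W0 i : 0 < norm_int R (W i.+1) by apply: lt_le_trans (fib_norm1 i).
have y0 i : 0 < norm_int R (symW i).
  by apply: lt_le_trans (norm_int_ge1 R (det_neq0 (symW_det i))).
split; [by move=> i; exact: WNsym|exact: symW_det|exact: symW_det3|].
have [K K0 hK] := symW_norm; have [K' K'0 hK'] := symW_row xi.
have C2 : 0 < C + 2 by lra.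
have [C1 C10 hC1] := fib_compare (f := fun i => norm_int R (W i.+1)) K0 C2 W0 y0
   hK (fun i => conj
     (le_trans (fib_upper i) (ler_wpM2r (ltW (W0 i)) (ler_wpM2r (ltW (W0 i.+1))
         (ltac:(lra) : 2 <= C + 2))))
     (le_trans (hl i) (ler_wpM2r (ltW (W0 i.+2)) (ltac:(lra) : C <= C + 2)))).
pose E := K * K' * D.
have E0 : 0 < E by apply: mulr_gt0 => //; exact: mulr_gt0.
exists (C1 + E); split.
- lra.
- move=> i; have [h _] := hC1 i; apply: le_trans h _.
  apply: ler_wpM2r; first exact: ltW.
  by apply: ler_wpM2r; [exact: ltW|lra].
- move=> i; have [_ h] := hC1 i; apply: le_trans h _.
  by apply: ler_wpM2r; [exact: ltW|lra].
- move=> i; have [h1 _] := hK i; have [h2 _] := hK' i.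
  apply: (@le_trans _ _ E); last lra.
  apply: le_trans (ler_pM (norm_int_ge0 _ _) (norm_row_ge0 _ _) h1 h2) _.
  have -> : forall a b : R, K * a * (K' * b) = K * K' * (b * a) by move=> *; ring.
  rewrite /E; apply: ler_wpM2l; first exact/ltW/mulr_gt0.
  by have := hD i.+1 isT; rewrite ler_pdivlMr.
move=> B.
have hub b : exists i, b < norm_int R (W i.+1).
  by have [[|i] [//_ h]] := Wub b; exists i.
have [i0 h] := fib_unbounded (f := fun i => norm_int R (W i.+1)) C0 fib_norm1 hl hub
   (K * B).
exists i0 => i hi; have := h i hi; have [_ h2] := hK i.
by move=> h1; have := le_trans h1 h2; rewrite ler_pM2l.
Qed.
End FromW.

Lemma approx_seq_of_star (R : realType) (xi : R) W :
  unbounded_admissible_fibonacci R W -> star_condition xi W ->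
  exists2 N, calP N & approx_seq xi (symW W N).
Proof.
move=> [WF [N [NP Nsym _ hN]] Wub] [h1 [h2 _] _]; exists N => //.
have W0 i : 0 < norm_int R (W i.+1) by apply: lt_le_trans (fib_norm1 R WF i).
have [C C0 hC] : exists2 C : R, 0 < C & forall i,
    norm_int R (W i.+2) <= C * norm_int R (W i.+1) `^ golden R /\
    norm_int R (W i.+1) `^ golden R <= C * norm_int R (W i.+2).
  case: h1 => [[C1 [C10 hC1]] [C2 [C20 hC2]]]; exists (C1 + C2); first lra.
  move=> i; split.
    apply: le_trans (hC1 i.+1 isT) _; apply: ler_wpM2r; last lra.
    exact: powR_ge0.
  apply: le_trans (hC2 i.+1 isT) _; apply: ler_wpM2r; last lra.
  exact: ltW.
have [K K0 hK] := asympt_gpow (f := fun i => norm_int R (W i.+1)) C0 W0 hC.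
have [D D0 hD] := gpow_fib (f := fun i => norm_int R (W i.+1)) K0 W0 hK.
by apply: (approx_seq_symW WF NP Nsym hN Wub D0) => // i; case: (hD i).
Qed.

(** * Uniqueness *)

Lemma le_eighth (R : realType) (T X x : R) :
  0 < T -> 8 * X <= T -> T * x <= X -> x <= 8^-1.
Proof.
move=> T0 h1 h2; rewrite -(ler_pM2l T0).
by apply: le_trans h2 _; rewrite ler_pdivlMr //; lra.
Qed.

(** Three products of size at most 1/8, doubled by [det3_le], add up to at most 3/4 < 1. *)
Lemma det3_eq0 (R : realType) (xi : R) (a b c : 'M[int]_2) :
  a^T = a -> b^T = b -> c^T = c ->
  norm_int R a * norm_row xi b * norm_row xi c <= 8^-1 ->
  norm_int R b * norm_row xi a * norm_row xi c <= 8^-1 ->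
  norm_int R c * norm_row xi a * norm_row xi b <= 8^-1 ->
  det3 a b c = 0.
Proof.
move=> ha hb hc h1 h2 h3; apply: (@int_small R).
by apply: le_lt_trans (det3_le xi ha hb hc) _; lra.
Qed.

(* The letters a, b, c, d, z stand for the norms of points, and la, ..., lz
   for the corresponding values of norm_row. *)
Lemma match_numeric (R : realType) (C T a b c d z la lb lc ld lz : R) :
  0 <= la -> 0 <= lb -> 0 <= lc -> 0 <= ld -> 0 <= lz ->
  1 <= C -> 64 * C ^+ 5 <= T ->
  T <= a -> T * a <= b -> b <= c -> c <= d ->
  c <= C * b * a -> d <= C * c * b ->
  a * la <= C -> b * lb <= C -> c * lc <= C -> d * ld <= C ->
  z * lz <= C -> b <= z -> z <= c ->
  [/\ z * lb * lc <= 8^-1, b * lz * lc <= 8^-1, c * lz * lb <= 8^-1 &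
     (8 * C ^+ 3 * b <= z ->
        [/\ z * lc * ld <= 8^-1, c * lz * ld <= 8^-1 & d * lz * lc <= 8^-1]) /\
     (z <= 8 * C ^+ 3 * b ->
        [/\ a * lb * lz <= 8^-1, b * la * lz <= 8^-1 & z * la * lb <= 8^-1])].
Proof.
move=> la0 lb0 lc0 ld0 lz0 C1 hT Ta Tab bc cd hc hd La Lb Lc Ld Lz bz zc.
have mulge (x y : R) : 0 <= x -> 0 <= y -> 0 <= x * y by exact: mulr_ge0.
have C2 : 1 <= C ^+ 2 by exact: exprn_ege1.
have C3 : 1 <= C ^+ 3 by exact: exprn_ege1.
have C5 : 1 <= C ^+ 5 by exact: exprn_ege1.
have C25 : C * C <= C ^+ 5.
  rewrite -expr2 -[5%N]/(2 + 3)%N exprD -{1}[C ^+ 2]mulr1.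
  by apply: ler_wpM2l => //; lra.
have C35 : C ^+ 3 <= C ^+ 5.
  rewrite -[5%N]/(3 + 2)%N exprD -{1}[C ^+ 3]mulr1.
  by apply: ler_wpM2l => //; lra.
have C0 : 0 <= C by lra.
have T0 : 0 < T by lra.
have T1 : 1 <= T by lra.
have a0 : 0 <= a by lra.
have ab : a <= b by apply: le_trans Tab; rewrite -{1}[a]mul1r ler_wpM2r.
have Tb : T <= b by lra.
have [b0 [c0 [d0 z0]]] : 0 <= b /\ 0 <= c /\ 0 <= d /\ 0 <= z by do !split; lra.
have Tc : T <= c by lra.
have Td : T <= d by lra.
have Tz : T <= z by lra.
have TL (t l : R) : T <= t -> 0 <= l -> t * l <= C -> T * l <= C.
  by move=> h l0; apply: le_trans; apply: ler_wpM2r.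
have two (x y : R) : 0 <= x -> 0 <= y -> x <= C -> T * y <= C -> x * y <= 8^-1.
  move=> x0 y0 hx hy; apply: (@le_eighth _ T (C * C)) => //; first lra.
  by have := ler_pM x0 (mulge _ _ (ltW T0) y0) hx hy; rewrite mulrCA.
have Tla := TL _ _ Ta la0 La; have Tlb := TL _ _ Tb lb0 Lb.
have Tlc := TL _ _ Tc lc0 Lc; have Tld := TL _ _ Td ld0 Ld.
have Tlz := TL _ _ Tz lz0 Lz.
have up (s t l : R) : 0 <= l -> s <= t -> t * l <= C -> s * l <= C.
  by move=> l0 st; apply: le_trans; apply: ler_wpM2r.
have zlc := up _ _ _ lc0 zc Lc; have blz := up _ _ _ lz0 bz Lz.
have alz := up _ _ _ lz0 ab blz; have cld := up _ _ _ ld0 cd Ld.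
split.
- by rewrite mulrAC; apply: two; rewrite ?mulge.
- by apply: two; rewrite ?mulge.
- apply: (@le_eighth _ T (C ^+ 3)) => //; first lra.
  have s1 := ler_wpM2r (mulge _ _ lz0 lb0) hc.
  have s2 := ler_pM (mulge _ _ b0 lz0) (mulge _ _ (mulge _ _ (ltW T0) a0) lb0)
    blz (up _ _ _ lb0 Tab Lb).
  have s3 := ler_wpM2l C0 s2; have s4 := ler_wpM2l (ltW T0) s1.
  have -> : C ^+ 3 = C * (C * C) by ring.
  lra.
split=> hz; split.
- by apply: two; rewrite ?mulge.
- by rewrite mulrAC; apply: two; rewrite ?mulge.
- apply: (@le_eighth _ (8 * C ^+ 3) (C ^+ 3)) => //; first lra.
  have s1 := ler_wpM2r (mulge _ _ lz0 lc0) hd.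
  have s2 := up _ _ _ lz0 hz Lz.
  have C83 := mulge _ _ (ler0n _ 8) (le_trans ler01 C3).
  have s3 := ler_pM (mulge _ _ c0 lc0) (mulge _ _ (mulge _ _ C83 b0) lz0) Lc s2.
  have s4 := ler_wpM2l C0 s3.
  have s5 := ler_wpM2l (mulge _ _ (ler0n _ 8) (le_trans ler01 C3)) s1.
  have e : C ^+ 3 = C * (C * C) by ring.
  rewrite [X in _ <= X]e; move: (C ^+ 3) s4 s5 => K s4 s5; lra.
- by rewrite mulrAC; apply: two; rewrite ?mulge.
- by rewrite mulrAC; apply: two; rewrite ?mulge.
- apply: (@le_eighth _ T (8 * C ^+ 5)) => //; first lra.
  have s1 := ler_wpM2r (mulge _ _ la0 lb0) hz.
  have s2 := ler_pM (mulge _ _ b0 lb0) (mulge _ _ (ltW T0) la0) Lb Tla.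
  have s3 := ler_wpM2l (mulge _ _ (ler0n _ 8) (le_trans ler01 C3)) s2.
  have s4 := ler_wpM2l (ltW T0) s1.
  have e : C ^+ 5 = C ^+ 3 * (C * C) by ring.
  rewrite e; move: (C ^+ 3) s3 s4 => K s3 s4; lra.
Qed.

(** When |y_{i+1}| <= |y'_j| < |y_{i+2}|, the point y'_j lies in the plane of y_{i+1}, y_{i+2}. If
    it is large compared with y_{i+1}, it also lies in the plane of y_{i+2}, y_{i+3}; otherwise in
    that of y_i, y_{i+1}. Consecutive planes meet in a line, which identifies y'_j. *)
Lemma approx_seq_match (R : realType) (xi : R) y y' : approx_seq xi y -> approx_seq xi y' ->
  forall I, exists J, forall j, (J <= j)%N -> exists2 i, (I <= i)%N & y' j ~~ y i.
Proof.
move=> hy hy' I.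
have [ysym _ ydet3 [C1 [C10 hu1 hl1 hL1 hub1]]] := hy.
have [ysym' ydet' _ [C2 [C20 _ _ hL' hub']]] := hy'.
(* [le_eighth] asks for 8 X <= T, and the worst case in [match_numeric] is X = 8 C^5. *)
pose C := C1 + C2 + 1; pose T := 64 * C ^+ 5.
have hC1 : 1 <= C by rewrite /C; lra.
have Y0 i : 0 < norm_int R (y i) by apply: lt_le_trans (approx_seq_ge1 i hy).
have [i1 h1] := hub1 T; have [i2 h2] := fib_ratio C10 Y0 hl1 hub1 (T + 1).
pose k := maxn I (maxn i1 i2).
have Ik q : (I <= q + k)%N by rewrite /k; lia.
have T0 : 0 < T by have := exprn_ege1 5 hC1; rewrite /T; lra.
pose w i := norm_int R (y (i + k)%N).
have w1 i : T <= w i by apply: h1; rewrite /k; lia.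
have w2 i : (T + 1) * w i <= w i.+1.
  by rewrite /w addSn; apply: h2; rewrite /k; lia.
have w3 i : w i <= w i.+1.
  apply: le_trans (w2 i); rewrite -{1}[w i]mul1r.
  by apply: ler_wpM2r; [exact: norm_int_ge0|lra].
have w2' i : T * w i <= w i.+1.
  by apply: le_trans (w2 i); apply: ler_wpM2r; [exact: norm_int_ge0|lra].
have [J hJ] := hub' (w 0%N + w 1%N).
exists J => j /hJ hj.
pose P m := norm_int R (y' j) < w m.
have exP : exists m, P m.
  have [i0 h] := hub1 (norm_int R (y' j) + 1); exists i0.
  by rewrite /P /w; have := h (i0 + k)%N (leq_addr _ _); lra.
have p0 := w1 0%N; have p1 := w1 1%N.
case: (ex_minnP exP) => -[|[|i]] hPm hmin; first by move: hPm; rewrite /P; lra.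
  by move: hPm; rewrite /P; lra.
have hb : w i.+1 <= norm_int R (y' j).
  by rewrite leNgt; apply/negP => /hmin; rewrite ltnn.
have rge0 A : 0 <= norm_row xi A by exact: norm_row_ge0.
have uC m : w m.+2 <= C * w m.+1 * w m.
  rewrite /w !addSn; apply: le_trans (hu1 _) _.
  apply: ler_wpM2r; first exact: norm_int_ge0.
  by apply: ler_wpM2r; [exact: norm_int_ge0|rewrite /C; lra].
have LC m : w m * norm_row xi (y (m + k)%N) <= C.
  by apply: le_trans (hL1 _) _; rewrite /C; lra.
have LzC : norm_int R (y' j) * norm_row xi (y' j) <= C.
  by apply: le_trans (hL' _) _; rewrite /C; lra.
have [B1 B2 B3 [Bcd Bab]] := @match_numeric R C T (w i) (w i.+1) (w i.+2) (w i.+3)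
  (norm_int R (y' j)) _ _ _ _ _ (rge0 (y (i + k)%N)) (rge0 (y (i.+1 + k)%N))
  (rge0 (y (i.+2 + k)%N)) (rge0 (y (i.+3 + k)%N)) (rge0 (y' j)) hC1 (lexx _) (w1 i)
  (w2' i) (w3 _) (w3 _) (uC _) (uC _) (LC _) (LC _) (LC _) (LC _) LzC hb (ltW hPm).
have z0 := det_neq0 (ydet' j).
have dzbc : det3 (y' j) (y (i.+1 + k)%N) (y (i.+2 + k)%N) = 0 by exact: (@det3_eq0 _ xi).
case: (lerP (8 * C ^+ 3 * w i.+1) (norm_int R (y' j))) => hz.
  have [D1 D2 D3] := Bcd hz.
  exists (i.+2 + k)%N; first exact: Ik.
  apply: (@prop_of_det3 (y (i.+1 + k)%N) _ (y (i.+3 + k)%N)) => //.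
    exact: (@det3_eq0 _ xi).
  by have := dzbc; rewrite /det3 => e; rewrite -[RHS]e; ring.
have [D1 D2 D3] := Bab (ltW hz).
exists (i.+1 + k)%N; first exact: Ik.
apply: (@prop_of_det3 (y (i + k)%N) _ (y (i.+2 + k)%N)) => //.
exact: (@det3_eq0 _ xi).
Qed.

(** Matched terms have comparable norms, and in both sequences the norm of a term is comparable to
    the [gpow] of the next one. So if y'_j matches y_i and y'_{j+1} matches y_{i'}, then [gpow] of
    |y_{i'}| and of |y_{i+1}| agree up to the factor [E]; far out, distinct terms differ by more,
    which forces i' = i + 1. *)
Lemma approx_seq_aligned (R : realType) (xi : R) y y' : approx_seq xi y -> approx_seq xi y' ->
  exists j0 m, forall n, y' (n + j0)%N ~~ y (n + m)%N.
Proof.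
move=> hy hy'.
have [_ _ _ [C1 [C10 _ hl1 _ hub1]]] := hy.
have Y0 i : 0 < norm_int R (y i) by apply: lt_le_trans (approx_seq_ge1 i hy).
have Y'0 i : 0 < norm_int R (y' i) by apply: lt_le_trans (approx_seq_ge1 i hy').
have [D D0 hD] := approx_seq_prop_norm hy hy'.
have [D' D'0 hD'] := approx_seq_prop_norm hy' hy.
have [K K0 hK] := approx_seq_gpow hy; have [K' K'0 hK'] := approx_seq_gpow hy'.
pose p := @gpow R.
pose E := p D * K' * D' * K + K * D * K' * p D'.
have pD := gpow_gt0 D0; have pD' := gpow_gt0 D'0.
have [X [X0 hX]] := gpow_large (E + 1).
have X'0 : 0 < X + 1 by lra.
have pX : E + 1 <= p (X + 1) by apply: hX; lra.
have [I hI] := fib_ratio C10 Y0 hl1 hub1 (X + 1).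
have hI' i i' : (I <= i)%N -> (i < i')%N ->
    (X + 1) * norm_int R (y i) <= norm_int R (y i').
  move=> Ii ii'; rewrite -(subnKC ii'); elim: (i' - i.+1)%N => [|n IH].
    by rewrite addn0; apply: hI.
  rewrite addnS; apply: le_trans IH _.
  apply: le_trans (hI (i.+1 + n)%N (leq_trans Ii _)); last first.
    by rewrite addSnnS leq_addr.
  by rewrite -{1}[norm_int _ _]mul1r; apply: ler_wpM2r; [exact: ltW|lra].
have pY i := gpow_gt0 (Y0 i).
have hI2 i i' : (I <= i)%N -> (i < i')%N ->
    E * p (norm_int R (y i)) < p (norm_int R (y i')).
  move=> Ii ii'; have := gpow_le (mulr_gt0 X'0 (Y0 i)) (hI' i i' Ii ii').
  rewrite gpowM // => h; apply: lt_le_trans h; rewrite ltr_pM2r //.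
  by move: pX; rewrite /p; lra.
have [J hJ] := approx_seq_match hy hy' I.
have step j i i' : y' j ~~ y i -> y' j.+1 ~~ y i' -> (I <= i)%N -> (I <= i')%N ->
    i' = i.+1.
  move=> h1 h2 Ii Ii'.
  have a1 := hD' _ _ h1; have a2 := hD _ _ (prop_sym h1).
  have b1 := hD' _ _ h2; have b2 := hD _ _ (prop_sym h2).
  have [k1 k2] := hK i; have [k3 k4] := hK' j.
  have c1 := gpow_le (Y0 _) b2; rewrite gpowM // in c1.
  have c2 := gpow_le (Y'0 _) b1; rewrite gpowM // in c2.
  have E1 : p (norm_int R (y i')) <= E * p (norm_int R (y i.+1)).
    apply: le_trans c1 _.
    apply: (@le_trans _ _ (p D * (K' * (D' * (K * p (norm_int R (y i.+1))))))).
      apply: ler_wpM2l; first exact: ltW.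
      apply: le_trans k3 _; apply: ler_wpM2l; first exact: ltW.
      apply: le_trans a1 _; apply: ler_wpM2l; first exact: ltW.
      exact: k2.
    have : 0 <= K * D * K' * p D' * p (norm_int R (y i.+1)).
      by rewrite !mulr_ge0 // ltW.
    by rewrite /E mulrDl !mulrA lerDl.
  have E2 : p (norm_int R (y i.+1)) <= E * p (norm_int R (y i')).
    apply: le_trans k1 _.
    apply: (@le_trans _ _ (K * (D * (K' * (p D' * p (norm_int R (y i'))))))).
      apply: ler_wpM2l; first exact: ltW.
      apply: le_trans a2 _; apply: ler_wpM2l; first exact: ltW.
      apply: le_trans k4 _; apply: ler_wpM2l; first exact: ltW.
      exact: c2.
    have : 0 <= p D * K' * D' * K * p (norm_int R (y i')).
      by rewrite !mulr_ge0 // ltW.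
    by rewrite /E mulrDl !mulrA lerDr.
  case: (ltngtP i' i.+1) => // hlt.
    by have := hI2 _ _ Ii' hlt; rewrite ltNge E2.
  by have := hI2 _ _ (leq_trans Ii (leqnSn _)) hlt; rewrite ltNge E1.
have [m Im hm] := hJ J (leqnn J).
exists J, m; elim=> [|n IH] //.
have [i' Ii' hi'] := hJ (n.+1 + J)%N (leq_addl _ _).
rewrite addSn in hi' *.
have -> : (n.+1 + m)%N = i'.
  by rewrite addSn; apply/esym/(step _ _ _ IH) => //; apply: leq_trans Im (leq_addl _ _).
exact: hi'.
Qed.

Lemma prop_adj_cancel (a b X : 'M[int]_2) : \det a != 0 -> \det b != 0 ->
  \adj b *m (b *m X *m a) *m \adj a ~~ X.
Proof.
move=> ha hb; rewrite !mulmxA; apply: prop_trans (prop_mulr_adj _ ha) _.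
exact: prop_adj_mull.
Qed.

Lemma fibonacci_unique (R : realType) (xi : R) W W' :
  unbounded_admissible_fibonacci R W -> star_condition xi W ->
  unbounded_admissible_fibonacci R W' -> star_condition xi W' ->
  exists (k l : nat) (eps : nat -> int),
    sign_fibonacci_seq eps /\
    exists i0 : nat, forall i : nat, (i0 <= i)%N ->
      W' (i + k)%N = eps i *: W (i + l)%N.
Proof.
move=> hW sW hW' sW'.
have [N NP hy] := approx_seq_of_star hW sW; have [N' NP' hy'] := approx_seq_of_star hW' sW'.
have [WF _ _] := hW; have [WF' _ _] := hW'.
have [j0 [m h]] := approx_seq_aligned hy hy'.
(* Solving [symW_rel] for the middle factor: the symmetric matrices determine the admissibility
   matrix up to a scalar, and hence the Fibonacci sequence. *)
have altE V (M : 'M[int]_2) (VF : fibonacci_seq V) (MP : calP M) i :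
    \adj (alt M i.+2) ~~ \adj (symW V M i.+1) *m symW V M i.+2 *m \adj (symW V M i).
  have r := symW_rel VF MP i; have d := symW_det VF MP.
  apply: prop_sym; apply: prop_trans
    (prop_mul (prop_mul (prop_refl _) (prop_sym r)) (prop_refl _)) _.
  exact: prop_adj_cancel.
have hN n : \adj (alt N' (n + j0).+1) ~~ \adj (alt N (n + m).+1).
  have hN2 i : \adj (alt N' (i + j0).+2) ~~ \adj (alt N (i + m).+2).
    apply: prop_trans (altE _ _ WF' NP' _) _.
    apply: (prop_trans _ (prop_sym (altE _ _ WF NP _))).
    apply: prop_mul; last exact/prop_adj/h.
    by apply: prop_mul; [exact/prop_adj/(h i.+1)|exact: (h i.+2)].
  (* [hN2] starts one index too late; it is applied at n + 1 and brought back by the period two of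
     [alt]. *)
  by have := hN2 n.+1; rewrite !addSn !altSS.
have hWW n : W' (n + j0).+1 ~~ W (n + m).+1.
  apply: prop_trans (prop_sym (symW_adj W' NP' _)) _.
  apply: (prop_trans _ (symW_adj W NP _)).
  by apply: prop_mul; [exact: h|exact: hN].
have hE n : exists e : int, (e = 1 \/ e = -1) /\ W' (n + j0).+1 = e *: W (n + m).+1.
  by apply: primitive_prop2 (hWW n); [case: (WF.1 (n + m).+1 isT)|case: (WF'.1 (n + j0).+1 isT)].
have [e he] := choice hE.
exists j0.+1, m.+1, e; split; last first.
  by exists 0%N => i _; rewrite !addnS; case: (he i).
split=> [i _|i _]; first by case: (he i).
have [e0 w0] := he i; have [e1 w1] := he i.+1; have [e2 w2] := he i.+2.
have ee : e i.+1 * e i = 1 \/ e i.+1 * e i = -1.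
  by case: e0 => ->; case: e1 => ->; rewrite ?mulr1 ?mul1r ?mulrN1 ?opprK; tauto.
have d : W (i + m).+3 != 0.
  by apply: det_neq0; case: (WF.1 (i + m).+3 isT).
have key : e i.+2 *: W (i + m).+3 = (e i.+1 * e i) *: W (i + m).+3.
  rewrite !addSn in w1 w2; rewrite -w2 (WF'.2 (i + j0).+1 isT) (WF.2 (i + m).+1 isT).
  rewrite w1 w0 /starmul -red_sign //; congr mx_red.
  by rewrite -scalemxAl -scalemxAr scalerA.
apply/eqP; rewrite -subr_eq0; have := scalemx_eq0 (e i.+2 - e i.+1 * e i) (W (i + m).+3).
by rewrite (negbTE d) orbF => <-; rewrite scalerBl key subrr.
Qed.

(** * The extremal number attached to a Fibonacci sequence *)

Lemma eq0_of_bounded (R : realType) (x M : R) (f : nat -> R) : 0 <= x ->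
  (forall i, x * f i <= M) -> (forall B, exists i, B <= f i) -> x = 0.
Proof.
move=> x0 h hub; apply/eqP; rewrite eq_le x0 andbT leNgt; apply/negP => xgt.
have [i hi] := hub ((M + 1) / x); have := h i.
move: hi; rewrite ler_pdivrMr // mulrC; lra.
Qed.

(** The squared trace is x_0^2 + 2 x_1^2 + x_2^2 + 2 det, so a bounded determinant makes trace and
    norm comparable. This gives a safe denominator before the limit direction is known. *)
Lemma trace_ge (R : realType) (A : 'M[int]_2) (D : R) : A^T = A ->
  `|(\det A)%:~R : R| <= D -> 4 * D <= norm_int R A ^+ 2 -> 1 <= norm_int R A ->
  norm_int R A <= 2 * `|(A 0 0)%:~R + (A 1 1)%:~R|.
Proof.
move=> /sym10 hA hd hD A1; set t := `|_ + _|.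
have t0 : 0 <= t by exact: normr_ge0.
have tsq : t ^+ 2 = (A 0 0)%:~R ^+ 2 + (A 1 1)%:~R ^+ 2
    + 2 * (A 0 1)%:~R ^+ 2 + 2 * (\det A)%:~R :> R.
  rewrite /t real_normK ?num_real // det2E hA intrB !intrM; ring.
have hn : norm_int R A ^+ 2 <= t ^+ 2 + 2 * D.
  have hd' : - D <= (\det A)%:~R by move: hd; rewrite ler_norml => /andP[].
  have s0 := sqr_ge0 ((A 0 0)%:~R : R); have s1 := sqr_ge0 ((A 0 1)%:~R : R).
  have s2 := sqr_ge0 ((A 1 1)%:~R : R).
  have E0 : 0 <= t ^+ 2 + 2 * D by rewrite tsq; lra.
  rewrite -[X in _ <= X]sqr_sqrtr // ler_sqr ?nnegrE ?norm_int_ge0 ?sqrtr_ge0 //.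
  apply: norm_le => [|i j]; first exact: sqrtr_ge0.
  rewrite -sqrtr_sqr ler_sqrt // tsq.
  by case: (ord2P i) => ->; case: (ord2P j) => ->; rewrite ?hA; lra.
rewrite -ler_sqr ?nnegrE ?norm_int_ge0 ?mulr_ge0 // exprMn.
have := sqr_ge0 t; lra.
Qed.

Section Limit.
Variables (R : realType) (y : nat -> 'M[int]_2) (D K : R).
Hypothesis K0 : 0 < K.
Hypothesis ysym : forall i, (y i)^T = y i.
Hypothesis ydet : forall i, \det (y i) != 0.
Hypothesis yD : forall i, `|(\det (y i))%:~R : R| <= D.
Hypothesis ylarge : forall i, 4 * D <= norm_int R (y i) ^+ 2.
Hypothesis ygrow : forall i, 2 * norm_int R (y i) <= norm_int R (y i.+1).
Hypothesis yub : forall B, exists i, B <= norm_int R (y i).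
Hypothesis yadj : forall i,
  norm_int R (y i) * norm_int R (\adj (y i) *m y i.+1) <= K * norm_int R (y i.+1).

Let Y i := norm_int R (y i).
Let x0 i : R := (y i 0 0)%:~R.
Let x1 i : R := (y i 0 1)%:~R.
Let x2 i : R := (y i 1 1)%:~R.
Let tr i := x0 i + x2 i.

Let Y1 i : 1 <= Y i. Proof. exact/norm_int_ge1/det_neq0/ydet. Qed.
Let Y0 i : 0 < Y i. Proof. exact: lt_le_trans (Y1 i). Qed.

Let tr_ge i : Y i <= 2 * `|tr i|.
Proof. exact: trace_ge (yD i) (ylarge i) (Y1 i). Qed.

Let tr_le i : `|tr i| <= 2 * Y i.
Proof. by rewrite mulr_natl; apply: normD_le; apply: norm_entry. Qed.

Let tr0 i : tr i != 0.
Proof. by rewrite -normr_gt0; have := tr_ge i; have := Y0 i; lra. Qed.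

(* The wedge products of two symmetric matrices y, z are the entries (or
   differences of entries) of \adj y *m z. *)
Let close (u : nat -> R) (n := fun i => norm_int R (\adj (y i) *m y i.+1)) :
  (forall i, `|u i.+1 * tr i - u i * tr i.+1| <= 2 * n i) ->
  exists l, forall i, `|u i - l * tr i| <= 32 * K / Y i.
Proof.
move=> hu.
have n0 i : 0 <= n i by exact: norm_int_ge0.
have hs i : `|u i.+1 / tr i.+1 - u i / tr i| <= 8 * K / Y i ^+ 2.
  have -> : u i.+1 / tr i.+1 - u i / tr i =
      (u i.+1 * tr i - u i * tr i.+1) / (tr i * tr i.+1).
    by field; rewrite !tr0.
  rewrite normrM normfV [X in _ / X]normrM ler_pdivrMr; last first.
    by rewrite mulr_gt0 // normr_gt0.
  apply: le_trans (hu i) _; rewrite mulrAC ler_pdivlMr ?exprn_gt0 //.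
  have h1 := yadj i; rewrite -/(n i) -/(Y i) -/(Y i.+1) in h1.
  have h2 := ler_pM (ltW (Y0 i)) (ltW (Y0 i.+1)) (tr_ge i) (tr_ge i.+1).
  have h3 := ler_wpM2l (ltW K0) h2; have h4 := ler_wpM2r (ltW (Y0 i)) h1.
  rewrite expr2; lra.
have [l hl] := cauchy_limit (u := fun i => u i / tr i)
   (mulr_gt0 (ltr0n R 8) K0) Y0 ygrow hs.
exists l => i.
have -> : u i - l * tr i = (u i / tr i - l) * tr i.
  by field; rewrite tr0.
have -> : 32 * K / Y i = 2 * (8 * K) / Y i ^+ 2 * (2 * Y i).
  by field; rewrite gt_eqF.
by apply: normM_le; [exact: hl|exact: tr_le].
Qed.

(** Let p and q be the limits of x_0 / tr and x_1 / tr. Bounded determinants put (p, q, 1 - p) on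
    the conic p (1 - p) = q^2. If p were 0, then x_0 and x_1 would be integers tending to 0 and the
    determinant would vanish. So the limit direction is p (1, xi, xi^2) with xi = q / p. *)
Lemma limit_exists : exists (xi C : R), 0 < C /\
  forall i, norm_row xi (y i) <= C / Y i.
Proof.
have s10 i := sym10 (ysym i).
pose n i := norm_int R (\adj (y i) *m y i.+1).
have pe i j k := norm_entry R (\adj (y i) *m y i.+1) j k.
have c0 i : `|x0 i.+1 * tr i - x0 i * tr i.+1| <= 2 * n i.
  have -> : x0 i.+1 * tr i - x0 i * tr i.+1 =
      ((\adj (y i) *m y i.+1) 0 0)%:~R - ((\adj (y i) *m y i.+1) 1 1)%:~R.
    rewrite !mul2E; adjE (y i); rewrite !s10 !(intrD, intrM, intrN) /tr /x0 /x2; ring.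
  by rewrite mulr_natl; apply: normB_le.
have c1 i : `|x1 i.+1 * tr i - x1 i * tr i.+1| <= 2 * n i.
  have -> : x1 i.+1 * tr i - x1 i * tr i.+1 =
      ((\adj (y i) *m y i.+1) 1 0)%:~R + ((\adj (y i) *m y i.+1) 0 1)%:~R.
    rewrite !mul2E; adjE (y i); rewrite !s10 !(intrD, intrM, intrN) /tr /x0 /x1 /x2; ring.
  by rewrite mulr_natl; apply: normD_le.
have [p hp] := close c0; have [q hq] := close c1.
pose E := 32 * K; have E0 : 0 < E by rewrite mulr_gt0.
pose d0 i := x0 i - p * tr i; pose d1 i := x1 i - q * tr i.
have hd0 i : `|d0 i| <= E / Y i by exact: hp.
have hd1 i : `|d1 i| <= E / Y i by exact: hq.
have td (d : R) i : `|d| <= E / Y i -> `|d * tr i| <= 2 * E.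
  move=> h; have -> : 2 * E = E / Y i * (2 * Y i) by field; rewrite gt_eqF.
  exact: normM_le.
have dd (d e : R) i : `|d| <= E / Y i -> `|e| <= E / Y i -> `|d * e| <= E * E.
  move=> h h'; apply: normM_le.
    by apply: le_trans h _; rewrite ler_pdivrMr // -{1}[E]mulr1 ler_pM2l.
  by apply: le_trans h' _; rewrite ler_pdivrMr // -{1}[E]mulr1 ler_pM2l.
have hpq : p * (1 - p) - q ^+ 2 = 0.
  apply/eqP; rewrite -normr_eq0; apply/eqP.
  pose B := D + `|1 - 2 * p| * (2 * E) + E * E + (`|2 * q| * (2 * E) + E * E).
  apply: (@eq0_of_bounded _ _ (4 * B) (fun i => Y i * Y i)) => [//|i|b]; last first.
    have [i hi] := yub `|b|; exists i.
    have := ler_norm b; have := Y1 i; rewrite -/(Y i) in hi => h1 h2.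
    have := normr_ge0 b; nra.
  have e : (p * (1 - p) - q ^+ 2) * (tr i * tr i) =
     (\det (y i))%:~R - (1 - 2 * p) * (d0 i * tr i) + d0 i * d0 i
      + (2 * q * (d1 i * tr i) + d1 i * d1 i).
    rewrite det2E s10 intrB !intrM /d0 /d1 /tr -/(x0 i) -/(x1 i) -/(x2 i); ring.
  have h1 : `|(p * (1 - p) - q ^+ 2) * (tr i * tr i)| <= B.
    rewrite e; apply: normD_le.
      apply: normD_le; last exact: (dd _ _ i).
      by apply: normB_le => //; apply: normM_le => //; exact: td.
    apply: normD_le; last exact: (dd _ _ i).
    by apply: normM_le => //; exact: td.
  rewrite normrM [`|tr i * _|]normrM in h1.
  have h2 := ler_pM (ltW (Y0 i)) (ltW (Y0 i)) (tr_ge i) (tr_ge i).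
  have h3 := ler_wpM2l (normr_ge0 (p * (1 - p) - q ^+ 2)) h2; lra.
have small (d : R) i : `|d| <= E / Y i -> E + 1 <= Y i -> `|d| < 1.
  move=> h1 h2; apply: le_lt_trans h1 _; rewrite ltr_pdivrMr // mul1r; lra.
have p0 : p != 0.
  apply/eqP => p0; have q0 : q = 0.
    by move/eqP: hpq; rewrite p0 mul0r sub0r oppr_eq0 expf_eq0 => /eqP.
  have [i hi] := yub (E + 1).
  have z0 : y i 0 0 = 0.
    by apply: (@int_small R); have := small _ i (hd0 i) hi; rewrite /d0 p0 mul0r subr0.
  have z1 : y i 0 1 = 0.
    by apply: (@int_small R); have := small _ i (hd1 i) hi; rewrite /d1 q0 mul0r subr0.
  by have := ydet i; rewrite det2E z0 z1 !mul0r subr0 eqxx.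
pose xi := q / p.
have xq : xi * q = 1 - p.
  by apply: (mulfI p0); rewrite /xi; move/eqP: hpq; rewrite subr_eq0 => /eqP ->; field.
have xp : xi * p = q by rewrite /xi mulfVK.
clearbody xi.
exists xi, ((`|xi| + 1) * E); split.
  by rewrite mulr_gt0 // ltr_wpDl.
move=> i; apply: norm_row_le => [|j].
  by rewrite !mulr_ge0 ?addr_ge0 ?invr_ge0 // ltW.
rewrite -[X in _ <= X]mulrA mulrDl mul1r; case: (ord2P j) => ->; rewrite ?s10.
  have -> : xi * (y i 0 0)%:~R - (y i 0 1)%:~R = xi * d0 i - d1 i.
    by rewrite /d0 /d1 -/(x0 i) -/(x1 i) -xp; ring.
  by apply: normB_le => //; apply: normM_le.
have -> : xi * (y i 0 1)%:~R - (y i 1 1)%:~R = xi * d1 i + d0 i.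
  have -> : d0 i = (1 - p) * tr i - x2 i by rewrite /d0 /tr; ring.
  by rewrite /d1 -/(x1 i) -/(x2 i) -xq; ring.
by apply: normD_le => //; apply: normM_le.
Qed.
End Limit.

Lemma growth_extremal (R : realType) W : unbounded_admissible_fibonacci R W ->
  lesssim (fun i => norm_int R (W i.+1) * norm_int R (W i))
          (fun i => norm_int R (W i.+2)) ->
  lesssim (fun i => abs_det R (W i)) (fun=> 1) ->
  exists xi : R, extremal xi /\ star_condition xi W.
Proof.
move=> [WF [N [NP Nsym _ hN]] Wub] [C [C0 hC]] [D [D0 hD]].
have W1 i := fib_norm1 R WF i.
have W0 i : 0 < norm_int R (W i.+1) by apply: lt_le_trans (W1 i).
have hl i : norm_int R (W i.+2) * norm_int R (W i.+1) <= C * norm_int R (W i.+3).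
  exact: (hC i.+1 isT).
pose y := symW W N.
have ysym i : (y i)^T = y i by exact: hN.
have ydet i : \det (y i) != 0 by exact: symW_det.
have y0 i : 0 < norm_int R (y i).
  by apply: lt_le_trans (norm_int_ge1 R (det_neq0 (ydet i))).
have [K K0 hK] := symW_norm R W NP.
have hub : forall B, exists i0, forall i, (i0 <= i)%N -> B <= norm_int R (W i.+1).
  apply: (fib_unbounded C0 W1 hl) => b.
  by have [[|i] [//_ h]] := Wub b; exists i.
have [i1 hi1] := hub (K * (4 * (D * `|(\det N)%:~R|) + 1)).
have [i2 hi2] := fib_ratio C0 W0 hl hub (2 * K * K).
(* The successor makes i + k positive, so that W_{i+k} is available in [zadj]. *)
pose k := (maxn i1 i2).+1.
pose Dy : R := D * `|(\det N)%:~R|.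
have Dy0 : 0 <= Dy by rewrite mulr_ge0 // ltW.
pose z i := y (i + k)%N.
have zD i : `|(\det (z i))%:~R : R| <= Dy.
  rewrite /z /y /symW det_mulmx det_alt intrM normrM; apply: ler_wpM2r => //.
  by have := hD (i + k).+1 isT; rewrite mulr1.
have zlarge1 i : 4 * Dy + 1 <= norm_int R (z i).
  have [_ h] := hK (i + k)%N; rewrite -(ler_pM2l K0); apply: le_trans h.
  by apply: hi1; rewrite /k; clear; lia.
have zlarge i : 4 * Dy <= norm_int R (z i) ^+ 2.
  by have := zlarge1 i; rewrite expr2; nra.
have zgrow i : 2 * norm_int R (z i) <= norm_int R (z i.+1).
  have [_ h] := hK (i.+1 + k)%N; have [h' _] := hK (i + k)%N.
  rewrite -(ler_pM2l K0); apply: le_trans h; rewrite addSn.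
  apply: le_trans (hi2 (i + k)%N _); last by rewrite /k; clear; lia.
  have -> : K * (2 * norm_int R (z i)) = 2 * K * norm_int R (z i) by ring.
  have -> : forall u v : R, 2 * K * u * v = 2 * K * (u * v) by move=> *; ring.
  by apply: ler_wpM2l => //; rewrite mulr_ge0 // ltW.
have zub B : exists i, B <= norm_int R (z i).
  have [i0 h] := hub (K * B); exists i0; have [_ h'] := hK (i0 + k)%N.
  rewrite -(ler_pM2l K0); apply: le_trans h'; apply: h.
  exact: leq_addr.
pose n := norm_int R N.
have n0 : 0 <= n by exact: norm_int_ge0.
have zadj i : norm_int R (z i) * norm_int R (\adj (z i) *m z i.+1)
    <= (K * K * (D * (2 * 2 * n * n)) * C + 1) * norm_int R (z i.+1).
  have [j hj] : exists j, (i + k)%N = j.+1 by rewrite /k addnS; eexists.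
  rewrite /z addSn hj /y.
  have [c c0 e] := fib_content WF j.
  (* The factor adj(W_{j+2}) W_{j+2} collapses to a bounded determinant. What remains has size <<
     |W_{j+1}|, and the growth hypothesis bounds |W_{j+1}| by |W_{j+3}| / |W_{j+2}| up to a
     constant. *)
  have e' : c *: (\adj (symW W N j.+1) *m symW W N j.+2) =
      \det (W j.+2) *: (\adj (alt N j.+2) *m W j.+1 *m alt N j.+3).
    rewrite /symW adj2M scalemxAr [c *: (W _ *m _)]scalemxAl e !mulmxA.
    rewrite -(mulmxA _ (\adj (W j.+2))) mul_adj_mx mul_mx_scalar -!scalemxAl //.
  have h1 : norm_int R (\adj (symW W N j.+1) *m symW W N j.+2)
      <= D * (2 * 2 * n * n) * norm_int R (W j.+1).
    apply: (@le_trans _ _ (`|c%:~R| * norm_int R (\adj (symW W N j.+1) *m symW W N j.+2))).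
      by rewrite -{1}[norm_int R _]mul1r ler_wpM2r ?norm_int_ge0 ?intr_ge1.
    rewrite -norm_scale e' norm_scale -mulrA; apply: ler_pM; rewrite ?norm_int_ge0 //.
      by have := hD j.+2 isT; rewrite mulr1.
    apply: le_trans (norm_mul _ _ _) _; rewrite norm_alt.
    have := norm_mul R (\adj (alt N j.+2)) (W j.+1).
    rewrite norm_adj norm_alt -/n => h.
    have := ler_wpM2r n0 (ler_wpM2l (ler0n R 2) h).
    by congr (_ <= _); ring.
  have [a1 _] := hK j.+1; have [_ a2] := hK j.+2.
  set Q := D * (2 * 2 * n * n) in h1 *.
  have Q0 : 0 <= Q by rewrite /Q !mulr_ge0 // ltW.
  apply: le_trans (ler_pM (norm_int_ge0 _ _) (norm_int_ge0 _ _) a1 h1) _.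
  apply: (@le_trans _ _ (K * K * Q * C * norm_int R (symW W N j.+2))); last first.
    by rewrite mulrDl mul1r lerDl norm_int_ge0.
  have s1 := ler_wpM2l (mulr_ge0 (ltW K0) Q0) (hl j).
  have s2 := ler_wpM2l (mulr_ge0 (mulr_ge0 (ltW K0) Q0) (ltW C0)) a2.
  apply: le_trans (_ : _ <= K * Q * (C * norm_int R (W j.+3))) _.
    by apply: le_trans s1; rewrite le_eqVlt; apply/orP; left; apply/eqP; ring.
  rewrite mulrA; apply: le_trans s2 _.
  by rewrite le_eqVlt; apply/orP; left; apply/eqP; ring.
have KK : 0 < K * K * (D * (2 * 2 * n * n)) * C + 1.
  rewrite ltr_wpDl //; have K0' := ltW K0; have D0' := ltW D0; have C0' := ltW C0.
  by rewrite !mulr_ge0.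
have [xi [E [E0 hE]]] := limit_exists KK (fun i => ysym (i + k)%N)
  (fun i => ydet (i + k)%N) zD zlarge zgrow zub zadj.
have [K' K'0 hK'] := symW_row W NP xi.
have hrow : lesssim (fun i => norm_row xi (W i)) (fun i => (norm_int R (W i))^-1).
  apply: (@lesssim_eventually _ _ _ (K' * E * K) k.+1) => [[//|i] _|[//|i]].
    by rewrite invr_gt0.
  rewrite ltnS => ki; have [_ h1] := hK' i; have [_ h2] := hK i.
  have := hE (i - k)%N; rewrite /z subnK // => h3.
  apply: le_trans h1 _; rewrite -!mulrA; apply: ler_wpM2l; first exact: ltW.
  apply: le_trans h3 _; apply: ler_wpM2l; first exact: ltW.
  by rewrite ler_pdivlMr // mulrC ler_pdivrMr.
exists xi; split.
  exact: approx_seq_extremal (approx_seq_symW WF NP Nsym hN Wub C0 hl hrow).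
apply: star_of_growth hrow; first by case: WF.
exists (C + 2); first lra.
move=> [//|i] _; split.
  apply: le_trans (fib_upper R WF i) _; apply: ler_wpM2r; first exact: ltW.
  by apply: ler_wpM2r; [exact: ltW|lra].
by apply: le_trans (hl i) _; apply: ler_wpM2r; [exact: ltW|lra].
Qed.

(** * Minimal points of an extremal number *)

Definition rnd (R : realType) (x : R) : int := Num.floor (x + 2^-1).

Lemma rnd_le (R : realType) (x : R) : `|x - (rnd x)%:~R| <= 2^-1.
Proof.
have := floor_itv (x + 2^-1); rewrite -/(rnd x) intrD => /andP[h1 h2].
by rewrite ler_norml; apply/andP; split; lra.
Qed.

Lemma rnd_best (R : realType) (x : R) (m : int) :
  `|x - (rnd x)%:~R| <= `|x - m%:~R|.
Proof.
have [->|hm] := eqVneq m (rnd x); first by [].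
have h : m - rnd x != 0 by rewrite subr_eq0.
have h1 := intr_ge1 R h; have h2 := rnd_le x.
have h3 := ler_normB (x - (rnd x)%:~R) (x - m%:~R).
have e : x - (rnd x)%:~R - (x - m%:~R) = (m - rnd x)%:~R by rewrite intrB; ring.
rewrite e in h3; lra.
Qed.

Section Forms.
Variables (R : realType) (xi : R).

(* The index s selects the coordinate x_1 or x_2 of a symmetric matrix, and the
   corresponding power of xi. *)
Definition crd (s : bool) (A : 'M[int]_2) : int := if s then A 1 1 else A 0 1.
Definition err (s : bool) (A : 'M[int]_2) : R :=
  (A 0 0)%:~R * (if s then xi ^+ 2 else xi) - (crd s A)%:~R.
Definition merr (A : 'M[int]_2) : R := Num.max `|err false A| `|err true A|.
(** The two minors of the coordinate vectors that involve x_0; they detect proportionality as soon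
    as one of the two x_0 is non-zero. *)
Definition wedge (s : bool) (A B : 'M[int]_2) : int :=
  A 0 0 * crd s B - crd s A * B 0 0.

Lemma err_le s A : `|err s A| <= merr A.
Proof. by rewrite /merr le_max; case: s; rewrite lexx ?orbT. Qed.

Lemma merr_le A b : (forall s, `|err s A| <= b) -> merr A <= b.
Proof. by move=> h; rewrite /merr ge_max !h. Qed.

Lemma merr_ex A : exists s, merr A = `|err s A|.
Proof.
by rewrite /merr /Num.max; case: ifP => _; [exists true|exists false].
Qed.

Lemma merr_ge0 A : 0 <= merr A.
Proof. exact: le_trans (normr_ge0 _) (err_le true A). Qed.

(* The integer point with first coordinate n closest to n (1, xi, xi^2). *)
Definition pt (n : nat) : 'M[int]_2 :=
  \matrix_(i, j) nth 0 [:: n%:Z; rnd (n%:R * xi); rnd (n%:R * xi ^+ 2)] (i + j)%N.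

Lemma pt_sym n : (pt n)^T = pt n.
Proof. by apply/matrixP => i j; rewrite !mxE addnC. Qed.

Lemma pt00 n : pt n 0 0 = n. Proof. by rewrite mxE. Qed.

Lemma err_pt s n : err s (pt n) =
  n%:R * (if s then xi ^+ 2 else xi)
  - (rnd (n%:R * (if s then xi ^+ 2 else xi)))%:~R.
Proof. by rewrite /err /crd pt00; case: s; rewrite mxE. Qed.

Lemma merr_pt_half n : merr (pt n) <= 2^-1.
Proof. by apply: merr_le => s; rewrite err_pt rnd_le. Qed.

Lemma merr_best (A : 'M[int]_2) n : absz (A 0 0) = n -> merr (pt n) <= merr A.
Proof.
move=> hA; apply: merr_le => s; apply: le_trans (err_le s A).
rewrite err_pt /err; set t := if s then _ else _.
have : A 0 0 = n \/ A 0 0 = - n%:Z by lia.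
case=> ->; first exact: rnd_best.
rewrite intrN mulNr -opprD normrN -[crd s A]opprK intrN; exact: rnd_best.
Qed.

Lemma merr_nonzero (A : 'M[int]_2) : A^T = A -> A != 0 -> A 0 0 = 0 -> 1 <= merr A.
Proof.
move=> /sym10 hs hA h0.
have [s hc] : exists s, crd s A != 0.
  case: (eqVneq (A 0 1) 0) => h1; last by exists false.
  exists true; apply: contra hA => /eqP h2; apply/eqP/mx2P; rewrite !mxE //.
  by rewrite hs.
apply: le_trans (err_le s A); rewrite /err h0 mul0r sub0r normrN.
exact: intr_ge1.
Qed.

Lemma extremal_approx : extremal xi -> exists2 C : R, 0 < C &
  forall X : R, 1 <= X -> exists n : nat,
    [/\ (1 <= n)%N, n%:R <= X & merr (pt n) * gpow X <= C].
Proof.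
move=> [_ _ [c [c0 h]]]; exists c => // X X1.
have pX : 0 < gpow X by apply: gpow_gt0; lra.
have [x0 [x1 [x2 [nz h0 h1 h2]]]] := h X X1.
have e : X `^ (- (golden R)^-1) = (gpow X)^-1 by rewrite powRN.
rewrite e in h1 h2.
pose A : 'M[int]_2 := \matrix_(i, j) nth 0 [:: x0; x1; x2] (i + j)%N.
have hA : merr A * gpow X <= c.
  by rewrite -ler_pdivlMr //; apply: merr_le => -[]; rewrite /err /crd !mxE.
(* A solution with x_0 = 0 has error at least 1, so n = 1, with error at most 1/2, does better. *)
case: (eqVneq x0 0) => hx0; last first.
  exists `|x0|%N; split; first by rewrite absz_gt0.
    by rewrite natr_absz -intr_norm in h0 *.
  apply: le_trans hA; apply: ler_wpM2r; first exact: ltW.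
  by apply: merr_best; rewrite mxE.
exists 1%N; split=> //; apply: le_trans hA; apply: ler_wpM2r; first exact: ltW.
apply: le_trans (merr_pt_half 1) _; apply: (@le_trans _ _ 1); first lra.
apply: merr_nonzero; last by rewrite mxE.
  by apply/matrixP => i j; rewrite !mxE addnC.
apply/eqP => A0; apply: nz.
have e0 : A 0 0 = 0 by rewrite A0 mxE.
have e1 : A 0 1 = 0 by rewrite A0 mxE.
have e2 : A 1 1 = 0 by rewrite A0 mxE.
by move: e0 e1 e2; rewrite !mxE /= => -> -> ->.
Qed.

Lemma merr_pt_gt0 n : no_relation xi -> (1 <= n)%N -> 0 < merr (pt n).
Proof.
move=> hn n1; apply: lt_le_trans (err_le false _).
rewrite normr_gt0 err_pt; apply/eqP => e.
have [] := hn 0 n%:Z (- rnd (n%:R * xi)).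
  by rewrite mul0r add0r intrN -[RHS]e.
by move=> _ [n0]; rewrite n0 in n1.
Qed.

(* The points pt (q k) are the minimal points of Davenport and Schmidt. *)
Definition records (q : nat -> nat) : Prop :=
  [/\ forall k, (1 <= q k)%N, forall k, (q k < q k.+1)%N,
      forall k, merr (pt (q k.+1)) < merr (pt (q k)) &
      forall k m, (1 <= m < q k.+1)%N -> merr (pt (q k)) <= merr (pt m)].

Lemma records_exist : extremal xi -> exists q, records q.
Proof.
move=> hx; have [C C0 hC] := extremal_approx hx.
have hn : no_relation xi by case: hx => h1 h2 _; exact: irrational_no_relation.
(* The guard makes [P] solvable for every n, as [choice] requires. *)
pose P n m := (1 <= n)%N -> [/\ (1 <= m)%N, merr (pt m) < merr (pt n) &
   forall m', (1 <= m' < m)%N -> merr (pt n) <= merr (pt m')].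
have [f hf] : {f & forall n, P n (f n)}.
  apply: (@choice _ _ P) => n; case: (leqP 1 n) => [n1|n0]; last first.
    by exists 0%N => h; move: n0; rewrite ltnNge h.
  have l0 := merr_pt_gt0 hn n1.
  pose Q m := (1 <= m)%N && (merr (pt m) < merr (pt n)).
  have exQ : exists m, Q m.
    have [X [X0 hX]] := gpow_large (C / merr (pt n) + 1).
    have [|m [m1 _ hm]] := hC (X + 1); first lra.
    exists m; rewrite /Q m1 /=; have XX : X <= X + 1 by lra.
    have {}hX := hX _ XX.
    have pX : 0 < gpow (X + 1) by apply: gpow_gt0; lra.
    rewrite -(ltr_pM2r pX); apply: le_lt_trans hm _.
    by rewrite mulrC -ltr_pdivrMr //; lra.
  case: (ex_minnP exQ) => m /andP[m1 hm] hmin; exists m => _; split=> //.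
  move=> m' /andP[m'1 hm']; rewrite leNgt; apply/negP => h.
  by have := hmin m'; rewrite /Q m'1 h leqNgt hm' => /(_ isT).
pose q k := iter k f 1%N.
have q1 k : (1 <= q k)%N by elim: k => [|k IH] //=; case: (hf _ IH).
exists q; split=> // k; last by case: (hf _ (q1 k)).
  have h1 j : merr (pt (q j.+1)) < merr (pt (q j)) by case: (hf _ (q1 j)).
  (* If q_{k+1} < q_k with k > 0, the minimality attached to q_{k-1} contradicts the strict decrease
     of the errors; for k = 0 there is no room below q_0 = 1. *)
  rewrite ltnNge; apply/negP => hle.
  have hne : q k.+1 != q k by apply: contraTneq (h1 k) => ->; rewrite ltxx.
  have hlt : (q k.+1 < q k)%N by rewrite ltn_neqAle hne.
  case: k hle hne hlt => [|k] _ _ hlt.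
    by have := q1 1%N; rewrite leqNgt hlt.
  have [_ _ hm] := hf _ (q1 k); have := hm (q k.+2); rewrite q1 hlt => /(_ isT).
  by rewrite leNgt (lt_trans (h1 k.+1) (h1 k)).
by case: (hf _ (q1 k)).
Qed.
End Forms.

Lemma submxE (A B : 'M[int]_2) i j : (A - B) i j = A i j - B i j.
Proof. by rewrite !mxE. Qed.

Lemma addmxE (A B : 'M[int]_2) i j : (A + B) i j = A i j + B i j.
Proof. by rewrite !mxE. Qed.

Lemma scalemxE (r : int) (A : 'M[int]_2) i j : (r *: A) i j = r * A i j.
Proof. by rewrite !mxE. Qed.

Definition mxlin := (submxE, addmxE, scalemxE).

Lemma int_multiple_le (a b : nat) (r : int) : (1 <= a)%N -> a%:Z = r * b%:Z ->
  (b <= a)%N.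
Proof.
move=> a1 h; have e : a = (absz r * b)%N.
  by have := congr1 absz h; rewrite abszM !absz_nat.
rewrite e leq_pmull // lt0n; apply: contraTneq a1 => r0.
by rewrite e r0 mul0n.
Qed.

Definition zspan (a b z : 'M[int]_2) := exists r t : int, z = r *: a + t *: b.

Lemma zspan_trans a b u v z : zspan a b u -> zspan a b v -> zspan u v z -> zspan a b z.
Proof.
move=> [r [t ->]] [r' [t' ->]] [m [n ->]].
exists (m * r + n * r'), (m * t + n * t').
by rewrite !scalerDr !scalerA !scalerDl addrACA.
Qed.

(** * Planes and lattices spanned by consecutive minimal points *)

Section Records.
Variables (R : realType) (xi : R) (q : nat -> nat).
Hypothesis hq : records xi q.
Hypothesis irr : no_relation xi.

Let x k := pt xi (q k).
Let X k : R := (q k)%:R.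
Let L k := merr xi (x k).

Lemma rec_sym k : (x k)^T = x k. Proof. exact: pt_sym. Qed.
Lemma rec00 k : x k 0 0 = q k. Proof. exact: pt00. Qed.

Lemma rec_X1 k : 1 <= X k. Proof. by rewrite /X ler1n; case: hq. Qed.
Lemma rec_X0 k : 0 < X k. Proof. exact: lt_le_trans ltr01 (rec_X1 k). Qed.

Lemma rec_lt i j : (i < j)%N -> (q i < q j)%N.
Proof.
case: hq => _ h _ _; move=> ij; rewrite -(subnKC ij).
by elim: (j - i.+1)%N => [|n IH]; rewrite ?addn0 // addnS; apply: ltn_trans (h _).
Qed.

Lemma rec_Xle i j : (i <= j)%N -> X i <= X j.
Proof.
rewrite leq_eqVlt => /orP[/eqP -> //|h]; rewrite ler_nat; apply: ltnW.
exact: rec_lt.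
Qed.

Lemma rec_Llt i j : (i < j)%N -> L j < L i.
Proof.
case: hq => _ _ h _; move=> ij; rewrite -(subnKC ij).
by elim: (j - i.+1)%N => [|n IH]; rewrite ?addn0 ?addnS; [apply: h|apply: lt_trans IH; apply: h].
Qed.

Lemma rec_L0 k : 0 < L k.
Proof. by apply: merr_pt_gt0 => //; case: hq. Qed.

Lemma rec_Lhalf k : L k <= 2^-1. Proof. exact: merr_pt_half. Qed.

Lemma rec_min k z : z^T = z -> z != 0 -> `|(z 0 0)%:~R : R| < X k.+1 -> L k <= merr xi z.
Proof.
move=> hz z0 hlt; case: (eqVneq (z 0 0) 0) => h0.
  by apply: le_trans (rec_Lhalf k) _; have := merr_nonzero xi hz z0 h0; lra.
case: hq => _ _ _ hmin; apply: le_trans (merr_best xi (erefl (absz (z 0 0)))).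
apply: hmin; rewrite absz_gt0 h0 /=.
by move: hlt; rewrite -intr_norm -natr_absz ltr_nat.
Qed.

Lemma wedge_errE s (a b : 'M[int]_2) : (wedge s a b)%:~R =
  (b 0 0)%:~R * err xi s a - (a 0 0)%:~R * err xi s b.
Proof. by rewrite /wedge intrB !intrM /err; case: s; ring. Qed.

(** The main term of the wedge is X_{k+1} times the error of [d]; the other is at most half of
    X_{k+1} L_k, since d_0 <= X_{k+1} / 2 and L_{k+1} < L_k. *)
Lemma wedge_lower_aux k (d : 'M[int]_2) : 0 <= (d 0 0)%:~R :> R ->
  2 * (d 0 0)%:~R <= X k.+1 -> L k <= merr xi d ->
  exists s, X k.+1 * L k <= 2 * `|(wedge s d (x k.+1))%:~R|.
Proof.
move=> d0 dX hd; have [s hs] := merr_ex xi d; exists s.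
rewrite wedge_errE rec00 -pmulrn -/(X _).
have h := lerB_dist ((X k.+1) * err xi s d) ((d 0 0)%:~R * err xi s (x k.+1)).
have X0 := rec_X0 k.+1; have Ll := rec_Llt (ltnSn k); have L0 := rec_L0 k.
rewrite !normrM (gtr0_norm X0) (ger0_norm d0) -hs in h.
have he := err_le xi s (x k.+1); rewrite -/(L _) in he.
have h1 := ler_wpM2l (ltW X0) hd.
have h2 : (d 0 0)%:~R * `|err xi s (x k.+1)| <= (d 0 0)%:~R * L k.
  by apply: ler_wpM2l => //; lra.
have h3 := ler_wpM2r (ltW L0) dX.
lra.
Qed.

Lemma wedge_lower k : exists s, X k.+1 * L k <= 2 * `|(wedge s (x k) (x k.+1))%:~R|.
Proof.
have X0 := rec_X0 k; have Xl := rec_Xle (leqnSn k).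
(* If x_k is too large, x_{k+1} - x_k is small enough, and its wedge with x_{k+1} is the same up to
   sign. *)
case: (lerP (2 * X k) (X k.+1)) => h.
  by apply: wedge_lower_aux; rewrite ?rec00 -?pmulrn -/(X _) //; exact: ltW.
pose d := x k.+1 - x k.
have d00 : (d 0 0)%:~R = X k.+1 - X k :> R.
  by rewrite /d mxlin intrB !rec00.
have dlt : X k < X k.+1 by rewrite ltr_nat; apply: rec_lt.
have [|||s hs] := @wedge_lower_aux k d; rewrite ?d00; try lra.
  apply: rec_min.
  - by rewrite linearB /= !rec_sym.
  - apply: contraTneq dlt => e; rewrite -subr_gt0 -d00 e mxE ltxx //.
  - by rewrite d00 gtr0_norm; lra.
exists s; have -> : wedge s (x k) (x k.+1) = - wedge s d (x k.+1).
  by rewrite /wedge /crd; case: s {hs}; rewrite /d !mxlin; ring.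
by rewrite intrN normrN.
Qed.

Lemma wedge_neq0 k : exists s, wedge s (x k) (x k.+1) != 0.
Proof.
have [s hs] := wedge_lower k; exists s; apply: contraTneq hs => ->.
by rewrite normr0 mulr0 -ltNge mulr_gt0 ?rec_X0 ?rec_L0.
Qed.

Lemma wedge_upper s k : `|(wedge s (x k) (x k.+1))%:~R : R| <= 2 * (X k.+1 * L k).
Proof.
rewrite wedge_errE !rec00 -!pmulrn -!/(X _) mulr_natl; apply: normB_le.
  by apply: normM_le; [rewrite gtr0_norm ?rec_X0|exact: err_le].
apply: normM_le; first by rewrite gtr0_norm ?rec_X0 // rec_Xle.
by apply: le_trans (err_le xi s _) _; apply/ltW/rec_Llt.
Qed.

(* Reducing the coordinates of a lattice point z modulo 1 to [-1/2, 1/2] gives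
   a point contradicting the minimality of x k, unless it is zero. *)
Lemma rec_zspan k z : z^T = z -> det3 (x k) (x k.+1) z = 0 -> zspan (x k) (x k.+1) z.
Proof.
move=> hz hd; have [s ws] := wedge_neq0 k.
pose w := wedge s (x k) (x k.+1).
have w0 : w%:~R != 0 :> R by rewrite intr_eq0.
pose al := wedge s z (x k.+1); pose be := wedge s (x k) z.
have e : w *: z = al *: x k + be *: x k.+1.
  have s1 := sym10 (rec_sym k); have s2 := sym10 (rec_sym k.+1); have s3 := sym10 hz.
  move: hd s1 s2 s3; rewrite /w /al /be /wedge /crd /det3.
  move: (x k) (x k.+1) => a b hd s1 s2 s3.
  apply: mx2P; rewrite !mxlin ?s1 ?s2 ?s3;
    case: (s);
    first [ring | by rewrite -[LHS]addr0 -hd; ring | by rewrite -[LHS]subr0 -hd; ring].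
pose r := rnd (al%:~R / w%:~R : R); pose t := rnd (be%:~R / w%:~R : R).
pose z' := z - (r *: x k + t *: x k.+1).
pose u : R := al%:~R / w%:~R - r%:~R; pose v : R := be%:~R / w%:~R - t%:~R.
have hu : `|u| <= 2^-1 by exact: rnd_le.
have hv : `|v| <= 2^-1 by exact: rnd_le.
have ez i j : (z' i j)%:~R = u * (x k i j)%:~R + v * (x k.+1 i j)%:~R :> R.
  have /matrixP/(_ i j) := e; rewrite !mxlin.
  move/(congr1 (fun n : int => n%:~R : R)); rewrite intrD !intrM => e'.
  rewrite /z' ?mxlin.
  rewrite intrB intrD !intrM /u /v; apply: (mulfI w0).
  rewrite mulrBr e'; field.
  exact: w0.
have z's : z'^T = z'.
  apply/matrixP => i j; rewrite mxE; apply/eqP; rewrite -(@eqr_int R); apply/eqP.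
  by rewrite !ez -{1}(rec_sym k) -{1}(rec_sym k.+1) ![(_^T) _ _]mxE.
have Xk := rec_X0 k; have XS := rec_X0 k.+1.
have dlt : X k < X k.+1 by rewrite ltr_nat; apply: rec_lt.
have Ll := rec_Llt (ltnSn k); have L0 := rec_L0 k.
case: (eqVneq z' 0) => [z0|z0].
  by exists r, t; apply/eqP; rewrite -subr_eq0 -/z' z0.
have hlt : `|(z' 0 0)%:~R : R| < X k.+1.
  rewrite ez !rec00 -!pmulrn -!/(X _).
  have hXk : `|X k| <= X k by rewrite gtr0_norm.
  have hXS : `|X k.+1| <= X k.+1 by rewrite gtr0_norm.
  by have := normD_le (normM_le hu hXk) (normM_le hv hXS); lra.
have := rec_min z's z0 hlt; rewrite leNgt => /negP[].
apply: (@le_lt_trans _ _ (2^-1 * L k + 2^-1 * L k.+1)); last lra.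
apply: merr_le => s'.
have -> : err xi s' z' = u * err xi s' (x k) + v * err xi s' (x k.+1).
  by rewrite /err /crd; case: s'; rewrite !ez; ring.
by apply: normD_le; apply: normM_le => //; exact: err_le.
Qed.

Definition flat k := det3 (x k) (x k.+1) (x k.+2) == 0.

Lemma rec_back k : flat k -> exists (r t : int), t != 0 /\
  x k = r *: x k.+1 + t *: x k.+2.
Proof.
move=> /eqP hd.
have [r [t e]] : zspan (x k.+1) (x k.+2) (x k).
  apply: rec_zspan; first exact: rec_sym.
  by rewrite -hd /det3; ring.
exists r, t; split=> //; apply/eqP => t0.
have /matrixP/(_ 0 0) := e; rewrite t0 scale0r addr0 mxlin !rec00 => h.
have q1 : (1 <= q k)%N by case: hq.
by have := int_multiple_le q1 h; rewrite leqNgt rec_lt.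
Qed.

(** By [rec_back], the two wedges differ by the non-zero integer factor -t. *)
Lemma wedge_flat k s : flat k ->
  `|(wedge s (x k.+1) (x k.+2))%:~R : R| <= `|(wedge s (x k) (x k.+1))%:~R|.
Proof.
move=> /rec_back[r [t [t0 e]]].
have -> : wedge s (x k) (x k.+1) = - t * wedge s (x k.+1) (x k.+2).
  rewrite e /wedge /crd; case: s; rewrite !mxlin; ring.
rewrite intrM normrM intrN normrN -{1}[`|(wedge _ _ _)%:~R|]mul1r.
by apply: ler_wpM2r => //; exact: intr_ge1.
Qed.

(** This carries a bound across a flat stretch of any length without losing a constant. *)
Lemma wedge_chain i j s : (i < j)%N -> (forall m, (i < m < j)%N -> flat m) ->
  `|(wedge s (x j) (x j.+1))%:~R : R| <= `|(wedge s (x i.+1) (x i.+2))%:~R|.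
Proof.
move=> ij; rewrite -(subnKC ij); elim: (j - i.+1)%N => [|n IH] h.
  by rewrite addn0.
rewrite addnS; apply: le_trans (wedge_flat s (h _ _)) (IH _) => [|m hm]; first lia.
by apply: h; lia.
Qed.

Lemma span_forward j n : (forall m, (j <= m < j + n)%N -> flat m) ->
  zspan (x j) (x j.+1) (x (j + n)%N) /\ zspan (x j) (x j.+1) (x (j + n).+1).
Proof.
elim: n => [|n IH] h.
  rewrite addn0; split; [exists 1, 0|exists 0, 1];
  by rewrite scale1r scale0r ?addr0 ?add0r.
have [h1 h2] := IH (fun m hm => h m ltac:(lia)).
rewrite addnS; split=> //; apply: zspan_trans h1 h2 _; apply: rec_zspan (rec_sym _) _.
by apply/eqP; apply: (h (j + n)%N); lia.
Qed.

Lemma span_backward m n : (forall i, (m <= i < m + n)%N -> flat i) ->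
  zspan (x (m + n)) (x (m + n).+1) (x m) /\ zspan (x (m + n)) (x (m + n).+1) (x m.+1).
Proof.
elim: n m => [|n IH] m h.
  rewrite addn0; split; [exists 1, 0|exists 0, 1];
  by rewrite scale1r scale0r ?addr0 ?add0r.
have [h1 h2] := IH m.+1 (fun i hi => h i ltac:(lia)).
rewrite addSnnS in h1 h2; split=> //; apply: zspan_trans h1 h2 _.
by have [r [t [_ e]]] := rec_back (h m ltac:(lia)); exists r, t.
Qed.

(** Flatness puts x_{i+1} in the span of x_j, x_{j+1} and x_{l+1} in that of x_{j+1}, x_{j+2}, so
    the determinant is r t' times that of x_j, x_{j+1}, x_{j+2}. If r or t' were 0, then x_{i+1} or
    x_{l+1} would be an integral multiple of x_{j+1}, against the growth of first coordinates or the
    decrease of errors. *)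
Lemma det3_nonflat i j l : (i < j)%N -> (j < l)%N -> ~~ flat j ->
  (forall m, (i < m < j)%N -> flat m) -> (forall m, (j < m < l)%N -> flat m) ->
  det3 (x i.+1) (x j.+1) (x l.+1) != 0.
Proof.
move=> ij jl hj h1 h2.
have [[r [t e1]] _] : zspan (x j) (x j.+1) (x i.+1) /\ zspan (x j) (x j.+1) (x i.+2).
  have := @span_backward i.+1 (j - i.+1)%N; rewrite subnKC //; apply => m hm.
  by apply: h1; lia.
have [_ [r' [t' e2]]] : zspan (x j.+1) (x j.+2) (x l) /\ zspan (x j.+1) (x j.+2) (x l.+1).
  have := @span_forward j.+1 (l - j.+1)%N; rewrite subnKC //; apply => m hm.
  by apply: h2; lia.
have r0 : r != 0.
  apply/eqP => r0; have /matrixP/(_ 0 0) := e1.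
  rewrite r0 scale0r add0r mxlin !rec00 => h.
  have q1 : (1 <= q i.+1)%N by case: hq.
  by have := int_multiple_le q1 h; rewrite leqNgt rec_lt.
have t0 : t' != 0.
  apply/eqP => t0; have hl := @rec_Llt j.+1 l.+1 jl.
  move: e2; rewrite t0 scale0r addr0 => e2.
  have r'0 : r' != 0.
    apply/eqP => h; have /matrixP/(_ 0 0) := e2; rewrite h scale0r rec00 mxE => h'.
    have : (1 <= q l.+1)%N by case: hq.
    by move: h' => [->].
  have : L j.+1 <= L l.+1.
    apply: merr_le => s; have := err_le xi s (x l.+1); apply: le_trans.
    have -> : err xi s (x l.+1) = r'%:~R * err xi s (x j.+1).
      by rewrite e2 /err /crd; case: s; rewrite !mxlin !intrM; ring.
    by rewrite normrM -{1}[`|err _ _ _|]mul1r ler_wpM2r // intr_ge1.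
  by rewrite leNgt hl.
have -> : det3 (x i.+1) (x j.+1) (x l.+1) = r * t' * det3 (x j) (x j.+1) (x j.+2).
  by rewrite e1 e2 /det3 !mxlin; ring.
by rewrite !mulf_neq0.
Qed.

(** If all triples from k on were flat, all x_m with m >= k would lie in one rational plane. Its
    normal vector (P, -Q, T) would be orthogonal to the limit direction (1, xi, xi^2), an integral
    relation excluded by [irr]. *)
Lemma nonflat_infinite k : exists2 m, (k <= m)%N & ~~ flat m.
Proof.
apply: contrapT => hno.
have hf m : (k <= m)%N -> flat m.
  by move=> km; apply/negPn/negP => h; apply: hno; exists m.
pose P := x k 0 1 * x k.+1 1 1 - x k 1 1 * x k.+1 0 1.
have hd n : det3 (x k) (x k.+1) (x (k + n)%N) = 0.
  have [[r [t e]] _] := @span_forward k n (fun m hm => hf m ltac:(lia)).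
  by rewrite e /det3 !mxlin; ring.
pose Q := wedge true (x k) (x k.+1); pose T := wedge false (x k) (x k.+1).
pose B : R := `|Q%:~R| * 2^-1 + `|T%:~R| * 2^-1.
have rel : P%:~R - Q%:~R * xi + T%:~R * xi ^+ 2 = 0 :> R.
  apply/eqP; rewrite -normr_eq0; apply/eqP.
  apply: (@eq0_of_bounded _ _ B (fun n => X (k + n)%N)) => [//|n|b].
    have := congr1 (fun n : int => n%:~R : R) (hd n).
    rewrite /det3 -/P intrD intrB !intrM mulr0z => hd'.
    have -> : `|P%:~R - Q%:~R * xi + T%:~R * xi ^+ 2| * X (k + n)%N
        = `|T%:~R * err xi true (x (k + n)%N) - Q%:~R * err xi false (x (k + n)%N)|.
      rewrite -[X in _ * X]gtr0_norm ?rec_X0 // -normrM; congr `|_|.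
      rewrite -[LHS]subr0 -hd' /err /crd rec00 -!pmulrn -!/(X _) /Q /T /wedge /crd.
      by rewrite !intrB !intrM; ring.
    rewrite /B [leRHS]addrC; apply: normB_le; apply: normM_le => //;
      by apply: le_trans (err_le _ _ _) (rec_Lhalf _).
  have hX n : n%:R <= X n.
    rewrite ler_nat; elim: n => [//|n IH]; apply: leq_ltn_trans IH _.
    by case: hq.
  exists (Num.truncn `|b|).+1; apply: (@le_trans _ _ ((Num.truncn `|b|).+1)%:R).
    by apply: le_trans (ler_norm b) _; apply/ltW; exact: truncnS_gt.
  by apply: le_trans (hX _) _; apply: rec_Xle; rewrite leq_addl.
have [] := irr (a := T) (b := - Q) (c := P).
  by rewrite -[RHS]rel intrN; ring.
move=> T0 /eqP; rewrite oppr_eq0 => /eqP Q0 _.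
by have [[]] := wedge_neq0 k; rewrite -/Q -/T ?T0 ?Q0 eqxx.
Qed.
End Records.

Lemma rank1_param (x0 x1 x2 : int) : 0 < x0 -> x0 * x2 = x1 * x1 ->
  exists a b h : int,
    [/\ 0 < a, 0 < h, x0 = a * a * h, x1 = a * b * h & x2 = b * b * h].
Proof.
move=> x0p e; have [u [v huv]] := Bezoutz x0 x1.
pose g := gcdz x0 x1; rewrite -/g in huv.
have [/dvdzP[a ea] /dvdzP[b eb]] : (g %| x0)%Z /\ (g %| x1)%Z.
  by split; [exact: dvdz_gcdl|exact: dvdz_gcdr].
have gp : 0 < g.
  by rewrite lt_def /g gcdz_eq0 negb_and gt_eqF.
have ap : 0 < a by rewrite -(pmulr_lgt0 _ gp) -ea.
have g0 : g != 0 by rewrite gt_eqF.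
have a0 : a != 0 by rewrite gt_eqF.
have e1 : u * a + v * b = 1.
  by apply: (mulIf g0); rewrite mul1r -{2}huv ea eb; ring.
have e2 : a * x2 = b * b * g.
  by apply: (mulIf g0); rewrite -[LHS]mulrA [x2 * g]mulrC mulrA -ea e eb; ring.
(* Expanding g = g (u a + v b)^2 and replacing b^2 g by a x_2 exhibits a factor a of g; [h] is the
   cofactor. *)
pose h := g * u * u * a + 2 * g * u * v * b + v * v * x2.
have eg : g = a * h.
  have -> : a * h = g * (u * a) * (u * a) + 2 * g * (u * a) * (v * b) + v * v * (a * x2).
    by rewrite /h; ring.
  rewrite e2; have -> : g * (u * a) * (u * a) + 2 * g * (u * a) * (v * b) + v * v * (b * b * g)
    = g * ((u * a + v * b) * (u * a + v * b)) by ring.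
  by rewrite e1 !mulr1.
exists a, b, h; split=> //.
- by rewrite -(pmulr_rgt0 _ ap) -eg.
- by rewrite ea eg mulrA.
- by rewrite eb eg; ring.
- by apply: (mulfI a0); rewrite e2 eg; ring.
Qed.

Lemma enumerate (P : pred nat) : (forall k, exists2 m, (k <= m)%N & P m) ->
  exists f : nat -> nat, [/\ forall n, P (f n), forall n, (f n < f n.+1)%N &
    forall n m, (f n < m < f n.+1)%N -> ~~ P m].
Proof.
move=> hP; pose Q n m := [/\ (n < m)%N, P m & forall i, (n < i < m)%N -> ~~ P i].
have [g hg] : {g & forall n, Q n (g n)}.
  apply: (@choice _ _ Q) => n.
  have ex : exists m, (n < m)%N && P m by have [m h1 h2] := hP n.+1; exists m; rewrite h1.
  case: (ex_minnP ex) => m /andP[h1 h2] hmin; exists m; split=> // i /andP[i1 i2].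
  by apply/negP => hi; have := hmin i; rewrite i1 hi leqNgt i2 => /(_ isT).
have [m0 _ h0] := hP 0%N.
exists (fun n => iter n g m0); split=> [[|n]|n|n m] //=.
- by case: (hg (iter n g m0)).
- by case: (hg (iter n g m0)).
- by case: (hg (iter n g m0)) => _ _; apply.
Qed.

(** * Growth of the minimal points *)

Section Estimates.
Variables (R : realType) (xi : R) (q : nat -> nat).
Hypothesis hq : records xi q.
Hypothesis irr : no_relation xi.

Let x k := pt xi (q k).
Let X k : R := (q k)%:R.
Let L k := merr xi (x k).
Local Notation p := (@gpow R).

Let X1 k : 1 <= X k. Proof. exact: (rec_X1 hq). Qed.
Let X0 k : 0 < X k. Proof. exact: (rec_X0 hq). Qed.
Let Xle i j : (i <= j)%N -> X i <= X j. Proof. exact: (rec_Xle hq). Qed.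
Let L0 k : 0 < L k. Proof. exact: (rec_L0 hq irr). Qed.
Let Llt i j : (i < j)%N -> L j < L i. Proof. exact: (rec_Llt hq). Qed.
Let Lhalf k : L k <= 2^-1. Proof. exact: rec_Lhalf. Qed.
Let x00 k : x k 0 0 = q k. Proof. exact: pt00. Qed.
Let xsym k : (x k)^T = x k. Proof. exact: pt_sym. Qed.
Let pX k : 0 < p (X k). Proof. exact: gpow_gt0. Qed.

Lemma X_ge_index k : k%:R <= X k.
Proof.
rewrite ler_nat; elim: k => [//|n IH]; apply: leq_ltn_trans IH _.
by case: hq.
Qed.

Lemma X_large B : exists k0, forall k, (k0 <= k)%N -> B <= X k.
Proof.
exists (Num.truncn `|B|).+1 => k hk; apply: le_trans (Xle hk).
apply: le_trans (X_ge_index _); apply: le_trans (ler_norm B) _.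
exact/ltW/truncnS_gt.
Qed.

Lemma rec_gpow : extremal xi -> exists2 C : R, 0 < C & forall k, L k * p (X k.+1) <= C.
Proof.
move=> hx; have [C C0 hC] := extremal_approx hx.
have p2 : 0 < p 2 by exact: gpow_gt0.
exists (p 2 * C) => [|k]; first exact: mulr_gt0.
(* Approximating at half of X_{k+1} yields an n strictly below q_{k+1}, to which the minimality of
   q_k applies. *)
have X2 : 1 <= X k.+1 / 2.
  rewrite ler_pdivlMr // mul1r (ler_nat R 2).
  by have := @rec_lt R xi q hq k k.+1 (ltnSn k); case: hq => h _ _ _; have := h k; clear; lia.
have [n [n1 nX hn]] := hC _ X2.
have XE : X k.+1 = 2 * (X k.+1 / 2) by field.
have Xh : 0 < X k.+1 / 2 by lra.
rewrite XE gpowM // mulrCA ler_pM2l //; apply: le_trans hn.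
apply: ler_wpM2r; first exact/ltW/gpow_gt0.
case: hq => _ _ _ hmin; apply: hmin; rewrite n1 -(ltr_nat R).
by apply: le_lt_trans nX _; have := X0 k.+1; rewrite -/(X _); lra.
Qed.

Lemma det_merr k : `|(\det (x k))%:~R : R| <= (2 + 2 * `|xi|) * (X k * L k).
Proof.
have e1 := err_le xi false (x k); have e2 := err_le xi true (x k).
rewrite -/(L k) in e1 e2.
have -> : (\det (x k))%:~R = X k * (xi * err xi false (x k)
     + xi * err xi false (x k) - err xi true (x k))
   - err xi false (x k) * err xi false (x k).
  rewrite det2E intrB !intrM (sym10 (xsym k)) /err /crd x00 -pmulrn -/(X k); ring.
have nX : `|X k| <= X k by rewrite gtr0_norm.
have l0 := L0 k; have lh := Lhalf k; have x1 := X1 k.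
have h := normB_le (normM_le nX (normB_le (normD_le (normM_le (lexx `|xi|) e1)
  (normM_le (lexx `|xi|) e1)) e2)) (normM_le e1 e1).
apply: le_trans h _.
have : L k * L k <= X k * L k by apply: ler_wpM2r; lra.
lra.
Qed.

Lemma det3_merr k : `|(det3 (x k) (x k.+1) (x k.+2))%:~R : R|
  <= 6 * (X k.+2 * (L k * L k.+1)).
Proof.
pose e s j := err xi s (x j).
have he s j : `|e s j| <= L j by exact: err_le.
have -> : (det3 (x k) (x k.+1) (x k.+2))%:~R =
   X k * (e false k.+1 * e true k.+2 - e true k.+1 * e false k.+2)
   + (X k.+1 * (e true k * e false k.+2 - e false k * e true k.+2)
   + X k.+2 * (e false k * e true k.+1 - e true k * e false k.+1)).
  rewrite /det3 !(intrD, intrB, intrM) /e /err /crd !x00 -!pmulrn -!/(X _); ring.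
have X01 := Xle (leqnSn k); have X12 := Xle (leqnSn k.+1).
have l0 := L0 k; have l1 := L0 k.+1; have l2 := L0 k.+2.
have L01 := ltW (Llt (ltnSn k)); have L12 := ltW (Llt (ltnSn k.+1)).
have aux t i j s s' : 0 < t -> t <= X k.+2 -> L i * L j <= L k * L k.+1 ->
   `|t * (e s i * e s' j - e s' i * e s j)| <= 2 * (X k.+2 * (L k * L k.+1)).
  move=> t0 tX hL.
  have nt : `|t| <= t by rewrite gtr0_norm.
  apply: le_trans (normM_le nt (normB_le (normM_le (he s i) (he s' j))
    (normM_le (he s' i) (he s j)))) _.
  have ll : 0 <= L i * L j by rewrite mulr_ge0 // ltW.
  have := ler_pM (ltW t0) ll tX hL; lra.
have -> : 6 * (X k.+2 * (L k * L k.+1)) = 2 * (X k.+2 * (L k * L k.+1)) +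
  (2 * (X k.+2 * (L k * L k.+1)) + 2 * (X k.+2 * (L k * L k.+1))) by ring.
apply: normD_le; last apply: normD_le.
- apply: aux; [exact: X0|lra|].
  by rewrite mulrC; apply: ler_pM => //; try exact: ltW; apply: le_trans L12 L01.
- apply: aux; [exact: X0|lra|].
  by apply: ler_wpM2l => //; exact: ltW.
- by apply: aux; [exact: X0|lra|].
Qed.

(* A singular record point is h (a^2, a b, b^2); if a is large, the previous
   record z satisfies a z_1 = b z_0 and a z_2 = b z_1, hence is proportional
   to it. *)
Lemma singular_bound C k : (forall k, L k * p (X k.+1) <= C) ->
  \det (x k.+1) = 0 -> p (p (p (X k.+1))) <= (2 + 2 * `|xi|) ^+ 2 * C ^+ 2.
Proof.
move=> hC; rewrite det2E (sym10 (xsym _)) => /eqP; rewrite subr_eq0 => /eqP hd.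
have x0p : 0 < x k.+1 0 0 by rewrite x00 ltz_nat; case: hq.
have [a [b [h [a0 h0 e0 e1 e2]]]] := rank1_param x0p hd.
pose A : R := a%:~R; pose B : R := b%:~R; pose H : R := h%:~R.
have A0 : 0 < A by rewrite ltr0z.
have H1 : 1 <= H by rewrite /H -[1]/(1%:~R) ler_int -gtz0_ge1.
have XE : X k.+1 = A * A * H.
  by rewrite /X pmulrn -x00 e0 !intrM.
have Lk := ltW (Llt (ltnSn k)).
have err1 : A * H * `|A * xi - B| <= L k.
  apply: le_trans (le_trans (err_le xi false (x k.+1)) Lk).
  rewrite /err /crd e0 e1 !intrM -/A -/B -/H.
  have -> : A * A * H * xi - A * B * H = A * H * (A * xi - B) by ring.
  by rewrite [leRHS]normrM [`|A * H|]gtr0_norm // mulr_gt0 //; lra.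
have zerr : X k * `|A * xi - B| <= A * L k.
  apply: (@le_trans _ _ (A * (A * H * `|A * xi - B|))); last by rewrite ler_pM2l.
  have := Xle (leqnSn k); rewrite XE => hX.
  by have := ler_wpM2r (normr_ge0 (A * xi - B)) hX; congr (_ <= _); ring.
have z1 : `|A * xi - B| <= A * L k.
  by apply: le_trans zerr; rewrite -{1}[`|_|]mul1r; apply: ler_wpM2r.
pose E := A * L k; have E0 : 0 < E by exact: mulr_gt0.
pose f s := err xi s (x k).
have hf s : `|f s| <= L k by exact: err_le.
have nA : `|A| <= A by rewrite gtr0_norm.
have nX : `|X k| <= X k by rewrite gtr0_norm.
have u1 : `|(a * x k 0 1 - b * x k 0 0)%:~R : R| <= (2 + 2 * `|xi|) * E.
  have -> : (a * x k 0 1 - b * x k 0 0)%:~R = X k * (A * xi - B) - A * f false.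
    rewrite intrB !intrM /f /err /crd x00 -pmulrn -/(X k) -/A -/B; ring.
  have g1 : `|X k * (A * xi - B)| <= E by rewrite normrM gtr0_norm.
  have := normB_le g1 (normM_le nA (hf false)); rewrite -/E.
  have := mulr_ge0 (normr_ge0 xi) (ltW E0); lra.
have u2 : `|(a * x k 1 1 - b * x k 0 1)%:~R : R| <= (2 + 2 * `|xi|) * E.
  have -> : (a * x k 1 1 - b * x k 0 1)%:~R =
      (xi * (A * f false) - A * f true) + (xi * (X k * (A * xi - B))
       - f false * (A * xi - B)).
    rewrite intrB !intrM /f /err /crd x00 -pmulrn -/(X k) -/A -/B; ring.
  have g1 : `|X k * (A * xi - B)| <= E by rewrite normrM gtr0_norm.
  have f1 : `|f false| <= 1 by have := hf false; have := Lhalf k; lra.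
  have := normD_le (normB_le (normM_le (lexx `|xi|) (normM_le nA (hf false)))
      (normM_le nA (hf true)))
    (normB_le (normM_le (lexx `|xi|) g1) (normM_le f1 z1)); rewrite -/E mul1r.
  by move=> g; apply: le_trans g _; lra.
pose c := 2 + 2 * `|xi|.
have c0 : 0 < c by rewrite /c; have := normr_ge0 xi; lra.
have cE : 1 <= c * E.
  rewrite leNgt; apply/negP => hlt.
  have v1 := int_small (le_lt_trans u1 hlt); have v2 := int_small (le_lt_trans u2 hlt).
  have [s ws] := wedge_neq0 hq irr k; case/eqP: ws.
  rewrite -/(x k) -/(x k.+1) /wedge /crd; case: s; rewrite e0 ?e1 ?e2.
    transitivity (- (h * (a * (a * x k 1 1 - b * x k 0 1) + b * (a * x k 0 1 - b * x k 0 0)))).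
      by ring.
    by rewrite v1 v2 !(mulr0, addr0, oppr0).
  transitivity (- (a * h * (a * x k 0 1 - b * x k 0 0))); first by ring.
  by rewrite v1 mulr0 oppr0.
have AX : A * A <= X k.+1.
  by rewrite XE -{1}[A * A]mulr1; apply: ler_wpM2l => //; rewrite mulr_ge0 // ltW.
pose P := p (X k.+1); pose P3 := p (p P).
have P0 : 0 < P by exact: gpow_gt0.
have PP0 : 0 < p P by exact: gpow_gt0.
have eX : X k.+1 = P * p P by rewrite gpow_gpow.
have eP : P = p P * P3 by rewrite gpow_gpow.
have LC := hC k; rewrite -/P in LC.
have sq : P * P <= c ^+ 2 * (X k.+1 * C ^+ 2).
  have s1 : P <= c * (A * C).
    have := ler_wpM2r (ltW P0) cE; rewrite mul1r => /le_trans; apply.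
    rewrite -mulrA ler_pM2l // /E -mulrA ler_pM2l //.
  have C0 : 0 <= C by apply: le_trans LC; rewrite mulr_ge0 // ltW.
  have := ler_pM (ltW P0) (ltW P0) s1 s1 => /le_trans; apply.
  have -> : c * (A * C) * (c * (A * C)) = c ^+ 2 * (A * A * C ^+ 2) by ring.
  apply: ler_wpM2l; first by rewrite exprn_ge0 // ltW.
  by apply: ler_wpM2r => //; rewrite exprn_ge0.
(* Since 2/gamma = 1 + 1/gamma^3, the square of [P] is X_{k+1} times its threefold [gpow]. *)
rewrite -/P -/P3 -(ler_pM2l (X0 k.+1)).
have -> : X k.+1 * P3 = P * P by rewrite {1}eX {4}eP; ring.
by move: sq; rewrite -/c; congr (_ <= _); ring.
Qed.

Lemma records_approx_seq : extremal xi -> exists y, approx_seq xi y.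
Proof.
move=> hx; have [C C0 hC] := rec_gpow hx.
have [k1 hk1] : exists k1, forall k, (k1 <= k)%N -> \det (x k) != 0.
  have [B1 [_ b1]] := gpow_large ((2 + 2 * `|xi|) ^+ 2 * C ^+ 2 + 1).
  have [B2 [_ b2]] := gpow_large B1; have [B3 [_ b3]] := gpow_large B2.
  have [k0 h0] := X_large B3; exists k0.+1 => -[//|k]; rewrite ltnS => hk.
  apply/eqP => /(singular_bound hC); apply/negP; rewrite -ltNge.
  have h1 := b1 _ (b2 _ (b3 _ (h0 k.+1 (leq_trans hk (leqnSn k))))).
  by apply: lt_le_trans h1; lra.
have pC0 := gpow_gt0 C0.
pose K1 := (2 + 2 * `|xi|) * C.
have c2 : 0 < 2 + 2 * `|xi| by have := normr_ge0 xi; lra.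
have K10 : 0 < K1 by exact: mulr_gt0.
have up k : (k1 <= k)%N -> p (X k.+1) <= K1 * X k.
  move=> hk; have d1 := le_trans (intr_ge1 R (hk1 k hk)) (det_merr k).
  have := ler_wpM2r (ltW (pX k.+1)) d1; rewrite mul1r => /le_trans; apply.
  have -> : (2 + 2 * `|xi|) * (X k * L k) * p (X k.+1) =
    (2 + 2 * `|xi|) * X k * (L k * p (X k.+1)) by ring.
  have -> : K1 * X k = (2 + 2 * `|xi|) * X k * C by rewrite /K1; ring.
  apply: ler_wpM2l => //.
  by rewrite mulr_ge0 // ltW.
pose K2 := 6 * C * C; have K20 : 0 < K2 by rewrite !mulr_gt0.
have XE k : p (X k) * p (p (X k)) = X k by exact: gpow_gpow.
have ppX k : 0 < p (p (X k)) by exact: gpow_gt0.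
(* The non-zero determinant gives 1 << X_{k+2} L_k L_{k+1}, hence X_{k+1}^(1/gamma) << X_{k+2}^(1 -
   1/gamma) = X_{k+2}^(1/gamma^2). *)
have low k : ~~ flat xi q k -> X k.+1 <= K2 `^ golden R * p (X k.+2).
  move=> hk; have d1 := le_trans (intr_ge1 R hk) (det3_merr k).
  have K2g : 0 < K2 `^ golden R by exact: powR_gt0.
  apply: gpow_le_inv; [exact: X0|by rewrite mulr_gt0|].
  rewrite gpowM // gpow_golden // -(ler_pM2l (pX k.+2)).
  have -> : p (X k.+2) * (K2 * p (p (X k.+2))) = K2 * X k.+2.
    by rewrite -{3}(XE k.+2); ring.
  have s1 := ler_pM (mulr_ge0 (ltW (L0 k)) (ltW (pX k.+1)))
     (mulr_ge0 (ltW (L0 k.+1)) (ltW (pX k.+2))) (hC k) (hC k.+1).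
  have s2 := ler_wpM2r (ltW (mulr_gt0 (pX k.+1) (pX k.+2))) d1.
  have s3 := ler_wpM2l (mulr_ge0 (ler0n R 6) (ltW (X0 k.+2))) s1.
  rewrite mul1r in s2; rewrite mulrC; apply: le_trans s2 _.
  rewrite /K2; move: s3; congr (_ <= _); ring.
have [f [f1 f2 f3]] : exists f : nat -> nat, [/\ forall n, (k1 <= f n)%N && ~~ flat xi q (f n),
    forall n, (f n < f n.+1)%N & forall n m, (f n < m < f n.+1)%N -> flat xi q m].
  have [|f [f1 f2 f3]] := @enumerate (fun m => (k1 <= m)%N && ~~ flat xi q m).
    move=> k; have [m hm hf] := nonflat_infinite hq irr (maxn k k1).
    move: hm; rewrite geq_max => /andP[hm1 hm2].
    by exists m => //; rewrite hm2.
  exists f; split=> // n m hm; have := f3 n m hm; have /andP[h _] := f1 n.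
  rewrite negb_and negbK => /orP[|//]; rewrite -ltnNge => hlt.
  by move: hm h hlt; clear; lia.
have fk n : (k1 <= f n)%N by case/andP: (f1 n).
have fnf n : ~~ flat xi q (f n) by case/andP: (f1 n).
(* The triple of index k is x_k, x_{k+1}, x_{k+2}; its middle point is the one kept. *)
pose y n := x (f n).+1; pose Y n := X (f n).+1.
pose K3 := K2 `^ golden R; have K30 : 0 < K3 by exact: powR_gt0.
have Y0 n : 0 < Y n by exact: X0.
have lowY n : Y n <= K3 * p (Y n.+1).
  apply: le_trans (low _ (fnf n)) _; rewrite ler_pM2l //.
  by apply: gpow_le => //; apply: Xle; rewrite ltnS f2.
have pK1 := gpow_gt0 K10.
pose K4 := 4 * C * p K1 * (6 * C * p K1).
have K40 : 0 < K4 by rewrite !mulr_gt0.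
(* Both ends of the flat stretch are used. At j the determinant gives 1 << Y_{n+1}^(1/gamma) L_j.
   The wedge at j is bounded by the one at i + 1, so Y_{n+1} L_j << Y_n^(1/gamma). Together Y_{n+1}
   << Y_{n+1}^(1/gamma) Y_n^(1/gamma), that is, Y_{n+1}^(1/gamma^2) << Y_n^(1/gamma). *)
have upY n : p (Y n.+1) <= K4 `^ golden R * Y n.
  pose i := f n; pose j := f n.+1.
  have ij : (i < j)%N by exact: f2.
  have pp_up k : (k1 <= k)%N -> p (p (X k.+1)) <= p K1 * p (X k).
    by move=> hk; rewrite -gpowM //; apply: gpow_le => //; exact: up.
  have XL k : X k.+1 * L k <= C * p (p (X k.+1)).
    rewrite -{1}(XE k.+1).
    have -> : forall u v w : R, u * v * w = w * u * v by move=> *; ring.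
    by apply: ler_wpM2r; [exact: ltW|exact: hC].
  have a1 : X j.+1 * L j <= 4 * C * p K1 * p (Y n).
    have [s hs] := wedge_lower hq irr j; apply: le_trans hs _.
    have h1 := wedge_chain hq irr s ij (fun m hm => f3 n m hm).
    have h2 := wedge_upper hq s i.+1.
    have h3 := XL i.+1; have h4 := pp_up i.+1 (leq_trans (fk n) (leqnSn _)).
    have h5 := ler_wpM2l (ltW C0) h4; rewrite -/(Y n) in h5.
    have := le_trans h1 h2; rewrite -/(X _) -/(x _) -/(L _); lra.
  have a2 : 1 <= 6 * C * p K1 * p (Y n.+1) * L j.
    apply: le_trans (intr_ge1 R (fnf n.+1)) _; apply: le_trans (det3_merr j) _.
    have h3 := XL j.+1; have h4 := pp_up j.+1 (leq_trans (fk n.+1) (leqnSn _)).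
    have h5 := ler_wpM2l (ltW C0) h4.
    have := ler_wpM2r (ltW (L0 j)) (le_trans h3 h5); rewrite -/(Y n.+1); lra.
  have K4g : 0 < K4 `^ golden R by exact: powR_gt0.
  have pY : 0 < p (Y n.+1) by exact: gpow_gt0.
  apply: gpow_le_inv; [by []|exact: mulr_gt0|].
  rewrite gpowM // gpow_golden // -(ler_pM2l pY) gpow_gpow //.
  have s1 := ler_wpM2l (ltW (Y0 n.+1)) a2; rewrite mulr1 in s1.
  apply: le_trans s1 _.
  have c6 : 0 <= 6 * C * p K1 * p (Y n.+1) by rewrite ltW // !mulr_gt0.
  have := ler_wpM2l c6 a1; rewrite -/(Y n.+1) /K4; congr (_ <= _); ring.
have [D D0 hD] : exists2 D, 0 < D & forall n, p (Y n.+1) <= D * Y n /\ Y n <= D * p (Y n.+1).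
  have K4g : 0 < K4 `^ golden R by exact: powR_gt0.
  exists (K4 `^ golden R + K3) => [|n]; first exact: addr_gt0.
  split; first by apply: le_trans (upY n) _; apply: ler_wpM2r; [exact: ltW|lra].
  by apply: le_trans (lowY n) _; apply: ler_wpM2r; [exact/ltW/gpow_gt0|lra].
have [E E0 hE] := gpow_fib D0 Y0 hD.
have nY n : Y n <= norm_int R (y n).
  have := norm_entry R (y n) 0 0; rewrite /y x00 -pmulrn -/(X _).
  by rewrite gtr0_norm.
pose K5 := (1 + `|xi| + `|xi ^+ 2|) * 2.
have K5s : 2 <= K5 by rewrite /K5; have := normr_ge0 xi; have := normr_ge0 (xi ^+ 2); lra.
have Yn n : norm_int R (y n) <= K5 * Y n.
  have ex s : `|(crd s (y n))%:~R : R| <= (1 + `|xi| + `|xi ^+ 2|) * Y n.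
    have -> : (crd s (y n))%:~R = Y n * (if s then xi ^+ 2 else xi) - err xi s (y n).
      by rewrite /err /y x00 -pmulrn -/(X _) -/(Y n); ring.
    have nYn : `|Y n| <= Y n by rewrite gtr0_norm.
    have hs : `|if s then xi ^+ 2 else xi| <= `|xi| + `|xi ^+ 2|.
      by case: s; rewrite ?lerDl ?lerDr.
    apply: le_trans (normB_le (normM_le nYn hs) (err_le xi s (y n))) _.
    have := Lhalf (f n).+1; have := X1 (f n).+1; rewrite -/(Y n) -/(L _) -/(y n) => g1 g2.
    have : merr xi (y n) <= 2^-1 by exact: g2.
    lra.
  have YK : (1 + `|xi| + `|xi ^+ 2|) * Y n <= K5 * Y n.
    have a1 := normr_ge0 xi; have a2 := normr_ge0 (xi ^+ 2).
    by apply: ler_wpM2r; [exact: ltW|rewrite /K5; lra].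
  have Y00 : `|(y n 0 0)%:~R : R| <= K5 * Y n.
    rewrite /y x00 -pmulrn -/(X _) -/(Y n) gtr0_norm // -{1}[Y n]mul1r.
    by apply: ler_wpM2r; [exact: ltW|lra].
  apply: norm_le => [|i j]; first by rewrite mulr_ge0 // ltW //; lra.
  case: (ord2P i) => ->; case: (ord2P j) => -> //;
    rewrite ?(sym10 (xsym _)); apply: le_trans YK; by [exact: (ex false)|exact: (ex true)].
have n0 n : 0 < norm_int R (y n) by apply: lt_le_trans (nY n).
have K50 : 0 < K5 by lra.
have cmp n : norm_int R (y n) <= K5 * Y n /\ Y n <= K5 * norm_int R (y n).
  split=> //; apply: le_trans (nY n) _; rewrite -{1}[norm_int _ _]mul1r.
  by apply: ler_wpM2r; [exact: ltW|lra].
have [G G0 hG] := fib_compare K50 E0 Y0 n0 cmp hE.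
have K6 : 0 < K5 * (1 + `|xi|) * (K3 * C).
  by rewrite !mulr_gt0 //; have := normr_ge0 xi; lra.
exists y; split.
- by move=> n; exact: xsym.
- by move=> n; apply: hk1; exact: leq_trans (fk n) (leqnSn _).
- move=> n; apply: (det3_nonflat hq irr (f2 n) (f2 n.+1) (fnf _)) => m hm.
    exact: f3 hm.
  exact: f3 hm.
exists (G + K5 * (1 + `|xi|) * (K3 * C)); split.
- exact: addr_gt0.
- move=> n; have [h _] := hG n; apply: le_trans h _.
  apply: ler_wpM2r; first exact: ltW.
  by apply: ler_wpM2r; [exact: ltW|lra].
- by move=> n; have [_ h] := hG n; apply: le_trans h _; apply: ler_wpM2r; [exact: ltW|lra].
- move=> n; apply: (@le_trans _ _ (K5 * (1 + `|xi|) * (K3 * C))); last lra.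
  have hr : norm_row xi (y n) <= (1 + `|xi|) * L (f n).+1.
    have e1 := err_le xi false (y n); have e2 := err_le xi true (y n).
    have xL : 0 <= `|xi| * merr xi (y n) by rewrite mulr_ge0 // merr_ge0.
    apply: norm_row_le => [|j].
      by rewrite mulr_ge0 ?addr_ge0 // ltW.
    rewrite mulrDl mul1r -[L _]/(merr xi (y n)).
    case: (ord2P j) => ->; rewrite ?(sym10 (xsym _)).
      have -> : xi * (y n 0 0)%:~R - (y n 0 1)%:~R = err xi false (y n).
        by rewrite /err /crd mulrC.
      lra.
    have -> : xi * (y n 0 1)%:~R - (y n 1 1)%:~R = err xi true (y n) - xi * err xi false (y n).
      by rewrite /err /crd; ring.
    by apply: normB_le => //; apply: normM_le.
  (* For k = f n, [low] bounds Y_n = X_{k+1} by the power X_{k+2}^(1/gamma), whose product with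
     L_{k+1} is bounded. *)
  have hl : Y n * L (f n).+1 <= K3 * C.
    have h1 := ler_wpM2r (ltW (L0 (f n).+1)) (low _ (fnf n)).
    have h2 := ler_wpM2l (ltW K30) (hC (f n).+1).
    by apply: le_trans h1 _; rewrite -/K3; move: h2; congr (_ <= _); ring.
  have [h1 _] := cmp n.
  apply: le_trans (ler_pM (norm_int_ge0 _ _) (norm_row_ge0 _ _) h1 hr) _.
  have -> : forall u v : R, K5 * u * ((1 + `|xi|) * v) = K5 * (1 + `|xi|) * (u * v).
    by move=> *; ring.
  apply: ler_wpM2l => //; rewrite mulr_ge0 ?addr_ge0 //; exact: ltW.
move=> B; have [k0 h] := X_large B; exists k0 => n hn.
apply: le_trans (nY n); apply: h.
have : (n <= f n)%N by elim: (n) => [//|m IH]; apply: leq_ltn_trans IH (f2 m).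
by move: hn; clear; lia.
Qed.
End Estimates.

Lemma extremal_approx_seq (R : realType) (xi : R) : extremal xi -> exists y, approx_seq xi y.
Proof.
move=> hx; have [q hq] := records_exist hx.
by apply: (records_approx_seq hq) => //; case: hx => h1 h2 _; exact: irrational_no_relation.
Qed.

Theorem theorem2p1 (R : realType) :
  (forall xi : R, extremal xi ->
     (exists W : nat -> 'M[int]_2,
        unbounded_admissible_fibonacci R W /\ star_condition xi W) /\
     (forall W W' : nat -> 'M[int]_2,
        unbounded_admissible_fibonacci R W -> star_condition xi W ->
        unbounded_admissible_fibonacci R W' -> star_condition xi W' ->
        exists (k l : nat) (eps : nat -> int),
          sign_fibonacci_seq eps /\
          exists i0 : nat, forall i : nat, (i0 <= i)%N ->
            W' (i + k)%N = eps i *: W (i + l)%N)) /\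
  (forall W : nat -> 'M[int]_2,
     unbounded_admissible_fibonacci R W ->
     lesssim (fun i => norm_int R (W i.+1) * norm_int R (W i))
             (fun i => norm_int R (W i.+2)) ->
     lesssim (fun i => abs_det R (W i)) (fun=> 1) ->
     exists xi : R, extremal xi /\ star_condition xi W).
Proof.
split; last exact: growth_extremal.
move=> xi hx; split; last exact: fibonacci_unique.
by have [y hy] := extremal_approx_seq hx; exact: approx_seq_fibonacci hy.
Qed.
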